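(* Let $n\ge1$ be an integer, let $q$ and $k$ be integers with $2\le q\le n+1$ and $k\ge0$, and put $m=n+1-q$, $\beta=k/q$ and $\rho=1+\beta$. Consider the differential equation $$w^{(n+1)}=z^k w^{(m)}.$$ Let $f_0,\ldots,f_n$ be its entire solutions with initial values $f_j^{(i)}(0)=\delta_{ij}$ for $0\le i,j\le n$. Then $\boldsymbol f=(f_0,\ldots,f_n)$ is a reduced representation of a transcendental linearly non-degenerate holomorphic curve $\mathbb{C}\to\mathbb{P}^n$, its Wronskian satisfies $W(\boldsymbol f)\equiv1$, and $$T(r,\boldsymbol f)\sim\frac{q\sin(\pi/q)}{\pi\rho}\,r^{\rho}\qquad(r\to\infty).$$
   Context: $\delta_{ij}$ is the Kronecker delta. A reduced representation of a holomorphic curve $f\colon\mathbb{C}\to\mathbb{P}^n$ is a vector $\boldsymbol f=(f_0,\ldots,f_n)$ of entire functions with no common zeros such that $f=[\boldsymbol f]$. The curve is linearly non-degenerate if $f_0,\ldots,f_n$ are linearly independent over $\mathbb{C}$. It is rational if it extends holomorphically to $\mathbb{P}^1$ (equivalently, has a representation with polynomial coordinates), and transcendental otherwise. The Wronskian is $W(\boldsymbol f)=\det\bigl(f_j^{(i)}\bigr)_{0\le i,j\le n}$. The characteristic is $T(r,\boldsymbol f)=\frac1{2\pi}\int_{-\pi}^{\pi}\log\|\boldsymbol f(re^{it})\|\,dt-\log\|\boldsymbol f(0)\|$, with $\|\cdot\|$ the Euclidean norm. *)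

(* Defs.v *)
From HB Require Import structures.
From mathcomp Require Import all_boot all_order all_algebra.
From mathcomp Require Import complex.
From mathcomp Require Import all_classical all_reals all_analysis.

Set Implicit Arguments.
Unset Strict Implicit.
Unset Printing Implicit Defensive.

Import Order.TTheory GRing.Theory Num.Theory.
Import numFieldNormedType.Exports.

Local Open Scope classical_set_scope.
Local Open Scope ring_scope.

(* [R[i]] does not inherit the topology by itself; going through
   [numClosedFieldType] gives it the normed structure over itself, for which
   [derivable _ _ 1] and [derive1n] are complex differentiation. *)
Definition Cplx (R : realType) : numClosedFieldType := R[i].

Definition entire (R : realType) (f : Cplx R -> Cplx R) : Prop :=
  forall z : Cplx R, derivable f z 1.

(* Points of P^n are the lines through the origin of C^(n+1). *)
Definition projspace (R : realType) (n : nat) :=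
  {U : {vspace 'rV[Cplx R]_n.+1} | \dim U == 1%N}.

Lemma dim_line (R : realType) (n : nat) (v : 'rV[Cplx R]_n.+1) :
  v != 0 -> \dim <[v]>%VS == 1%N.
Proof. by move=> v0; rewrite dim_vline v0. Qed.

Definition proj_point (R : realType) (n : nat) (v : 'rV[Cplx R]_n.+1)
    (v0 : v != 0) : projspace R n :=
  exist _ <[v]>%VS (dim_line v0).

(* Holomorphy at a point, by a local lift to C^(n+1); the lift does not vanish
   near [z0], since [<[g z]>] has dimension 1 there. *)
Definition holomorphic_at (R : realType) (n : nat)
    (F : Cplx R -> projspace R n) (z0 : Cplx R) : Prop :=
  exists g : 'I_n.+1 -> Cplx R -> Cplx R,
    \forall z \near z0,
      (forall j, derivable (g j) z 1) /\ val (F z) = <[\row_j g j z]>%VS.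

Definition holomorphic_curve (R : realType) (n : nat)
    (F : Cplx R -> projspace R n) : Prop :=
  forall z : Cplx R, holomorphic_at F z.

Lemma affine_vec_neq0 (R : realType) (z : Cplx R) :
  \row_(j < 2) (if j == 0 then 1 else z) != 0 :> 'rV[Cplx R]_2.
Proof.
by apply/eqP => /matrixP /(_ 0 0); rewrite !mxE eqxx => /eqP; rewrite oner_eq0.
Qed.

Lemma infinity_vec_neq0 (R : realType) (w : Cplx R) :
  \row_(j < 2) (if j == 0 then w else 1) != 0 :> 'rV[Cplx R]_2.
Proof.
by apply/eqP => /matrixP /(_ 0 1); rewrite !mxE /= => /eqP; rewrite oner_eq0.
Qed.

(* The two charts of P^1: [z |-> [1 : z]], the embedding of C, and
   [w |-> [w : 1]], centred at infinity. *)
Definition affine_chart (R : realType) (z : Cplx R) : projspace R 1 :=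
  proj_point (affine_vec_neq0 z).

Definition infinity_chart (R : realType) (w : Cplx R) : projspace R 1 :=
  proj_point (infinity_vec_neq0 w).

Definition holomorphic_on_P1 (R : realType) (n : nat)
    (G : projspace R 1 -> projspace R n) : Prop :=
  holomorphic_curve (fun z => G (affine_chart z)) /\
  holomorphic_curve (fun w => G (infinity_chart w)).

Definition rational_curve (R : realType) (n : nat)
    (F : Cplx R -> projspace R n) : Prop :=
  exists2 G : projspace R 1 -> projspace R n,
    holomorphic_on_P1 G & forall z, G (affine_chart z) = F z.

Definition transcendental_curve (R : realType) (n : nat)
    (F : Cplx R -> projspace R n) : Prop :=
  ~ rational_curve F.

Definition reduced_representation (R : realType) (n : nat)
    (f : 'I_n.+1 -> Cplx R -> Cplx R) (F : Cplx R -> projspace R n) : Prop :=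
  [/\ forall j, entire (f j),
      forall z, exists j, f j z != 0 &
      forall z, val (F z) = <[\row_j f j z]>%VS].

Definition linearly_independent (R : realType) (n : nat)
    (f : 'I_n.+1 -> Cplx R -> Cplx R) : Prop :=
  forall c : 'I_n.+1 -> Cplx R,
    (forall z, \sum_j c j * f j z = 0) -> forall j, c j = 0.

Definition linearly_nondegenerate (R : realType) (n : nat)
    (F : Cplx R -> projspace R n) : Prop :=
  forall f : 'I_n.+1 -> Cplx R -> Cplx R,
    reduced_representation f F -> linearly_independent f.

Definition wronskian (R : realType) (n : nat)
    (f : 'I_n.+1 -> Cplx R -> Cplx R) (z : Cplx R) : Cplx R :=
  \det (\matrix_(i < n.+1, j < n.+1) derive1n i (f j) z).

Definition eucl_norm (R : realType) (n : nat)
    (f : 'I_n.+1 -> Cplx R -> Cplx R) (z : Cplx R) : R :=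
  Num.sqrt (\sum_j (complex.Re (f j z) ^+ 2 + complex.Im (f j z) ^+ 2)).

Definition polar (R : realType) (r t : R) : Cplx R :=
  Complex (r * cos t) (r * sin t).

Definition characteristic (R : realType) (n : nat)
    (f : 'I_n.+1 -> Cplx R -> Cplx R) (r : R) : R :=
  (2 * pi)^-1 *
    (\int[lebesgue_measure]_(t in `[- pi, pi]) ln (eucl_norm f (polar r t)))
  - ln (eucl_norm f 0).

(* The entire solutions of w^(n+1) = z^k w^(m) with f_j^(i)(0) = delta_ij. *)
Definition fundamental_solutions (R : realType) (n m k : nat)
    (f : 'I_n.+1 -> Cplx R -> Cplx R) : Prop :=
  [/\ forall j, entire (f j),
      forall j z, derive1n n.+1 (f j) z = z ^+ k * derive1n m (f j) z &
      forall i j : 'I_n.+1, derive1n i (f j) 0 = (i == j)%:R].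

(* Main.v *)
Require Import Defs.
From HB Require Import structures.
From mathcomp Require Import all_boot all_order all_algebra.
From mathcomp Require Import perm complex ring lra zify.
From mathcomp Require Import all_classical all_reals all_analysis.

(** Along the ray of argument [t], the jet [y_i = f^(i)(s e^(it))] of a solution,
with [y_i] divided by [(s^beta e^(i beta t))^i], satisfies the linear system
[Y_i' = mu s^beta Y_(i+1) - (i beta / s) Y_i], where [mu = e^(i rho t)] and the
index [n + 1] is identified with [m]. To leading order this is a cyclic shift of
the entries [m], ..., [n], with the [q]-th roots of unity as eigenvalues, together
with a nilpotent part on the entries below [m]. In the variable [s^rho / rho] the
component along a root [zeta] therefore grows at the rate [Re (mu zeta)], up to a
drift of order [1 / s]. In the sector [|rho t| < pi / q] the root 1 has the largest
rate, [cos (rho t)]. Gronwall estimates for the sum of the squared components give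
an upper bound for every solution ([ray_upper]); estimates for the difference
between the dominant square and the others give a lower bound for a solution that
starts in the dominant direction ([ray_lower]), which exists because the Wronskian
does not vanish. Hence [ln (eucl_norm f) / s^rho] tends to [cos (rho t) / rho] in
that sector ([ray_limit]).

With [N = q + k = q rho] and [w = e^(2 pi i / N)], the equation is invariant under
[z -> w z], and [f_j (w z) = w^j f_j z] ([fundamental_rotation]). So the norm is
the same on the [N] sectors of the plane, and the mean over a circle is
[N / (2 pi)] times the integral of [cos (rho t) / rho] over [|t| < pi / N], which is
the constant of the theorem. The passage to the limit is dominated by
[ln_norm_bound], a bound of order [s^rho] for [|ln (eucl_norm f)|] in all
directions; its lower half uses that the Wronskian is 1. The Wronskian is constant
because differentiating any row of its matrix produces a multiple of another row
([wronskian_const]).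

If the curve were rational, the ratios of its coordinates would have limits at
infinity independent of the direction. On the positive axis the system for the
jet has nonnegative coefficients, so that [f_m] and [f_(m+1)] are positive there
and dominate all coordinates ([fundamental_comparable]); their ratio then has a
finite nonzero limit, which contradicts the factor [w], different from 1, that the
rotation puts in front of it ([fundamental_not_rational]).

Existence comes from power series ([existence_fundamental]) and uniqueness from
Gronwall's inequality ([solution_unique]). As entire means complex differentiable
everywhere, the derivatives of entire functions are shown to be entire by
Goursat's theorem and Cauchy's formula ([entire_derive1]). *)

Set Implicit Arguments.
Unset Strict Implicit.
Unset Printing Implicit Defensive.

Import Order.TTheory GRing.Theory Num.Theory.
Import numFieldNormedType.Exports.

Local Open Scope classical_set_scope.
Local Open Scope ring_scope.

Local Notation Re := complex.Re.
Local Notation Im := complex.Im.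

(** * Real and complex numbers *)

Section ComplexModulus.
Variable R : realType.
Local Notation C := (Cplx R).
Implicit Types (x y : R) (z w : C).

Definition rc x : C := Complex x 0.

(** The norm of [Cplx R] takes its values in [Cplx R]; estimates between real
numbers use this modulus. *)
Definition cmod z : R := Num.sqrt (Re z ^+ 2 + Im z ^+ 2).

Lemma normE z : `|z| = rc (cmod z).
Proof. exact: normc_def. Qed.

Lemma C_ext z w : Re z = Re w -> Im z = Im w -> z = w.
Proof. by case: z => a b; case: w => c d /= -> ->. Qed.

Lemma rcD x y : rc (x + y) = rc x + rc y.
Proof. by apply: C_ext => //=; rewrite addr0. Qed.
Lemma rcN x : rc (- x) = - rc x.
Proof. by apply: C_ext => //=; rewrite oppr0. Qed.
Lemma rcB x y : rc (x - y) = rc x - rc y.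
Proof. by rewrite rcD rcN. Qed.
Lemma rcM x y : rc (x * y) = rc x * rc y.
Proof. by apply: C_ext => /=; ring. Qed.
Lemma rc0 : rc 0 = 0. Proof. by []. Qed.
Lemma rc1 : rc 1 = 1. Proof. by []. Qed.
Lemma rcX x n : rc (x ^+ n) = rc x ^+ n.
Proof. by elim: n => [|n ih]; rewrite ?expr0 // !exprS rcM ih. Qed.
Lemma rcMn n : rc n%:R = n%:R.
Proof. by elim: n => // n ih; rewrite -addn1 !natrD rcD ih. Qed.
Lemma rc_inj : injective rc. Proof. by move=> x y []. Qed.
Lemma rcV x : rc x^-1 = (rc x)^-1.
Proof.
have [->|x0] := eqVneq x 0; first by rewrite invr0 rc0 invr0.
have rx0 : rc x != 0 by apply: contra_neq x0 => /rc_inj.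
by apply: (mulfI rx0); rewrite -rcM !divff.
Qed.

Lemma ReD z w : Re (z + w) = Re z + Re w. Proof. by case: z; case: w. Qed.
Lemma ImD z w : Im (z + w) = Im z + Im w. Proof. by case: z; case: w. Qed.
Lemma ReN z : Re (- z) = - Re z. Proof. by case: z. Qed.
Lemma ImN z : Im (- z) = - Im z. Proof. by case: z. Qed.
Lemma ReB z w : Re (z - w) = Re z - Re w. Proof. by rewrite ReD ReN. Qed.
Lemma ImB z w : Im (z - w) = Im z - Im w. Proof. by rewrite ImD ImN. Qed.
Lemma ReM z w : Re (z * w) = Re z * Re w - Im z * Im w.
Proof. by case: z; case: w. Qed.
Lemma ImM z w : Im (z * w) = Re z * Im w + Im z * Re w.
Proof. by case: z; case: w. Qed.
Lemma Re0 : Re (0 : C) = 0. Proof. by []. Qed.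
Lemma Im0 : Im (0 : C) = 0. Proof. by []. Qed.
Lemma ReMrc x z : Re (rc x * z) = x * Re z.
Proof. by rewrite ReM /= mul0r subr0. Qed.
Lemma ImMrc x z : Im (rc x * z) = x * Im z.
Proof. by rewrite ImM /= mul0r addr0. Qed.

Lemma Re_sum (I : Type) (r : seq I) (P : pred I) (F : I -> C) :
  Re (\sum_(i <- r | P i) F i) = \sum_(i <- r | P i) Re (F i).
Proof. by apply: (big_morph _ ReD Re0). Qed.
Lemma Im_sum (I : Type) (r : seq I) (P : pred I) (F : I -> C) :
  Im (\sum_(i <- r | P i) F i) = \sum_(i <- r | P i) Im (F i).
Proof. by apply: (big_morph _ ImD Im0). Qed.
Lemma rc_le x y : (rc x <= rc y) = (x <= y).
Proof. by rewrite lecE /= eqxx. Qed.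
Lemma rc_lt x y : (rc x < rc y) = (x < y).
Proof. by rewrite ltcE /= eqxx. Qed.

Lemma cmod_ge0 z : 0 <= cmod z. Proof. exact: sqrtr_ge0. Qed.
Lemma cmod0 : cmod 0 = 0.
Proof. by apply: rc_inj; rewrite -normE normr0. Qed.
Lemma cmod1 : cmod 1 = 1.
Proof. by apply: rc_inj; rewrite -normE normr1. Qed.
Lemma cmod_eq0 z : (cmod z == 0) = (z == 0).
Proof.
rewrite -(normr_eq0 z) normE; apply/eqP/eqP => [->|] //.
by rewrite -rc0 => /rc_inj.
Qed.
Lemma cmod_gt0 z : (0 < cmod z) = (z != 0).
Proof. by rewrite lt_def cmod_ge0 andbT cmod_eq0. Qed.
Lemma cmodM z w : cmod (z * w) = cmod z * cmod w.
Proof. by apply: rc_inj; rewrite rcM -!normE normrM. Qed.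
Lemma cmodN z : cmod (- z) = cmod z.
Proof. by apply: rc_inj; rewrite -!normE normrN. Qed.
Lemma cmodV z : cmod z^-1 = (cmod z)^-1.
Proof. by apply: rc_inj; rewrite rcV -!normE normfV. Qed.
Lemma cmodX z n : cmod (z ^+ n) = cmod z ^+ n.
Proof. by apply: rc_inj; rewrite rcX -!normE normrX. Qed.
Lemma cmodD z w : cmod (z + w) <= cmod z + cmod w.
Proof. by rewrite -rc_le rcD -!normE ler_normD. Qed.
Lemma cmodB z w : cmod (z - w) <= cmod z + cmod w.
Proof. by rewrite -(cmodN w) cmodD. Qed.
Lemma cmodBC z w : cmod (z - w) = cmod (w - z).
Proof. by rewrite -cmodN opprB. Qed.
Lemma cmod_rc x : cmod (rc x) = `|x|.
Proof. by rewrite /cmod /= expr0n addr0 sqrtr_sqr. Qed.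
Lemma cmod_nat n : cmod n%:R = n%:R.
Proof. by rewrite -rcMn cmod_rc normr_nat. Qed.
Lemma cmod_sum (I : Type) (r : seq I) (P : pred I) (F : I -> C) :
  cmod (\sum_(i <- r | P i) F i) <= \sum_(i <- r | P i) cmod (F i).
Proof.
elim/big_ind2 : _ => [|a b c d h1 h2|//]; first by rewrite cmod0.
exact: le_trans (cmodD _ _) (lerD h1 h2).
Qed.
Lemma cmod_sqr z : cmod z ^+ 2 = Re z ^+ 2 + Im z ^+ 2.
Proof. by rewrite sqr_sqrtr // addr_ge0 // sqr_ge0. Qed.
Lemma Re_le_cmod z : `|Re z| <= cmod z.
Proof.
rewrite -(ler_pXn2r (_ : 0 < 2)%N) ?nnegrE ?cmod_ge0 ?normr_ge0 //.
by rewrite cmod_sqr real_normK ?num_real // lerDl sqr_ge0.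
Qed.
Lemma Im_le_cmod z : `|Im z| <= cmod z.
Proof.
rewrite -(ler_pXn2r (_ : 0 < 2)%N) ?nnegrE ?cmod_ge0 ?normr_ge0 //.
by rewrite cmod_sqr real_normK ?num_real // lerDr sqr_ge0.
Qed.
Lemma cmod_le_ReIm z : cmod z <= `|Re z| + `|Im z|.
Proof.
rewrite -(ler_pXn2r (_ : 0 < 2)%N) ?nnegrE ?cmod_ge0 ?addr_ge0 ?normr_ge0 //.
rewrite cmod_sqr sqrrD !real_normK ?num_real // lerD2r lerDl.
by rewrite mulrn_wge0 // mulr_ge0.
Qed.
Lemma cmod_triangle z w : cmod z <= cmod w + cmod (z - w).
Proof. by rewrite -[X in cmod X <= _](subrKC w) cmodD. Qed.
Lemma cmod_subr z w : cmod z - cmod w <= cmod (z - w).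
Proof. by rewrite lerBlDl cmod_triangle. Qed.

(** The inner product of the real plane. *)
Definition cdot (a b : C) : R := Re a * Re b + Im a * Im b.

Lemma cdot_le (a b : C) : `|cdot a b| <= cmod a * cmod b.
Proof.
have := Re_le_cmod (Complex (Re a) (- Im a) * b).
rewrite cmodM ReM /= (_ : cmod (Complex (Re a) (- Im a) : C) = cmod a); last first.
  by rewrite /cmod /= sqrrN.
by rewrite /cdot mulNr opprK.
Qed.

Lemma cdotB (z a b : C) : cdot z (a - b) = cdot z a - cdot z b.
Proof. by rewrite /cdot ReB ImB; ring. Qed.

Lemma cdotM (z c : C) : cdot z (c * z) = Re c * cmod z ^+ 2.
Proof. by rewrite /cdot ReM ImM cmod_sqr; ring. Qed.

End ComplexModulus.

Ltac nneg := repeat (first [ assumption | apply: ler01 | apply: ler0n | apply: cmod_ge0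
  | apply: sqr_ge0 | apply: normr_ge0 | apply: addr_ge0 | apply: exprn_ge0
  | apply: mulr_ge0 | apply: expR_ge0 | apply: powR_ge0 | apply: divr_ge0
  | apply: sumr_ge0 => ? _ | apply: ltW; assumption ]).

(** * Derivatives in the plane and of curves *)

Section Differentiation.
Variable R : realType.
Local Notation C := (Cplx R).

(** This form of differentiability has no quotient and includes [h = 0], so that
estimates compose directly; the real and the complex derivative are the two
cases used. *)
Lemma is_derive_littleP (K : numFieldType) (f : K -> K) (z l : K) :
  is_derive z 1 f l <->
  forall e : K, 0 < e -> exists2 d : K, 0 < d &
    forall h, `|h| < d -> `|f (z + h) - f z - h * l| <= e * `|h|.
Proof.
pose Q h := h^-1 *: (f (h *: (1 : K^o) + z) - f z).
have step h : h != 0 -> `|Q h - l| * `|h| = `|f (z + h) - f z - h * l|.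
  move=> h0; rewrite -normrM; congr `| _ |.
  rewrite /Q mulrBl mulrC /GRing.scale /= mulVKf // mulr1 [h + z]addrC.
  by rewrite (mulrC l).
split.
  move=> [dfz dl] e e0.
  have : Q h @[h --> 0^'] --> l by rewrite -dl; exact: dfz.
  move/cvgrPdist_le => /(_ e e0) [d /= d0 H]; exists d => // h hd.
  have [->|h0] := eqVneq h 0.
    by rewrite addr0 subrr mul0r subr0 normr0 mulr0.
  rewrite -step // ler_wpM2r //.
  by rewrite distrC; apply: H => //=; rewrite sub0r normrN.
move=> H.
have QH : Q h @[h --> 0^'] --> l.
  apply/cvgrPdist_le => e e0; have [d d0 Hd] := H e e0.
  exists d => //= h; rewrite /= sub0r normrN => hd h0.
  have hp : 0 < `|h| by rewrite normr_gt0.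
  by rewrite -(ler_pM2r hp) distrC step // Hd.
apply: DeriveDef; first by apply/cvg_ex; exists l.
exact: (cvg_lim _ QH).
Qed.

Lemma is_deriveRP (f : R -> R) (x l : R) :
  is_derive x 1 f l <->
  forall e, 0 < e -> exists2 d, 0 < d &
    forall h, `|h| < d -> `|f (x + h) - f x - h * l| <= e * `|h|.
Proof. exact: is_derive_littleP. Qed.

Lemma pos_rc (e : C) : 0 < e -> exists2 x : R, 0 < x & e = rc x.
Proof.
case: e => a b; rewrite ltcE /= => /andP[/eqP -> a0]; by exists a.
Qed.

Lemma is_deriveCP (f : C -> C) (z l : C) :
  is_derive z 1 f l <->
  forall e, 0 < e -> exists2 d : R, 0 < d &
    forall h, cmod h < d -> cmod (f (z + h) - f z - h * l) <= e * cmod h.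
Proof.
split.
  move=> /is_derive_littleP H e e0.
  have [] := H (rc e); first by rewrite -rc0 rc_lt.
  move=> _ /pos_rc[d d0 ->] Hd; exists d => // h hd.
  by rewrite -rc_le rcM -!normE Hd // normE rc_lt.
move=> H; apply/is_derive_littleP => _ /pos_rc[e e0 ->].
have [d d0 Hd] := H e e0; exists (rc d); first by rewrite -rc0 rc_lt.
by move=> h; rewrite !normE rc_lt -rcM rc_le => /Hd.
Qed.

(** Derivative of a curve in the complex plane, taken coordinatewise because
the plane is a normed space over itself only. *)
Definition rder (u : R -> C) (s : R) (v : C) :=
  is_derive s 1 (fun x => Re (u x)) (Re v) /\
  is_derive s 1 (fun x => Im (u x)) (Im v).

Lemma rderP (u : R -> C) s v :
  rder u s v <->
  forall e, 0 < e -> exists2 d : R, 0 < d &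
    forall h, `|h| < d -> cmod (u (s + h) - u s - rc h * v) <= e * `|h|.
Proof.
split.
  move=> [/is_deriveRP A /is_deriveRP B] e e0.
  have e2 : 0 < e / 2 by rewrite divr_gt0.
  have [d1 d10 H1] := A _ e2; have [d2 d20 H2] := B _ e2.
  exists (Num.min d1 d2); first by rewrite lt_min d10.
  move=> h; rewrite lt_min => /andP[h1 h2].
  apply: le_trans (cmod_le_ReIm _) _.
  rewrite !ReB !ImB ReMrc ImMrc.
  by apply: le_trans (lerD (H1 _ h1) (H2 _ h2)) _; rewrite -mulrDl -splitr.
move=> H; split; apply/is_deriveRP => e e0; have [d d0 Hd] := H e e0;
  exists d => // h hd; apply: le_trans _ (Hd h hd).
  by rewrite -ReMrc -!ReB Re_le_cmod.
by rewrite -ImMrc -!ImB Im_le_cmod.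
Qed.

Lemma rder_cst (c : C) s : rder (fun=> c) s 0.
Proof. by split; exact: is_derive_cst. Qed.

Lemma rder_rc (f : R -> R) (s l : R) : is_derive s 1 f l -> rder (fun x => rc (f x)) s (rc l).
Proof. by move=> H; split => //=; exact: is_derive_cst. Qed.

Lemma rderD u v s du dv :
  rder u s du -> rder v s dv -> rder (fun x => u x + v x) s (du + dv).
Proof.
move=> [a b] [c d]; split.
  by under eq_fun do rewrite ReD; rewrite ReD; exact: is_deriveD.
by under eq_fun do rewrite ImD; rewrite ImD; exact: is_deriveD.
Qed.

Lemma rderN u s du : rder u s du -> rder (fun x => - u x) s (- du).
Proof.
move=> [a b]; split.
  by under eq_fun do rewrite ReN; rewrite ReN; exact: is_deriveN.
by under eq_fun do rewrite ImN; rewrite ImN; exact: is_deriveN.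
Qed.

Lemma rderB u v s du dv :
  rder u s du -> rder v s dv -> rder (fun x => u x - v x) s (du - dv).
Proof. by move=> a b; apply: rderD => //; exact: rderN. Qed.

Lemma is_deriveRM (f g : R -> R) (s df dg : R) : is_derive s 1 f df ->
  is_derive s 1 g dg -> is_derive s 1 (fun x => f x * g x) (df * g s + f s * dg).
Proof.
move=> a b; apply: (is_derive_eq (is_deriveM a b)).
by rewrite /GRing.scale /= addrC; congr (_ + _); rewrite mulrC.
Qed.

Lemma is_derive_compR (f g : R -> R) (s a b : R) : is_derive (g s) 1 f a ->
  is_derive s 1 g b -> is_derive s 1 (fun x => f (g x)) (a * b).
Proof. exact: (@is_derive1_comp R f g s a b). Qed.

Lemma is_derive_linR (c s : R) : is_derive s 1 (fun t => c * t) c.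
Proof.
apply: (is_derive_eq (is_deriveRM (is_derive_cst c s 1) (is_derive_id s 1))).
by rewrite mul0r add0r mulr1.
Qed.

Lemma is_derive_affineR (a b s : R) : is_derive s 1 (fun t => a + b * t) b.
Proof.
apply: (is_derive_eq (is_deriveD (is_derive_cst a s 1) (is_derive_linR b s))).
by rewrite add0r.
Qed.

Lemma rderM u v s du dv :
  rder u s du -> rder v s dv -> rder (fun x => u x * v x) s (du * v s + u s * dv).
Proof.
move=> [a b] [c d]; split.
  under eq_fun do rewrite ReM.
  apply: (is_derive_eq (is_deriveB (is_deriveRM a c) (is_deriveRM b d))).
  by rewrite ReD !ReM; ring.
under eq_fun do rewrite ImM.
apply: (is_derive_eq (is_deriveD (is_deriveRM a d) (is_deriveRM b c))).
by rewrite ImD !ImM; ring.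
Qed.

Lemma rder_chain (f : C -> C) (u : R -> C) (s : R) (v l : C) :
  is_derive (u s) 1 f l -> rder u s v -> rder (fun x => f (u x)) s (v * l).
Proof.
move=> /is_deriveCP H /rderP K; apply/rderP => e e0.
pose A := cmod l + 1; pose B := cmod v + 1.
have A0 : 0 < A by rewrite ltr_wpDl // cmod_ge0.
have B0 : 0 < B by rewrite ltr_wpDl // cmod_ge0.
have e1 : 0 < e / 2 / B by rewrite !divr_gt0.
have e2 : 0 < Num.min 1 (e / 2 / A) by rewrite lt_min ltr01 !divr_gt0.
have [d1 d10 H1] := H _ e1; have [d2 d20 K1] := K _ e2.
exists (Num.min d2 (d1 / B)); first by rewrite lt_min d20 divr_gt0.
move=> h; rewrite lt_min => /andP[hd2]; rewrite ltr_pdivlMr // => hd1.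
have k1 := K1 h hd2.
have kd : u (s + h) = u s + (u (s + h) - u s) by ring.
set w := u (s + h) - u s in k1 kd.
have wB : cmod w <= `|h| * B.
  rewrite (_ : w = (w - rc h * v) + rc h * v); last by ring.
  apply: le_trans (cmodD _ _) _; rewrite cmodM cmod_rc /B mulrDr mulr1 addrC lerD2l.
  by apply: le_trans k1 _; rewrite ler_piMl // ge_min lexx.
rewrite kd (_ : _ - _ = (f (u s + w) - f (u s) - w * l) + (w - rc h * v) * l); last by ring.
apply: le_trans (cmodD _ _) _.
rewrite (_ : e * `|h| = e / 2 * `|h| + e / 2 * `|h|); last by field.
apply: lerD.
  apply: le_trans (H1 w (le_lt_trans wB hd1)) _.
  apply: le_trans (ler_wpM2l (ltW e1) wB) _.
  by rewrite mulrCA divfK ?gt_eqF // mulrC.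
rewrite cmodM; apply: le_trans (ler_wpM2r (cmod_ge0 _) k1) _.
apply: le_trans (_ : e / 2 / A * `|h| * A <= _).
  apply: ler_pM; rewrite ?cmod_ge0 ?mulr_ge0 ?(ltW e2) ?lerDl //.
  by rewrite ler_wpM2r // ge_min lexx orbT.
by rewrite mulrAC divfK // gt_eqF.
Qed.

Lemma rder_comp (f : C -> C) (a e l : C) s :
  is_derive (a + rc s * e) 1 f l -> rder (fun x => f (a + rc x * e)) s (e * l).
Proof.
move=> df; apply: rder_chain df _.
have := rderD (rder_cst a s) (rderM (rder_rc (is_derive_id s 1)) (rder_cst e s)).
by rewrite rc1 mul1r mulr0 addr0 add0r.
Qed.

Lemma rderZ (c : C) u s du : rder u s du -> rder (fun x => c * u x) s (c * du).
Proof.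
by move=> h; have := rderM (rder_cst c s) h; rewrite mul0r add0r.
Qed.

Lemma rder_sum (I : Type) (r : seq I) (P : pred I) (u : I -> R -> C) (v : I -> C) s :
  (forall i, P i -> rder (u i) s (v i)) ->
  rder (fun x => \sum_(i <- r | P i) u i x) s (\sum_(i <- r | P i) v i).
Proof.
move=> H; elim: r => [|i r ih].
  by rewrite big_nil; under eq_fun do rewrite big_nil; exact: rder_cst.
rewrite big_cons; under eq_fun do rewrite big_cons.
by case: ifP => // Pi; apply: rderD; [exact: H|].
Qed.

Lemma is_derive_cmod2 u s v : rder u s v ->
  is_derive s 1 (fun x => cmod (u x) ^+ 2) (2 * (Re (u s) * Re v + Im (u s) * Im v)).
Proof.
move=> [a b]; under eq_fun do rewrite cmod_sqr !expr2.
apply: (is_derive_eq (is_deriveD (is_deriveRM a a) (is_deriveRM b b))).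
by ring.
Qed.

Lemma is_derive_sumR (I : Type) (r : seq I) (P : pred I) (u : I -> R -> R) (v : I -> R) (s : R) :
  (forall i, P i -> is_derive s 1 (u i) (v i)) ->
  is_derive s 1 (fun x => \sum_(i <- r | P i) u i x) (\sum_(i <- r | P i) v i).
Proof.
move=> H; elim: r => [|i r ih].
  by rewrite big_nil; under eq_fun do rewrite big_nil; exact: is_derive_cst.
rewrite big_cons; under eq_fun do rewrite big_cons.
by case: ifP => // Pi; apply: (is_deriveD (H i Pi) ih).
Qed.

Lemma is_derive_lipschitz (f : C -> C) (z l : C) : is_derive z 1 f l ->
  exists2 d : R, 0 < d &
    forall h, cmod h < d -> cmod (f (z + h) - f z) <= (1 + cmod l) * cmod h.
Proof.
move=> /is_deriveCP/(_ 1 ltr01)[d d0 H]; exists d => // h /H hd.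
rewrite -[X in cmod X](subrK (h * l)); apply: le_trans (cmodD _ _) _.
by rewrite mulrDl [cmod l * _]mulrC -cmodM lerD.
Qed.

Lemma is_derive_epsdelta (f : C -> C) (z l : C) : is_derive z 1 f l ->
  forall e, 0 < e -> exists2 d : R, 0 < d &
    forall h, cmod h < d -> cmod (f (z + h) - f z) < e.
Proof.
move=> /is_derive_lipschitz[d d0 H] e e0.
have M0 : 0 < 1 + cmod l by rewrite ltr_pwDl // cmod_ge0.
exists (Num.min d (e / (1 + cmod l))); first by rewrite lt_min d0 divr_gt0.
move=> h; rewrite lt_min ltr_pdivlMr // mulrC => /andP[/H h1 h2].
exact: le_lt_trans h1 h2.
Qed.

Lemma rder_continuous u s v : rder u s v ->
  {for s, continuous (fun x => Re (u x))} /\ {for s, continuous (fun x => Im (u x))}.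
Proof.
by move=> [[/derivable1_diffP/differentiable_continuous ? _]
  [/derivable1_diffP/differentiable_continuous ? _]].
Qed.

(** * Monotonicity and Gronwall estimates *)

Lemma nondecreasing_der (f df : R -> R) (a b : R) : a <= b ->
  (forall x, a <= x <= b -> is_derive x 1 f (df x)) ->
  (forall x, a <= x <= b -> 0 <= df x) -> f a <= f b.
Proof.
move=> ab H H0.
have [||c cab E] := @MVT_segment R f df a b ab.
- by move=> x; rewrite in_itv /= => /andP[/ltW h1 /ltW h2]; apply: H; rewrite h1.
- apply: derivable_within_continuous => x; rewrite in_itv /= => hx.
  by have [] := H x hx.
rewrite -subr_ge0 E mulr_ge0 ?subr_ge0 //; apply: H0.
by move: cab; rewrite in_itv.
Qed.

(** The function [f * expR (- A)] is nonincreasing. *)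
Lemma le_exp_gronwall (f df A dA : R -> R) (a b : R) : a <= b ->
  (forall x, a <= x <= b -> is_derive x 1 f (df x)) ->
  (forall x, a <= x <= b -> is_derive x 1 A (dA x)) ->
  (forall x, a <= x <= b -> df x <= dA x * f x) ->
  f b <= f a * expR (A b - A a).
Proof.
move=> ab Hf HA H.
have dE x : a <= x <= b -> is_derive x 1 (fun y => - (f y * expR (- A y)))
    (- (df x * expR (- A x) + f x * (- dA x * expR (- A x)))).
  move=> hx; apply: is_deriveN; apply: is_deriveRM; first exact: Hf.
  apply: (is_derive_eq (is_derive_compR (is_derive_expR _)
    (is_deriveN (HA x hx)))).
  by rewrite mulrC.
have /(_ _)/= := nondecreasing_der ab dE.
rewrite lerN2 => /(_ _) h.
have {}h : f b * expR (- A b) <= f a * expR (- A a).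
  apply: h => x hx; rewrite oppr_ge0 mulrA -mulrDl mulr_le0_ge0 ?expR_ge0 //.
  by rewrite mulrN mulrC subr_le0 H.
move: h; rewrite !expRN -(ler_pM2r (expR_gt0 (A b))) mulfVK ?gt_eqF ?expR_gt0 //.
by rewrite expRD expRN [expR (A b) * _]mulrC mulrA.
Qed.

Lemma zero_der_const (f : R -> R) (a b : R) : a <= b ->
  (forall x, a <= x <= b -> is_derive x 1 f 0) -> f b = f a.
Proof.
move=> ab H; apply/eqP; rewrite eq_le; apply/andP; split.
  rewrite -lerN2; apply: (@nondecreasing_der (fun x => - f x) (fun=> - 0)) => //.
  by move=> x hx; apply: is_deriveN; exact: H.
by apply: (@nondecreasing_der f (fun=> 0)).
Qed.

Lemma rder0_const (u : R -> C) (a b : R) : a <= b ->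
  (forall x, a <= x <= b -> rder u x 0) -> u b = u a.
Proof.
move=> ab H; apply: C_ext.
  by apply: (@zero_der_const (fun x => Re (u x))) => // x hx; have [] := H x hx.
by apply: (@zero_der_const (fun x => Im (u x))) => // x hx; have [] := H x hx.
Qed.

End Differentiation.

(** * Primitives and integrals of curves *)

Section Primitives.
Variable R : realType.
Local Notation C := (Cplx R).
Local Notation mu := (@lebesgue_measure R).

Lemma Rintegral_primitive (f F : R -> R) (a b : R) : a < b ->
  (forall x : R, {for x, continuous f}) ->
  (forall x, a <= x <= b -> is_derive x 1 F (f x)) ->
  \int[mu]_(x in `[a, b]) f x = F b - F a.
Proof.
move=> ab cf dF; rewrite /Rintegral (@continuous_FTC2 R f F a b ab) //.
- by apply: continuous_subspaceT => x; exact: cf.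
- have cF x : a <= x <= b -> {for x, continuous F}.
    by move=> /dF[/derivable1_diffP/differentiable_continuous].
  split.
  + by move=> x; rewrite in_itv /= => /andP[/ltW ? /ltW ?]; have [] := dF x _; first by apply/andP.
  + by apply: cvg_at_right_filter; apply: cF; rewrite lexx ltW.
  + by apply: cvg_at_left_filter; apply: cF; rewrite lexx ltW.
- move=> x; rewrite in_itv /= => /andP[/ltW xa /ltW xb].
  by rewrite derive1E; have [] := dF x _; first by apply/andP.
Qed.

Lemma continuous_primitive (f : R -> R) (a : R) :
  (forall x : R, {for x, continuous f}) ->
  exists F : R -> R, forall x, a <= x -> is_derive x 1 F (f x).
Proof.
(* starting at [a - 1] makes [a] an interior point, where the derivative is
   two-sided *)
move=> cf; exists (fun x => \int[mu]_(t in `[a - 1, x]) f t) => x ax.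
have int : mu.-integrable `[a - 1, x + 1] (EFin \o f).
  apply: continuous_compact_integrable; first exact: segment_compact.
  by apply: continuous_subspaceT => y; exact: cf.
have xx1 : x < x + 1 by rewrite ltrDl.
have [|d1 d2] := continuous_FTC1 xx1 int _ (cf x).
  by rewrite /= lte_fin (lt_le_trans _ ax) // gtrBl.
by apply: DeriveDef; [exact: d1|rewrite -derive1E; exact: d2].
Qed.

(** Continuity of a curve, coordinatewise for the same reason as [rder]. *)
Definition ccont (u : R -> C) := forall s : R,
  (Re (u x) @[x --> s] --> Re (u s)) /\ (Im (u x) @[x --> s] --> Im (u s)).

Lemma ccont_rder u v : (forall s, rder u s (v s)) -> ccont u.
Proof. by move=> H s; exact: rder_continuous (H s). Qed.

Lemma ccontZ (c : C) u : ccont u -> ccont (fun s => c * u s).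
Proof.
move=> H s; have [a b] := H s; split.
  rewrite (_ : (fun x => Re _) = (fun x => Re c * Re (u x) - Im c * Im (u x))).
    by rewrite ReM; apply: cvgB; apply: cvgM => //; exact: cvg_cst.
  by apply/funext => x; rewrite ReM.
rewrite (_ : (fun x => Im _) = (fun x => Re c * Im (u x) + Im c * Re (u x))).
  by rewrite ImM; apply: cvgD; apply: cvgM => //; exact: cvg_cst.
by apply/funext => x; rewrite ImM.
Qed.

Lemma ccontD u v : ccont u -> ccont v -> ccont (fun s => u s + v s).
Proof.
move=> H K s; have [a b] := H s; have [c d] := K s; split.
  rewrite (_ : (fun x => Re _) = (fun x => Re (u x) + Re (v x))).
    by rewrite ReD; exact: cvgD.
  by apply/funext => x; rewrite ReD.
rewrite (_ : (fun x => Im _) = (fun x => Im (u x) + Im (v x))).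
  by rewrite ImD; exact: cvgD.
by apply/funext => x; rewrite ImD.
Qed.

Definition cint (u : R -> C) : C :=
  Complex (\int[mu]_(x in `[0, 1]) Re (u x)) (\int[mu]_(x in `[0, 1]) Im (u x)).

(** Curves are integrated by means of primitives: linearity, subdivision and
estimates all go through this formula. *)
Lemma cint_rder (u U : R -> C) : ccont u ->
  (forall s, 0 <= s <= 1 -> rder U s (u s)) -> cint u = U 1 - U 0.
Proof.
move=> cu H; apply: C_ext; rewrite ?ReB ?ImB.
  apply: (@Rintegral_primitive (fun x => Re (u x)) (fun x => Re (U x))) => //.
    by move=> x; have [] := cu x.
  by move=> x hx; have [] := H x hx.
apply: (@Rintegral_primitive (fun x => Im (u x)) (fun x => Im (U x))) => //.
  by move=> x; have [] := cu x.
by move=> x hx; have [] := H x hx.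
Qed.

Lemma rder_primitive (u : R -> C) : ccont u ->
  exists U, forall s, 0 <= s -> rder U s (u s).
Proof.
move=> cu; have [U1 H1] := @continuous_primitive (fun x => Re (u x)) 0 (fun x => proj1 (cu x)).
have [U2 H2] := @continuous_primitive (fun x => Im (u x)) 0 (fun x => proj2 (cu x)).
by exists (fun x => Complex (U1 x) (U2 x) : C) => s s0; split; [exact: H1|exact: H2].
Qed.

Lemma cintD u v : ccont u -> ccont v -> cint (fun s => u s + v s) = cint u + cint v.
Proof.
move=> cu cv; have [U HU] := rder_primitive cu; have [V HV] := rder_primitive cv.
rewrite (@cint_rder _ (fun s => U s + V s)); last 2 first.
- exact: ccontD.
- by move=> s /andP[s0 _]; apply: rderD; [exact: HU|exact: HV].
rewrite (cint_rder cu (U := U)); last by move=> s /andP[s0 _]; exact: HU.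
rewrite (cint_rder cv (U := V)); last by move=> s /andP[s0 _]; exact: HV.
by ring.
Qed.

Lemma cintZ c u : ccont u -> cint (fun s => c * u s) = c * cint u.
Proof.
move=> cu; have [U HU] := rder_primitive cu.
rewrite (@cint_rder _ (fun s => c * U s)); last 2 first.
- exact: ccontZ.
- by move=> s /andP[s0 _]; apply: rderZ; exact: HU.
rewrite (cint_rder cu (U := U)); last by move=> s /andP[s0 _]; exact: HU.
by ring.
Qed.

Lemma cintB u v : ccont u -> ccont v -> cint (fun s => u s - v s) = cint u - cint v.
Proof.
move=> cu cv; have -> : (fun s => u s - v s) = (fun s => u s + (-1) * v s).
  by apply/funext => s; rewrite mulN1r.
by rewrite cintD ?cintZ ?mulN1r //; exact: ccontZ.
Qed.

Lemma real_increment_le (f df : R -> R) (a b M : R) : a <= b ->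
  (forall x, a <= x <= b -> is_derive x 1 f (df x)) ->
  (forall x, a <= x <= b -> `|df x| <= M) -> `|f b - f a| <= M * (b - a).
Proof.
move=> ab H HM.
have H1 : M * a - f a <= M * b - f b.
  apply: (@nondecreasing_der _ (fun x => M * x - f x) (fun x => M - df x)) => //.
    by move=> x hx; apply: is_deriveB (is_derive_linR M x) (H x hx).
  by move=> x hx; rewrite subr_ge0 (le_trans (ler_norm _) (HM x hx)).
have H2 : M * a + f a <= M * b + f b.
  apply: (@nondecreasing_der _ (fun x => M * x + f x) (fun x => M + df x)) => //.
    by move=> x hx; apply: is_deriveD (is_derive_linR M x) (H x hx).
  by move=> x hx; rewrite -[df x]opprK subr_ge0 (le_trans (ler_norm _)) // normrN HM.
by rewrite ler_norml; apply/andP; split; rewrite mulrBr; lra.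
Qed.

(** The factor 2 comes from treating the two coordinates separately. *)
Lemma increment_le (u v : R -> C) (a b M : R) : a <= b ->
  (forall s, a <= s <= b -> rder u s (v s)) ->
  (forall s, a <= s <= b -> cmod (v s) <= M) ->
  cmod (u b - u a) <= 2 * M * (b - a).
Proof.
move=> ab H HM; apply: le_trans (cmod_le_ReIm _) _.
rewrite ReB ImB -mulrA mulr_natl mulr2n lerD //.
  apply: (@real_increment_le (fun x => Re (u x)) (fun x => Re (v x))) => // x hx.
    by have [] := H x hx.
  exact: le_trans (Re_le_cmod _) (HM x hx).
apply: (@real_increment_le (fun x => Im (u x)) (fun x => Im (v x))) => // x hx.
  by have [] := H x hx.
exact: le_trans (Im_le_cmod _) (HM x hx).
Qed.

Lemma cint_le u M : ccont u -> (forall s, 0 <= s <= 1 -> cmod (u s) <= M) ->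
  cmod (cint u) <= 2 * M.
Proof.
move=> cu H; have [U HU] := rder_primitive cu.
have HU' s : 0 <= s <= 1 -> rder U s (u s) by move=> /andP[s0 _]; exact: HU.
rewrite (cint_rder cu HU') -[2 * M]mulr1 -[X in _ * X](subr0 1).
exact: increment_le HU' H.
Qed.

End Primitives.

(** * Integrals over segments and triangles *)

Section Goursat.
Variable R : realType.
Local Notation C := (Cplx R).

Definition seg (f : C -> C) (p q : C) : C :=
  (q - p) * cint (fun t => f (p + rc t * (q - p))).

Definition seg_cont (f : C -> C) (p q : C) := ccont (fun t => f (p + rc t * (q - p))).

Definition triangle f (p q r : C) := seg f p q + seg f q r + seg f r p.

Lemma entire_rder (f : C -> C) : entire f -> forall p d s,
  rder (fun t => f (p + rc t * d)) s (d * derive1 f (p + rc s * d)).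
Proof.
move=> ef p d s; apply: rder_comp; rewrite derive1E.
by apply: DeriveDef; [exact: ef|].
Qed.

Lemma entire_seg_cont (f : C -> C) : entire f -> forall p q, seg_cont f p q.
Proof. by move=> ef p q; exact: ccont_rder (fun s => entire_rder ef p (q - p) s). Qed.

Lemma seg_primitive (f F : C -> C) p q : seg_cont f p q ->
  (forall t : R, 0 <= t <= 1 ->
    is_derive (p + rc t * (q - p)) 1 F (f (p + rc t * (q - p)))) ->
  seg f p q = F q - F p.
Proof.
move=> cf dF; rewrite /seg -cintZ //.
rewrite (@cint_rder _ _ (fun t => F (p + rc t * (q - p)))).
- by rewrite rc0 rc1 mul0r addr0 mul1r subrKC.
- exact: ccontZ.
- by move=> s hs; apply: rder_comp; exact: dF.
Qed.

Lemma rder_affine (u : R -> C) (v : C) (a b s : R) :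
  rder u (a + b * s) v -> rder (fun t => u (a + b * t)) s (rc b * v).
Proof.
have dA := is_derive_affineR a b s.
move=> [h1 h2]; split; rewrite ?ReMrc ?ImMrc mulrC.
  exact: (@is_derive_compR _ (fun x => Re (u x)) (fun t => a + b * t) _ _ _ h1 dA).
exact: (@is_derive_compR _ (fun x => Im (u x)) (fun t => a + b * t) _ _ _ h2 dA).
Qed.

(** Reversal and bisection of a segment are the cases where [a] and [b] are among
0, 1/2 and 1. *)
Lemma seg_affine f p q (a b : R) : seg_cont f p q -> 0 <= a <= 1 -> 0 <= b <= 1 ->
  forall U, (forall s, 0 <= s -> rder U s (f (p + rc s * (q - p)))) ->
  seg f (p + rc a * (q - p)) (p + rc b * (q - p)) = (q - p) * (U b - U a).
Proof.
move=> cf /andP[a0 a1] /andP[b0 b1] U HU.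
have E t : p + rc a * (q - p) + rc t * (p + rc b * (q - p) - (p + rc a * (q - p)))
    = p + rc (a + (b - a) * t) * (q - p).
  by rewrite rcD rcM rcB; ring.
have cU : ccont (fun t => f (p + rc (a + (b - a) * t) * (q - p))).
  move=> s; have [c1 c2] := cf (a + (b - a) * s).
  have cA : {for s, continuous (fun t : R => a + (b - a) * t)}.
    apply: continuousD; first exact: cst_continuous.
    by apply: continuousM; first exact: cst_continuous.
  by split; [exact: (continuous_comp cA c1)|exact: (continuous_comp cA c2)].
rewrite /seg; under [X in cint X]eq_fun do rewrite E.
have -> : p + rc b * (q - p) - (p + rc a * (q - p)) = (q - p) * rc (b - a).
  by rewrite rcB; ring.
rewrite -mulrA -cintZ //; congr (_ * _).
rewrite (@cint_rder _ _ (fun t => U (a + (b - a) * t))).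
- by rewrite mulr1 mulr0 addr0 subrKC.
- exact: ccontZ.
- move=> s /andP[s0 s1]; apply: rder_affine; apply: HU.
  have : a + (b - a) * s = a * (1 - s) + b * s by ring.
  by move=> ->; rewrite addr_ge0 // mulr_ge0 // subr_ge0.
Qed.

Lemma segN f p q : seg_cont f p q -> seg f q p = - seg f p q.
Proof.
move=> cf; have [U HU] := rder_primitive cf.
have := @seg_affine f p q 1 0 cf _ _ U HU.
have := @seg_affine f p q 0 1 cf _ _ U HU.
rewrite rc0 rc1 mul0r addr0 mul1r subrKC !lexx ler01 => -> // -> //.
by ring.
Qed.

Definition mid (p q : C) : C := p + rc (2^-1) * (q - p).

Lemma midC p q : mid p q = mid q p.
Proof.
rewrite /mid rcV rcMn.
have two : (2 : C) != 0 by rewrite pnatr_eq0.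
by field.
Qed.

Lemma seg_mid f p q : seg_cont f p q -> seg f p q = seg f p (mid p q) + seg f (mid p q) q.
Proof.
move=> cf; have [U HU] := rder_primitive cf.
have h2 : 0 <= (2^-1 : R) <= 1 by apply/andP; split; lra.
have := @seg_affine f p q 0 1 cf _ _ U HU.
have := @seg_affine f p q 0 2^-1 cf _ h2 U HU.
have := @seg_affine f p q 2^-1 1 cf h2 _ U HU.
rewrite -/(mid p q) rc0 rc1 mul0r addr0 mul1r subrKC !lexx ler01 => -> // -> // -> //.
by ring.
Qed.

Lemma seg_le f p q M : seg_cont f p q ->
  (forall t, 0 <= t <= 1 -> cmod (f (p + rc t * (q - p))) <= M) ->
  cmod (seg f p q) <= 2 * M * cmod (q - p).
Proof.
move=> cf H; rewrite cmodM mulrC ler_wpM2r ?cmod_ge0 //; exact: cint_le.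
Qed.

Lemma segB f g p q : seg_cont f p q -> seg_cont g p q ->
  seg (fun z => f z - g z) p q = seg f p q - seg g p q.
Proof. by move=> cf cg; rewrite /seg cintB // mulrBr. Qed.

Lemma triangle_split f p q r : entire f ->
  triangle f p q r = triangle f p (mid p q) (mid p r) + triangle f (mid p q) q (mid q r) +
    triangle f (mid p r) (mid q r) r + triangle f (mid p q) (mid q r) (mid p r).
Proof.
move=> ef; have cf := entire_seg_cont ef.
rewrite /triangle (seg_mid (cf p q)) (seg_mid (cf q r)) (seg_mid (cf r p)) (midC r p).
rewrite (segN (cf (mid p q) (mid p r))) (segN (cf (mid p q) (mid q r))).
by rewrite (segN (cf (mid p r) (mid q r))); ring.
Qed.

End Goursat.

(** * Goursat's theorem and primitives of entire functions *)

Section GoursatTheorem.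
Variable R : realType.
Local Notation C := (Cplx R).

(** The intervals of radius [K / 2 ^ n] around [a n] are nested, and the limit is
the supremum of their left ends. *)
Lemma real_geometric_limit (a : nat -> R) (K : R) :
  (forall n, `|a n.+1 - a n| <= K / 2 ^+ n.+1) ->
  exists l, forall n, `|a n - l| <= K / 2 ^+ n.
Proof.
move=> H.
pose e n := K / 2 ^+ n.
have eS n : e n = e n.+1 + e n.+1.
  by rewrite /e exprS invfM; field; rewrite expf_neq0 // pnatr_eq0.
have up n m : a n - e n <= a (n + m)%N - e (n + m)%N.
  elim: m => [|m ih]; first by rewrite addn0.
  apply: le_trans ih _; rewrite addnS (eS (n + m)%N).
  have := H (n + m)%N; rewrite -/(e _) ler_norml => /andP[h1 h2]; lra.
have dn n m : a (n + m)%N + e (n + m)%N <= a n + e n.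
  elim: m => [|m ih]; first by rewrite addn0.
  apply: le_trans ih; rewrite addnS (eS (n + m)%N).
  have := H (n + m)%N; rewrite -/(e _) ler_norml => /andP[h1 h2]; lra.
have e0 n : 0 <= e n.
  rewrite eS; have := H n; rewrite -/(e _) => /(le_trans (normr_ge0 _)) h.
  by rewrite addr_ge0.
have low n m : a n - e n <= a m + e m.
  have h1 := up n m; have h2 := dn m n; rewrite addnC in h2.
  have := e0 (n + m)%N; lra.
pose S := [set a n - e n | n in [set: nat]].
have hS : has_sup S.
  split; first by exists (a 0%N - e 0%N); exists 0%N.
  by exists (a 0%N + e 0%N) => _ [n _ <-].
exists (sup S) => n; rewrite -/(e n).
have h1 : a n - e n <= sup S by apply: ub_le_sup; [exact: hS.2|exists n].
have h2 : sup S <= a n + e n by apply: ge_sup; [exact: hS.1|move=> _ [m _ <-]].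
rewrite ler_norml; apply/andP; split; lra.
Qed.

Lemma geometric_limit (a : nat -> C) (K : R) :
  (forall n, cmod (a n.+1 - a n) <= K / 2 ^+ n.+1) ->
  exists l, forall n, cmod (a n - l) <= 2 * K / 2 ^+ n.
Proof.
move=> H.
have [n|x hx] := @real_geometric_limit (fun n => Re (a n)) K.
  by rewrite -ReB (le_trans (Re_le_cmod _)).
have [n|y hy] := @real_geometric_limit (fun n => Im (a n)) K.
  by rewrite -ImB (le_trans (Im_le_cmod _)).
exists (Complex x y) => n; apply: le_trans (cmod_le_ReIm _) _.
by rewrite ReB ImB /= -mulrA mulr_natl mulr2n lerD.
Qed.

Definition perimeter (p q r : C) : R := cmod (q - p) + cmod (r - q) + cmod (p - r).

Lemma triangle_le f p q r M : seg_cont f p q -> seg_cont f q r -> seg_cont f r p ->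
  (forall z, cmod (z - p) <= perimeter p q r -> cmod (f z) <= M) ->
  cmod (triangle f p q r) <= 2 * M * perimeter p q r.
Proof.
move=> c1 c2 c3 H.
have c0 (z : C) := cmod_ge0 z.
have tt (t : R) : 0 <= t <= 1 -> `|t| <= 1 by move=> /andP[? ?]; rewrite ger0_norm.
have e1 := @seg_le _ f p q M c1; have e2 := @seg_le _ f q r M c2.
have e3 := @seg_le _ f r p M c3.
apply: le_trans (cmodD _ _) _; rewrite mulrDr; apply: lerD.
  apply: le_trans (cmodD _ _) _; rewrite mulrDr; apply: lerD.
    apply: e1 => t /tt ht; apply: H; rewrite addrAC subrr add0r cmodM cmod_rc /perimeter.
    by have := ler_wpM2r (c0 (q - p)) ht; have := c0 (r - q); have := c0 (p - r); lra.
  apply: e2 => t /tt ht; apply: H; rewrite addrAC /perimeter.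
  apply: le_trans (cmodD _ _) _; rewrite cmodM cmod_rc.
  by have := ler_wpM2r (c0 (r - q)) ht; have := c0 (p - r); lra.
apply: e3 => t /andP[t0 t1]; apply: H.
have -> : r + rc t * (p - r) - p = rc (t - 1) * (p - r) by rewrite rcB rc1; ring.
rewrite cmodM cmod_rc ler0_norm ?subr_le0 // opprB /perimeter.
have : (1 - t) * cmod (p - r) <= 1 * cmod (p - r) by rewrite ler_wpM2r // gerBl.
by have := c0 (q - p); have := c0 (r - q); lra.
Qed.

Definition tri3 f (T : C * C * C) := triangle f T.1.1 T.1.2 T.2.
Definition per3 (T : C * C * C) := perimeter T.1.1 T.1.2 T.2.

Definition is_child (f : C -> C) (T T' : C * C * C) :=
  [/\ per3 T' = per3 T / 2, cmod (T'.1.1 - T.1.1) <= per3 T / 2 &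
      cmod (tri3 f T) <= 4 * cmod (tri3 f T')].

(** The integrals over the four half-size triangles add up to the integral over
[T], so that one of them carries at least a quarter of it. *)
Lemma exists_child f T : entire f -> exists T', is_child f T T'.
Proof.
move=> ef; case: T => [[p q] r].
have hf (z : C) : cmod (rc 2^-1 * z) = cmod z / 2.
  by rewrite cmodM cmod_rc ger0_norm ?invr_ge0 // mulrC.
have two : (2 : C) != 0 by rewrite pnatr_eq0.
have half : rc (2^-1 : R) = (2 : C)^-1 by rewrite rcV rcMn.
have d1 (a b : C) : mid a b - a = rc 2^-1 * (b - a) by rewrite /mid; ring.
have d2 (a b : C) : b - mid a b = rc 2^-1 * (b - a) by rewrite /mid half; field.
have d3 (a b c : C) : mid a b - mid a c = rc 2^-1 * (b - c) by rewrite /mid; ring.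
have c0 (z : C) := cmod_ge0 z.
pose t1 := (p, mid p q, mid p r); pose t2 := (mid p q, q, mid q r).
pose t3 := (mid p r, mid q r, r); pose t4 := (mid p q, mid q r, mid p r).
have h := @triangle_split _ f p q r ef.
have P1 : per3 t1 = per3 (p, q, r) / 2.
  rewrite /per3 /perimeter /= d1 (cmodBC _ (mid p q)) d3 (cmodBC p) d1 !hf.
  by rewrite (cmodBC r q) (cmodBC p r); ring.
have P2 : per3 t2 = per3 (p, q, r) / 2.
  rewrite /per3 /perimeter /= d2 d1 (midC p q) d3 !hf.
  by ring.
have P3 : per3 t3 = per3 (p, q, r) / 2.
  rewrite /per3 /perimeter /= d2 (midC q r) (midC p r) d3 d1 !hf.
  by ring.
have P4 : per3 t4 = per3 (p, q, r) / 2.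
  rewrite /per3 /perimeter /= d3 (midC p q) d3 (midC q r) (midC p r) d3 !hf.
  by rewrite (cmodBC r p) (cmodBC p q) (cmodBC q r); ring.
have F1 : cmod (p - p) <= per3 (p, q, r) / 2.
  by rewrite subrr cmod0 divr_ge0 // !addr_ge0.
have F2 : cmod (mid p q - p) <= per3 (p, q, r) / 2.
  by rewrite d1 hf /per3 /perimeter /=; have := c0 (r - q); have := c0 (p - r); lra.
have F3 : cmod (mid p r - p) <= per3 (p, q, r) / 2.
  rewrite d1 hf /per3 /perimeter /= (cmodBC r p).
  by have := c0 (r - q); have := c0 (q - p); lra.
have [|n1] := boolP (cmod (tri3 f (p, q, r)) <= 4 * cmod (tri3 f t1)).
  by exists t1; split.
have [|n2] := boolP (cmod (tri3 f (p, q, r)) <= 4 * cmod (tri3 f t2)).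
  by exists t2; split.
have [|n3] := boolP (cmod (tri3 f (p, q, r)) <= 4 * cmod (tri3 f t3)).
  by exists t3; split.
exists t4; split => //.
move: n1 n2 n3; rewrite -!ltNge.
have : cmod (tri3 f (p, q, r)) <= cmod (tri3 f t1) + cmod (tri3 f t2)
    + cmod (tri3 f t3) + cmod (tri3 f t4).
  rewrite [X in cmod X](_ : _ = tri3 f t1 + tri3 f t2 + tri3 f t3 + tri3 f t4) //.
  do 2! (apply: le_trans (cmodD _ _) _; rewrite lerD2r).
  exact: cmodD.
lra.
Qed.

(** Repeated bisection shrinks a triangle to a point [l] at which [f] agrees with
an affine function up to [e] times the distance. The affine function has a
primitive, and the remainder contributes at most a multiple of [e] times the
square of the perimeter, which decreases as fast as the integrals do. *)
Lemma goursat (f : C -> C) p q r : entire f -> triangle f p q r = 0.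
Proof.
move=> ef.
have [child childP] : {c : C * C * C -> C * C * C | forall T, is_child f T (c T)}.
  exists (fun T => projT1 (cid (exists_child T ef))) => T.
  by case: cid.
pose T n := iter n child (p, q, r).
pose D := per3 (p, q, r); pose A := cmod (triangle f p q r).
have TS n : T n.+1 = child (T n) by rewrite /T iterS.
have perT n : per3 (T n) = D / 2 ^+ n.
  elim: n => [|n ih]; first by rewrite expr0 divr1.
  have [E _ _] := childP (T n); rewrite TS E ih exprS.
  by field; rewrite expf_neq0 // pnatr_eq0.
have triT n : A <= 4 ^+ n * cmod (tri3 f (T n)).
  elim: n => [|n ih]; first by rewrite expr0 mul1r.
  have [_ _ E] := childP (T n); apply: le_trans ih _; rewrite TS.
  by rewrite exprSr -mulrA ler_wpM2l // exprn_ge0.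
have [l Hl] : exists l, forall n, cmod ((T n).1.1 - l) <= 2 * D / 2 ^+ n.
  apply: geometric_limit => n; have [_ E _] := childP (T n).
  by rewrite TS; apply: le_trans E _; rewrite perT exprS invfM mulrA mulrAC lexx.
have D0 : 0 <= D by rewrite !addr_ge0 // cmod_ge0.
have dl : is_derive l 1 f (derive1 f l).
  by rewrite derive1E; apply: DeriveDef => //; exact: ef.
pose g (z : C) := f l + (z - l) * derive1 f l.
have dg (z : C) : is_derive z 1 g (derive1 f l).
  apply/is_deriveCP => e e0; exists 1 => // h _.
  have -> : g (z + h) - g z - h * derive1 f l = 0 by rewrite /g; ring.
  by rewrite cmod0 mulr_ge0 ?cmod_ge0 // ltW.
have dG (z : C) : is_derive z 1 (fun w => f l * w + (w - l) ^+ 2 / 2 * derive1 f l) (g z).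
  have two : (2 : C) != 0 by rewrite pnatr_eq0.
  apply/is_deriveCP => e e0.
  pose M := cmod (derive1 f l) + 1.
  have M0 : 0 < M by rewrite ltr_wpDl ?cmod_ge0.
  exists (e / M); first by rewrite divr_gt0.
  move=> h; rewrite ltr_pdivlMr // => hh.
  have -> : f l * (z + h) + (z + h - l) ^+ 2 / 2 * derive1 f l -
    (f l * z + (z - l) ^+ 2 / 2 * derive1 f l) - h * g z = h * (derive1 f l * (h / 2)).
    by rewrite /g; field.
  rewrite cmodM mulrC ler_wpM2r ?cmod_ge0 // !cmodM cmodV cmod_nat.
  have := cmod_ge0 h; have := cmod_ge0 (derive1 f l).
  move: hh; rewrite /M; nra.
have eg : entire g by move=> z; have [] := dg z.
have tg T' : tri3 g T' = 0.
  by rewrite /tri3 /triangle !(seg_primitive (entire_seg_cont eg _ _) (fun t _ => dG _)); ring.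
have tfg T' : tri3 f T' = tri3 (fun z => f z - g z) T'.
  rewrite -[LHS]subr0 -(tg T') /tri3 /triangle.
  by rewrite !(segB (entire_seg_cont ef _ _) (entire_seg_cont eg _ _)); ring.
have efg : entire (fun z => f z - g z).
  by move=> z; apply: derivableB; [exact: ef|exact: eg].
suff H e : 0 < e -> A <= e * (6 * D ^+ 2).
  apply/eqP; rewrite -cmod_eq0 eq_le cmod_ge0 andbT -/A leNgt; apply/negP => A0.
  have K0 : 0 < 6 * D ^+ 2 + 1 by rewrite ltr_wpDl // mulr_ge0 // sqr_ge0.
  pose X := A / (6 * D ^+ 2 + 1) / 2.
  have X0 : 0 < X by rewrite /X !divr_gt0.
  have AE : A = 2 * (X * (6 * D ^+ 2 + 1)) by rewrite /X; field; exact: lt0r_neq0.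
  have D2 : 0 <= X * (6 * D ^+ 2) by apply: mulr_ge0; [exact: ltW|apply: mulr_ge0; [exact: ler0n|exact: sqr_ge0]].
  by have := H X X0; rewrite {1}AE mulrDr mulr1; lra.
move=> e0.
have /is_deriveCP/(_ e e0)[d d0 Hd] := dl.
have [n hn] : exists n, 3 * D / 2 ^+ n < d.
  have [n /(_ n (leqnn n))] : exists n, forall m, (n <= m)%N -> 3 * D / 2 ^+ m < d.
    have : 3 * D * (2^-1) ^+ n @[n --> \oo] --> 3 * D * 0.
      apply: cvgM; first exact: cvg_cst.
      by apply: cvg_expr; rewrite ger0_norm ?invr_ge0 // invf_lt1 // ltr1n.
    rewrite mulr0 => /cvgrPdist_lt/(_ d d0)[n _ hn]; exists n => m hm.
    have := hn m hm; rewrite /= sub0r normrN ger0_norm ?exprVn //.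
    by rewrite mulr_ge0 ?invr_ge0 ?exprn_ge0 // mulr_ge0.
  by exists n.
have p2 : 0 < (2 : R) ^+ n by rewrite exprn_gt0.
have bnd z : cmod (z - (T n).1.1) <= per3 (T n) -> cmod (f z - g z) <= e * (3 * D / 2 ^+ n).
  rewrite perT => hz.
  have hzl : cmod (z - l) <= 3 * D / 2 ^+ n.
    rewrite -(subrK (T n).1.1 z) -addrA; apply: le_trans (cmodD _ _) _.
    rewrite (_ : 3 * D / 2 ^+ n = D / 2 ^+ n + 2 * D / 2 ^+ n); last by ring.
    exact: lerD.
  have := Hd (z - l) (le_lt_trans hzl hn); rewrite subrKC.
  have -> : f z - f l - (z - l) * derive1 f l = f z - g z by rewrite /g; ring.
  by move=> h; apply: le_trans h _; rewrite ler_wpM2l // ltW.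
have := triT n; rewrite tfg.
have := triangle_le (entire_seg_cont efg _ _) (entire_seg_cont efg _ _)
  (entire_seg_cont efg _ _) bnd.
rewrite -/(tri3 _ (T n)) -/(per3 (T n)) perT => h1 h2.
have p4 : 0 < (4 : R) ^+ n by rewrite exprn_gt0.
apply: le_trans h2 (le_trans (ler_wpM2l (ltW p4) h1) _).
have -> : (4 : R) ^+ n = 2 ^+ n * 2 ^+ n by rewrite -exprMn -natrM.
rewrite le_eqVlt; apply/orP; left; apply/eqP; field; exact: lt0r_neq0.
Qed.

Lemma seg_cst (c p q : C) : seg (fun=> c) p q = (q - p) * c.
Proof.
rewrite /seg (@cint_rder _ _ (fun t => rc t * c)).
- by rewrite rc0 rc1 mul0r mul1r subr0.
- exact: ccont_rder (rder_cst c).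
- move=> s _; have := rderM (rder_rc (is_derive_id s 1)) (rder_cst c s).
  by rewrite rc1 mul1r mulr0 addr0.
Qed.

(** The primitive is the integral over the segment from 0: by [goursat] its
increments are integrals over short segments. *)
Lemma entire_primitive (f : C -> C) : entire f -> exists F : C -> C, forall z : C, is_derive z 1 F (f z).
Proof.
move=> ef; exists (fun z => seg f 0 z) => z; apply/is_deriveCP => e e0.
have cf := entire_seg_cont ef.
have dz : is_derive z 1 f (derive1 f z) by rewrite derive1E; apply: DeriveDef => //; exact: ef.
have e2 : 0 < e / 2 by rewrite divr_gt0.
have [d d0 Hd] := is_derive_epsdelta dz e2; exists d => // h hd.
have ec : entire (fun _ : C => f z) by move=> w; exact: derivable_cst.
have -> : h * f z = seg (fun=> f z) z (z + h).
  by rewrite seg_cst; ring.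
have -> : seg f 0 (z + h) - seg f 0 z = seg f z (z + h).
  have := goursat 0 z (z + h) ef; rewrite /triangle (segN (cf 0 (z + h))) => /eqP.
  by rewrite subr_eq0 => /eqP <-; ring.
rewrite -segB //; last exact: entire_seg_cont.
have efc : entire (fun w => f w - f z) by move=> w; apply: derivableB; [exact: ef|exact: ec].
apply: le_trans (@seg_le _ _ _ _ (e / 2) (entire_seg_cont efc _ _) _) _.
  move=> t /andP[t0 t1]; rewrite (_ : z + h - z = h); last by ring.
  apply/ltW/Hd; apply: le_lt_trans hd; rewrite cmodM cmod_rc ger0_norm //.
  by rewrite ler_piMl ?cmod_ge0.
by rewrite mulrCA divff ?mulr1 ?pnatr_eq0 // (_ : z + h - z = h) //; ring.
Qed.

End GoursatTheorem.

(** * Cauchy's formula on a square and the derivative of an entire function *)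

Section CauchyFormula.
Variable R : realType.
Local Notation C := (Cplx R).

Lemma ccont_bounded (u : R -> C) : ccont u ->
  exists2 M : R, 0 <= M & forall t, 0 <= t <= 1 -> cmod (u t) <= M.
Proof.
move=> cu.
have bd (g : R -> R) : (forall s : R, g x @[x --> s] --> g s) ->
    exists M, forall t, 0 <= t <= 1 -> g t <= M.
  move=> cg.
  have [|c _ Hc] := @EVT_max R g 0 1 ler01.
    by apply: continuous_subspaceT => x; exact: cg.
  by exists (g c) => t ht; apply: Hc; rewrite in_itv.
have [M1 H1] := bd (fun x => `|Re (u x)|) (fun s => cvg_norm (proj1 (cu s))).
have [M2 H2] := bd (fun x => `|Im (u x)|) (fun s => cvg_norm (proj2 (cu s))).
have H t : 0 <= t <= 1 -> cmod (u t) <= M1 + M2.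
  by move=> ht; apply: le_trans (cmod_le_ReIm _) (lerD (H1 t ht) (H2 t ht)).
exists (M1 + M2) => //.
by apply: le_trans (H 0 _); rewrite ?cmod_ge0 // lexx ler01.
Qed.

(** For [a = w^-1] and [b = (w - h)^-1] the hypothesis is the resolvent identity.
The remainder is quadratic in [h], uniformly for bounded [a] and [b], as
differentiation under the integral sign requires. *)
Lemma inverse_power_taylor (A : R) n : 0 <= A ->
  exists2 K : R, 0 <= K & forall a b h : C, cmod a <= A -> cmod b <= A ->
    b = a + h * a * b ->
    cmod (b ^+ n - a ^+ n - h * (n%:R * a ^+ n.+1)) <= K * cmod h ^+ 2.
Proof.
move=> A0; elim: n => [|n [K K0 ih]].
  exists 0 => // a b h _ _ _; rewrite !expr0 subrr mul0r mulr0 subr0 cmod0.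
  by rewrite mul0r.
exists (A * K + n.+1%:R * A ^+ n.+2 * A); first by nneg.
move=> a b h ha hb E.
have -> : b ^+ n.+1 - a ^+ n.+1 - h * (n.+1%:R * a ^+ n.+2) =
    b * (b ^+ n - a ^+ n - h * (n%:R * a ^+ n.+1)) +
    h ^+ 2 * (n.+1%:R * a ^+ n.+2 * b).
  have E' : b - a - h * a * b = 0 by rewrite {1}E; ring.
  apply/eqP; rewrite -subr_eq0 -(mulr0 (a ^+ n + n.+1%:R * h * a ^+ n.+1)) -E' -natr1 !exprS; apply/eqP.
  by ring.
apply: le_trans (cmodD _ _) _; rewrite mulrDl; apply: lerD.
  by rewrite cmodM -mulrA ler_pM ?cmod_ge0 // ih.
rewrite cmodM cmodX mulrC ler_wpM2r ?sqr_ge0 // (cmodM _ b) (cmodM n.+1%:R) cmodX cmod_nat.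
apply: ler_pM => //; [by nneg|exact: cmod_ge0|].
by apply: ler_wpM2l; [exact: ler0n|apply: lerXn2r; rewrite ?nnegrE ?cmod_ge0].
Qed.

Lemma inverse_shift (w h : C) (d : R) : 0 < d -> d <= cmod w -> cmod h <= d / 2 ->
  [/\ cmod w^-1 <= 2 / d, cmod (w - h)^-1 <= 2 / d &
      (w - h)^-1 = w^-1 + h * w^-1 * (w - h)^-1].
Proof.
move=> d0 dw hd.
have dwh : d / 2 <= cmod (w - h).
  have := cmod_subr w (w - h); rewrite (_ : w - (w - h) = h); last by ring.
  by lra.
have d2 : 0 < d / 2 by rewrite divr_gt0.
have w0 : w != 0 by rewrite -cmod_gt0 (lt_le_trans d0).
have wh0 : w - h != 0 by rewrite -cmod_gt0 (lt_le_trans d2).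
split.
- by rewrite cmodV -invf_div lef_pV2 ?posrE ?(lt_le_trans d2) //; lra.
- by rewrite cmodV -invf_div lef_pV2 ?posrE ?(lt_le_trans d2).
- by field; rewrite w0 wh0.
Qed.

Lemma is_derive_inv (z w : C) n : w - z != 0 ->
  is_derive w 1 (fun x : C => (x - z)^-1 ^+ n) (- (n%:R * (w - z)^-1 ^+ n.+1)).
Proof.
move=> wz; have d0 : 0 < cmod (w - z) by rewrite cmod_gt0.
have A0 : 0 <= 2 / cmod (w - z) by rewrite divr_ge0 // ltW.
have [K K0 HK] := inverse_power_taylor n A0.
have K1 : 0 < K + 1 by rewrite ltr_wpDl.
apply/is_deriveCP => e e0.
exists (Num.min (cmod (w - z) / 2) (e / (K + 1))); first by rewrite lt_min !divr_gt0.
move=> h; rewrite lt_min => /andP[/ltW h1]; rewrite ltr_pdivlMr // => /ltW h2.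
have [|i1 i2 i3] := @inverse_shift (w - z) (- h) _ d0 (lexx _); first by rewrite cmodN.
have := HK _ _ _ i1 i2 i3; rewrite cmodN opprK (_ : w - z + h = w + h - z); last by ring.
move=> H; rewrite [X in cmod X](_ : _ = (w + h - z)^-1 ^+ n - (w - z)^-1 ^+ n -
  - h * (n%:R * (w - z)^-1 ^+ n.+1)); last by ring.
apply: le_trans H _; rewrite expr2 mulrA ler_wpM2r ?cmod_ge0 //.
by apply: le_trans h2; rewrite mulrC ler_wpM2l ?cmod_ge0 // lerDl.
Qed.

Lemma seg_kernel_cont (phi : C -> C) (p q z : C) n : entire phi ->
  (forall t : R, p + rc t * (q - p) != z) ->
  seg_cont (fun w => phi w * (w - z)^-1 ^+ n) p q.
Proof.
move=> ephi Hz.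
have H t := rderM (entire_rder ephi p (q - p) t)
  (@rder_comp _ (fun x => (x - z)^-1 ^+ n) p (q - p) _ t
     (@is_derive_inv z (p + rc t * (q - p)) n _)).
by apply: ccont_rder; apply: H => t; rewrite subr_eq0.
Qed.

(** The second order remainder of the kernel is bounded uniformly along the
segment, which is at distance at least [d] from [z]. *)
Lemma is_derive_seg_kernel (phi : C -> C) (p q z : C) (d : R) n : entire phi ->
  0 < d -> (forall t : R, d <= cmod (p + rc t * (q - p) - z)) ->
  is_derive z 1 (fun z => seg (fun w => phi w * (w - z)^-1 ^+ n) p q)
    (n%:R * seg (fun w => phi w * (w - z)^-1 ^+ n.+1) p q).
Proof.
move=> ephi d0 Hd.
have A0 : 0 <= 2 / d by rewrite divr_ge0 // ltW.
have [K K0 HK] := inverse_power_taylor n A0.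
have [M M0 HM] := ccont_bounded (entire_seg_cont ephi p q).
have d2 : 0 < d / 2 by rewrite divr_gt0.
have avoid (z' : C) : cmod (z' - z) <= d / 2 -> forall t : R, p + rc t * (q - p) != z'.
  move=> hz t; apply/eqP => E; have := Hd t; rewrite E => h.
  by move: (le_trans h hz); rewrite leNgt ltr_pdivrMr // mulr_natr mulr2n ltrDl d0.
pose B := 2 * (M * K) * cmod (q - p) + 1.
have B0 : 0 < B by rewrite ltr_wpDl //; nneg.
apply/is_deriveCP => e e0.
exists (Num.min (d / 2) (e / B)); first by rewrite lt_min d2 divr_gt0.
move=> h; rewrite lt_min => /andP[/ltW h1]; rewrite ltr_pdivlMr // => /ltW h2.
have c1 : seg_cont (fun w => phi w * (w - (z + h))^-1 ^+ n) p q.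
  by apply: seg_kernel_cont => //; apply: avoid; rewrite addrAC subrr add0r.
have c2 m : seg_cont (fun w => phi w * (w - z)^-1 ^+ m) p q.
  by apply: seg_kernel_cont => //; apply: avoid; rewrite subrr cmod0 ltW.
have segZ c g : seg_cont g p q -> seg (fun w => c * g w) p q = c * seg g p q.
  by move=> cg; rewrite /seg cintZ // mulrCA.
have cZ c g : seg_cont g p q -> seg_cont (fun w => c * g w) p q by move=> cg; apply: ccontZ.
have cB g1 g2 : seg_cont g1 p q -> seg_cont g2 p q -> seg_cont (fun w => g1 w - g2 w) p q.
  move=> cg1 cg2; have := ccontD cg1 (ccontZ (-1) cg2).
  by congr ccont; apply/funext => t; rewrite mulN1r.
rewrite -(segB c1 (c2 n)) mulrA -(segZ (h * n%:R) _ (c2 n.+1)).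
have c3 := cB _ _ c1 (c2 n); have c4 := cZ (h * n%:R) _ (c2 n.+1).
rewrite -(segB c3 c4).
apply: le_trans (@seg_le _ _ _ _ (M * K * cmod h ^+ 2) (cB _ _ c3 c4) _) _.
- move=> t ht; set w := p + _.
  have [i1 i2 i3] := @inverse_shift (w - z) h _ d0 (Hd t) h1.
  have := HK _ _ _ i1 i2 i3; rewrite (_ : w - z - h = w - (z + h)); last by ring.
  move=> H; rewrite [X in cmod X](_ : _ = phi w * ((w - (z + h))^-1 ^+ n -
    (w - z)^-1 ^+ n - h * (n%:R * (w - z)^-1 ^+ n.+1))); last by ring.
  by rewrite cmodM -mulrA ler_pM ?cmod_ge0 // HM.
- rewrite (_ : _ * cmod (q - p) = (B - 1) * cmod h * cmod h); last first.
    by rewrite /B; ring.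
  rewrite ler_wpM2r ?cmod_ge0 //; apply: le_trans h2.
  by rewrite mulrC ler_wpM2l ?cmod_ge0 // gerBl.
Qed.

Definition ci : C := Complex 0 1.

Lemma ci2 : ci * ci = -1.
Proof. by apply: C_ext => /=; ring. Qed.

Lemma cmod_ci : cmod ci = 1.
Proof. by rewrite /cmod /= expr0n add0r expr1n sqrtr1. Qed.

(** Integral over the boundary of a square whose sides are exchanged by the
multiplication by [ci] about [z0]. *)
Definition diamond (g : C -> C) (z0 : C) : C :=
  \sum_(j < 4) seg g (z0 + ci ^+ j) (z0 + ci ^+ j.+1).

(** A diagonal cuts the square into two triangles. *)
Lemma diamond_entire g z0 : entire g -> diamond g z0 = 0.
Proof.
move=> eg; rewrite /diamond !big_ord_recr big_ord0 /= add0r.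
have := goursat (z0 + ci ^+ 0) (z0 + ci ^+ 1) (z0 + ci ^+ 2) eg.
have := goursat (z0 + ci ^+ 0) (z0 + ci ^+ 2) (z0 + ci ^+ 3) eg.
rewrite /triangle (segN (entire_seg_cont eg (z0 + ci ^+ 0) (z0 + ci ^+ 2))).
have -> : ci ^+ 4 = ci ^+ 0 by rewrite (exprD ci 2 2) expr2 ci2 mulrNN mulr1.
move: (seg g (z0 + ci ^+ 0) (z0 + ci ^+ 1)) (seg g (z0 + ci ^+ 1) (z0 + ci ^+ 2))
  (seg g (z0 + ci ^+ 2) (z0 + ci ^+ 3)) (seg g (z0 + ci ^+ 3) (z0 + ci ^+ 0))
  (seg g (z0 + ci ^+ 0) (z0 + ci ^+ 2)) => s01 s12 s23 s30 s02 h1 h2.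
by rewrite -[RHS](addr0 0) -{1}h1 -h2; ring.
Qed.

Lemma diamond_far (z0 z : C) (t : R) (j : nat) : cmod (z - z0) < 1 / 2 ->
  1 / 10 <= cmod (z0 + ci ^+ j + rc t * (z0 + ci ^+ j.+1 - (z0 + ci ^+ j)) - z).
Proof.
move=> hz.
have -> : z0 + ci ^+ j + rc t * (z0 + ci ^+ j.+1 - (z0 + ci ^+ j)) - z =
  ci ^+ j * Complex (1 - t) t - (z - z0).
  have -> : (Complex (1 - t) t : C) = 1 + rc t * (ci - 1) by apply: C_ext => /=; ring.
  by rewrite exprS; ring.
have := cmod_subr (ci ^+ j * Complex (1 - t) t) (z - z0).
rewrite cmodM cmodX cmod_ci expr1n mul1r.
(* the sides of the square are at distance [1 / sqrt 2] from its centre *)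
have : 6 / 10 <= cmod (Complex (1 - t) t : C).
  rewrite -(ler_pXn2r (_ : 0 < 2)%N) ?nnegrE ?cmod_ge0 // cmod_sqr /=.
  have := sqr_ge0 (2 * t - 1); lra.
lra.
Qed.

Lemma is_derive_diamond_kernel (phi : C -> C) (z0 z : C) n : entire phi ->
  cmod (z - z0) < 1 / 2 ->
  is_derive z 1 (fun z => diamond (fun w => phi w * (w - z)^-1 ^+ n) z0)
    (n%:R * diamond (fun w => phi w * (w - z)^-1 ^+ n.+1) z0).
Proof.
move=> ephi hz; rewrite /diamond mulr_sumr.
have d0 : 0 < 1 / 10 :> R by rewrite divr_gt0.
have H (j : 'I_4) := is_derive_seg_kernel n ephi d0 (fun t => diamond_far t j hz).
have := is_derive_sum H.
by congr is_derive; apply/funext => x; rewrite fct_sumE.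
Qed.

Lemma diamond_kernel2 (z0 z : C) : cmod (z - z0) < 1 / 2 ->
  diamond (fun w => 1 * (w - z)^-1 ^+ 2) z0 = 0.
Proof.
move=> hz.
have d0 : 0 < 1 / 10 :> R by rewrite divr_gt0.
have e1 : entire (fun _ : C => 1 : C) by move=> w; exact: derivable_cst.
have H (j : nat) : seg (fun w => 1 * (w - z)^-1 ^+ 2) (z0 + ci ^+ j) (z0 + ci ^+ j.+1) =
    - (z0 + ci ^+ j.+1 - z)^-1 - - (z0 + ci ^+ j - z)^-1.
  have nz (t : R) : z0 + ci ^+ j + rc t * (z0 + ci ^+ j.+1 - (z0 + ci ^+ j)) - z != 0.
    by rewrite -cmod_gt0; apply: lt_le_trans (diamond_far t j hz).
  apply: (@seg_primitive _ _ (fun w => - (w - z)^-1)).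
    by apply: seg_kernel_cont => // t; rewrite -subr_eq0.
  move=> t _; have := is_deriveN (is_derive_inv 1 (nz t)).
  by rewrite opprK mul1r.
rewrite /diamond !big_ord_recr big_ord0 /= add0r !H.
have -> : ci ^+ 4 = ci ^+ 0 by rewrite (exprD ci 2 2) expr2 ci2 mulrNN mulr1.
move: (_^-1) (_^-1) (_^-1) (_^-1) => a b c d; ring.
Qed.

Definition diamond_winding (z0 z : C) := diamond (fun w => 1 * (w - z)^-1 ^+ 1) z0.

(** The derivative in [z] is the integral of [(w - z) ^- 2], which has a primitive
on each side. *)
Lemma diamond_winding_const (z0 z : C) : cmod (z - z0) < 1 / 2 ->
  diamond_winding z0 z = diamond_winding z0 z0.
Proof.
move=> hz.
have e1 : entire (fun _ : C => 1 : C) by move=> w; exact: derivable_cst.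
have := @rder0_const R (fun t => diamond_winding z0 (z0 + rc t * (z - z0))) 0 1 ler01.
rewrite rc0 rc1 mul0r addr0 mul1r subrKC; apply => t /andP[t0 t1].
have ht : cmod (z0 + rc t * (z - z0) - z0) < 1 / 2.
  rewrite addrAC subrr add0r cmodM cmod_rc ger0_norm //.
  by apply: le_lt_trans hz; rewrite ler_piMl ?cmod_ge0.
have := rder_comp (is_derive_diamond_kernel 1 e1 ht).
by rewrite diamond_kernel2 // !mulr0.
Qed.

(** The winding integral is not computed: on each side its imaginary part is at
least 1, and the four sides contribute equally. *)
Lemma diamond_winding_neq0 (z0 : C) : diamond_winding z0 z0 != 0.
Proof.
pose kap (t : R) : C := (ci - 1) * (Complex (1 - t) t : C)^-1.
have nz (t : R) : (Complex (1 - t) t : C) != 0.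
  by apply/eqP => -[h1 h2]; move: h1; rewrite h2; lra.
have ccK : ccont kap.
  have e1 : entire (fun _ : C => ci - 1 : C) by move=> w; exact: derivable_cst.
  have := @seg_kernel_cont (fun=> ci - 1) 1 ci 0 1 e1 _; rewrite /seg_cont.
  under eq_fun do rewrite subr0 expr1.
  have E t : (Complex (1 - t) t : C) = 1 + rc t * (ci - 1) by apply: C_ext => /=; ring.
  under eq_fun do rewrite -E; apply => t; rewrite -E; exact: nz.
have H (j : nat) : seg (fun w => 1 * (w - z0)^-1 ^+ 1) (z0 + ci ^+ j) (z0 + ci ^+ j.+1) = cint kap.
  have cj : ci ^+ j != 0 by rewrite -cmod_gt0 cmodX cmod_ci expr1n.
  have -> : cint kap = cint (fun t => (ci - 1) * (Complex (1 - t) t : C)^-1) by [].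
  rewrite /seg -cintZ; last first.
    apply: (@seg_kernel_cont (fun=> 1) (z0 + ci ^+ j) (z0 + ci ^+ j.+1) z0 1).
      by move=> w; exact: derivable_cst.
    move=> t; rewrite -subr_eq0 -cmod_gt0; have := @diamond_far z0 z0 t j.
    by rewrite subrr cmod0 divr_gt0 // => /(_ isT); apply: lt_le_trans; rewrite divr_gt0.
  congr cint; apply/funext => t; rewrite mul1r expr1.
  have -> : z0 + ci ^+ j + rc t * (z0 + ci ^+ j.+1 - (z0 + ci ^+ j)) - z0 =
      ci ^+ j * Complex (1 - t) t.
    have -> : (Complex (1 - t) t : C) = 1 + rc t * (ci - 1) by apply: C_ext => /=; ring.
    by rewrite exprS; ring.
  by rewrite exprS; field; rewrite nz cj.
have -> : diamond_winding z0 z0 = rc 4 * cint kap.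
  by rewrite /diamond_winding /diamond !big_ord_recr big_ord0 /= add0r !H rcMn; ring.
have [U HU] := rder_primitive ccK.
rewrite (@cint_rder _ _ U ccK); last by move=> s /andP[s0 _]; exact: HU.
have ImK t : 0 <= t <= 1 -> 1 <= Im (kap t).
  move=> /andP[t0 t1].
  have -> : Im (kap t) = ((1 - t) ^+ 2 + t ^+ 2)^-1.
    have d0 : (1 - t) ^+ 2 + t ^+ 2 != 0.
      by apply: lt0r_neq0; have := sqr_ge0 (2 * t - 1); nra.
    by rewrite /kap ImM /=; field.
  rewrite -invr1 lef_pV2 ?posrE //; first nra.
  by have := sqr_ge0 (2 * t - 1); nra.
have : Im (U 0) - 0 <= Im (U 1) - 1.
  apply: (@nondecreasing_der R (fun t => Im (U t) - t) (fun t => Im (kap t) - 1)) => //.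
    move=> x /andP[x0 _]; apply: is_deriveB (is_derive_id x 1).
    by have [] := HU x x0.
  by move=> x hx; rewrite subr_ge0 ImK.
move=> h; apply/eqP => /(congr1 (@complex.Im R)); rewrite ImMrc ImB Im0; lra.
Qed.

(** The difference quotient of a primitive [F] of [f] extends to an entire
function: [F] has a second order Taylor expansion, being the primitive of a
differentiable function. *)
Lemma entire_difference_quotient (f F : C -> C) (z : C) : entire f ->
  (forall w : C, is_derive w 1 F (f w)) ->
  entire (fun w => if w == z then f z else (F w - F z) / (w - z)).
Proof.
move=> ef dF w.
have [->{w}|wz] := eqVneq w z; last first.
  have d1 : derivable (fun x : C => (F x - F z) * (x - z)^-1 ^+ 1) w 1.
    apply: derivableM; first by apply: derivableB => //; have [] := dF w.
    by have [] := @is_derive_inv z w 1 _; first by rewrite subr_eq0.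
  apply: near_eq_derivable d1.
  exists `|w - z|; first by rewrite /= normr_gt0 subr_eq0.
  move=> x /= hx; rewrite expr1; case: eqP => // xz; move: hx.
  by rewrite xz ltxx.
apply: (@ex_derive _ _ _ _ _ _ (derive1 f z / 2)).
apply/is_deriveCP => e e0.
have dz : is_derive z 1 f (derive1 f z) by rewrite derive1E; apply: DeriveDef => //; exact: ef.
have e2 : 0 < e / 2 by rewrite divr_gt0.
have /is_deriveCP/(_ _ e2)[d d0 Hd] := dz.
exists d => // h hd; rewrite eqxx.
have [->|h0] := eqVneq h 0.
  by rewrite addr0 eqxx subrr mul0r subr0 cmod0 mulr0.
have -> : z + h == z = false by rewrite -subr_eq0 addrAC subrr add0r (negbTE h0).
have two : (2 : C) != 0 by rewrite pnatr_eq0.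
pose u (s : R) := F (z + rc s * h) - rc s * (h * f z) - rc (s * s) * (h ^+ 2 * (derive1 f z / 2)).
pose v (s : R) := h * (f (z + rc s * h) - f z - rc s * h * derive1 f z).
have duv s : rder u s (v s).
  have r1 := rder_comp (dF (z + rc s * h)).
  have r2 := rderM (rder_rc (is_derive_id s 1)) (rder_cst (h * f z) s).
  have r3 := rderM (rder_rc (is_deriveRM (is_derive_id s 1) (is_derive_id s 1)))
    (rder_cst (h ^+ 2 * (derive1 f z / 2)) s).
  have := rderB (rderB r1 r2) r3.
  rewrite (_ : _ - _ = v s) //.
  by rewrite /v !mulr0 !addr0 rc1 mulr1 !mul1r rcD; field.
have := @increment_le R u v 0 1 (e / 2 * cmod h ^+ 2) ler01 (fun s _ => duv s) _.
rewrite /u /v mul0r rc0 !mul0r !addr0 !subr0 mulr1 rc1 !mul1r mulr1.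
rewrite (_ : 2 * (e / 2 * cmod h ^+ 2) = e * cmod h * cmod h); last by field.
move=> H; rewrite -(ler_pM2r (_ : 0 < cmod h)) ?cmod_gt0 //.
rewrite -cmodM (_ : z + h - z = h); last by ring.
rewrite (_ : _ * h = F (z + h) - h * f z - h ^+ 2 * (derive1 f z / 2) - F z); last by field.
apply: H => s /andP[s0 s1]; rewrite cmodM mulrC expr2 mulrA ler_wpM2r ?cmod_ge0 //.
have hs : cmod (rc s * h) <= cmod h by rewrite cmodM cmod_rc ger0_norm // ler_piMl ?cmod_ge0.
apply: le_trans (Hd _ (le_lt_trans hs hd)) _.
by rewrite ler_wpM2l // ltW.
Qed.

(** The formula concerns a primitive [F], whose difference quotient at [z] is
entire because [f] has one derivative; the same formula for [f] would presuppose
a second one. *)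
Lemma cauchy_formula (f F : C -> C) (z0 z : C) : entire f ->
  (forall w : C, is_derive w 1 F (f w)) -> cmod (z - z0) < 1 / 2 ->
  F z * diamond_winding z0 z0 = diamond (fun w => F w * (w - z)^-1 ^+ 1) z0.
Proof.
move=> ef dF hz; rewrite -(diamond_winding_const hz).
have eF : entire F by move=> w; have [] := dF w.
have e1 : entire (fun _ : C => 1 : C) by move=> w; exact: derivable_cst.
have eG := @entire_difference_quotient f F z ef dF.
have H0 := diamond_entire z0 eG.
have nz (t : R) (j : nat) : z0 + ci ^+ j + rc t * (z0 + ci ^+ j.+1 - (z0 + ci ^+ j)) != z.
  rewrite -subr_eq0 -cmod_gt0; apply: lt_le_trans (diamond_far t j hz).
  by rewrite divr_gt0.
apply/eqP; rewrite eq_sym -subr_eq0 -H0 /diamond_winding /diamond mulr_sumr -sumrB; apply/eqP.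
apply: eq_bigr => j _.
have c1 := seg_kernel_cont 1 eF (fun t => nz t j).
have c2 := seg_kernel_cont 1 e1 (fun t => nz t j).
rewrite {2}/seg mulrCA -(cintZ _ c2) -/(seg (fun w => F z * (1 * (w - z)^-1 ^+ 1)) _ _).
rewrite -(segB c1 (ccontZ (F z) c2)) /seg; congr (_ * cint _); apply/funext => t.
by rewrite (negbTE (nz t j)) expr1; ring.
Qed.

(** Near [z0] a primitive [F] of [f] is a Cauchy integral, hence differentiable
any number of times, and [derive1 f] is its second derivative. *)
Lemma entire_derive1 (f : C -> C) : entire f -> entire (derive1 f).
Proof.
move=> ef z0.
have [F dF] := entire_primitive ef.
have eF : entire F by move=> w; have [] := dF w.
pose c := diamond_winding z0 z0.
have c0 : c != 0 by exact: diamond_winding_neq0.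
pose K n (z : C) := diamond (fun w => F w * (w - z)^-1 ^+ n) z0.
have dK n (z : C) : cmod (z - z0) < 1 / 2 -> is_derive z 1 (K n) (n%:R * K n.+1 z).
  by move=> hz; exact: is_derive_diamond_kernel.
have near_ball (z : C) : cmod (z - z0) < 1 / 2 -> \forall w \near z, cmod (w - z0) < 1 / 2.
  move=> hz; exists (rc (1 / 2 - cmod (z - z0))); first by rewrite /= -rc0 rc_lt subr_gt0.
  move=> w /=; rewrite normE rc_lt (cmodBC z w) => hw.
  rewrite (_ : w - z0 = (w - z) + (z - z0)); last by ring.
  by apply: le_lt_trans (cmodD _ _) _; rewrite -ltrBrDr.
have uniq (g h : C -> C) (z dg dh : C) : (\near z, g z = h z) ->
    is_derive z 1 g dg -> is_derive z 1 h dh -> dg = dh.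
  move=> gh [_ <-] [_ <-]; exact: near_eq_derive.
have dcK n (z : C) : cmod (z - z0) < 1 / 2 ->
    is_derive z 1 (fun x => c^-1 * K n x) (c^-1 * (n%:R * K n.+1 z)).
  by move=> hz; exact: is_deriveZ (dK n z hz).
have E1 (z : C) : cmod (z - z0) < 1 / 2 -> F z = c^-1 * K 1 z.
  by move=> hz; rewrite /K -(cauchy_formula ef dF hz) mulrC mulfK.
have E2 (z : C) : cmod (z - z0) < 1 / 2 -> f z = c^-1 * K 2 z.
  move=> hz; rewrite -[K 2 z]mul1r; apply: uniq (dF z) (dcK 1 z hz).
  by near=> w; apply: E1; near: w; exact: near_ball.
have E3 (z : C) : cmod (z - z0) < 1 / 2 -> derive1 f z = c^-1 * (2 * K 3 z).
  move=> hz; apply: uniq (dcK 2 z hz); last first.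
    by rewrite derive1E; apply: DeriveDef => //; exact: ef.
  by near=> w; apply: E2; near: w; exact: near_ball.
have h0 : cmod (z0 - z0) < 1 / 2 by rewrite subrr cmod0 divr_gt0.
apply: (@near_eq_derivable _ _ _ (fun x => c^-1 * (2 * K 3 x))).
  by near=> w; apply/esym/E3; near: w; exact: near_ball.
have d3 := is_deriveZ (c^-1) (is_deriveZ 2 (dK 3 z0 h0)).
by have [H _] := d3; exact: H.
Unshelve. all: by end_near.
Qed.

End CauchyFormula.

(** * Everywhere convergent power series *)

Section EntireSeries.
Variable R : realType.
Local Notation C := (Cplx R).

Definition ccvg (u : nat -> C) (l : C) :=
  (Re (u n) @[n --> \oo] --> Re l) /\ (Im (u n) @[n --> \oo] --> Im l).

Lemma ccvgP (u : nat -> C) (l : C) :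
  ccvg u l <-> forall e : R, 0 < e -> \forall s \near \oo, cmod (u s - l) < e.
Proof.
split=> [[/cvgrPdist_lt A /cvgrPdist_lt B] e e0|H].
  have e2 : 0 < e / 2 by rewrite divr_gt0.
  apply: filterS2 (A _ e2) (B _ e2) => s h1 h2.
  apply: le_lt_trans (cmod_le_ReIm _) _.
  by rewrite ReB ImB (splitr e) (distrC (Re _)) (distrC (Im _)) ltrD.
split; apply/cvgrPdist_lt => e e0; apply: filterS (H e e0) => s h.
  by rewrite -ReB; apply: le_lt_trans (Re_le_cmod _) _; rewrite cmodBC.
by rewrite -ImB; apply: le_lt_trans (Im_le_cmod _) _; rewrite cmodBC.
Qed.

Lemma ccvg_cst (c : C) : ccvg (fun=> c) c.
Proof. by split; exact: cvg_cst. Qed.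

Lemma ccvgD u v (a b : C) : ccvg u a -> ccvg v b -> ccvg (fun n => u n + v n) (a + b).
Proof.
move=> [u1 u2] [v1 v2]; split.
  rewrite (_ : (fun n => _) = (fun n => Re (u n) + Re (v n))).
    by rewrite ReD; exact: cvgD.
  by apply/funext => x; rewrite ReD.
rewrite (_ : (fun n => _) = (fun n => Im (u n) + Im (v n))).
  by rewrite ImD; exact: cvgD.
by apply/funext => x; rewrite ImD.
Qed.

Lemma ccvgM u v (a b : C) : ccvg u a -> ccvg v b -> ccvg (fun n => u n * v n) (a * b).
Proof.
move=> [u1 u2] [v1 v2]; split.
  rewrite (_ : (fun n => _) = (fun n => Re (u n) * Re (v n) - Im (u n) * Im (v n))).
    by rewrite ReM; apply: cvgB; exact: cvgM.
  by apply/funext => x; rewrite ReM.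
rewrite (_ : (fun n => _) = (fun n => Re (u n) * Im (v n) + Im (u n) * Re (v n))).
  by rewrite ImM; apply: cvgD; exact: cvgM.
by apply/funext => x; rewrite ImM.
Qed.

Lemma ccvgB u v (a b : C) : ccvg u a -> ccvg v b -> ccvg (fun n => u n - v n) (a - b).
Proof.
move=> hu hv; rewrite (_ : a - b = a + (-1) * b); last by ring.
rewrite (_ : (fun n => _) = (fun n => u n + (-1) * v n)); last first.
  by apply/funext => n; ring.
by apply: ccvgD => //; apply: ccvgM => //; exact: ccvg_cst.
Qed.

Lemma ccvg_uniq u (a b : C) : ccvg u a -> ccvg u b -> a = b.
Proof.
move=> [a1 a2] [b1 b2]; apply: C_ext.
  by apply: (cvg_unique _ a1 b1); exact: norm_hausdorff.
by apply: (cvg_unique _ a2 b2); exact: norm_hausdorff.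
Qed.

Lemma ccvg_shift u (a : C) k : ccvg u a -> ccvg (fun n => u (n + k)%N) a.
Proof. by move=> [h1 h2]; split; rewrite (@cvg_shiftn k _ (fun n => _ (u n))). Qed.

Lemma ccvg_le u (a : C) B : ccvg u a -> (forall n, cmod (u n) <= B) -> cmod a <= 2 * B.
Proof.
have bd (v : nat -> R) (b : R) : v n @[n --> \oo] --> b -> (forall n, `|v n| <= B) -> `|b| <= B.
  move=> hv H; apply: (ler_cvg_to (cvg_norm hv) (cvg_cst B)).
  by apply: nearW => n; exact: H.
move=> [h1 h2] H; apply: le_trans (cmod_le_ReIm _) _; rewrite mulr_natl mulr2n.
apply: lerD; [apply: (bd _ _ h1)|apply: (bd _ _ h2)] => n; apply: le_trans (H n).
  exact: Re_le_cmod.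
exact: Im_le_cmod.
Qed.

Definition psum (c : nat -> R) (z : C) n : C := \sum_(p < n) rc (c p) * z ^+ p.

Definition pser (c : nat -> R) (z : C) : C :=
  Complex (limn (fun n => Re (psum c z n))) (limn (fun n => Im (psum c z n))).

(** Absolute convergence at every radius, with bounds on partial sums instead of
a limit. *)
Definition ecoef (c : nat -> R) :=
  forall r : R, 0 <= r -> exists M : R, forall n, \sum_(p < n) `|c p| * r ^+ p <= M.

Lemma real_series_cvg (a : nat -> R) (M : R) : (forall n, \sum_(p < n) `|a p| <= M) ->
  cvgn (fun n => \sum_(p < n) a p).
Proof.
move=> H; have E (b : nat -> R) : (fun n => \sum_(p < n) b p) = series b.
  by apply/funext => n; rewrite /series /= big_mkord.
rewrite E; apply: normed_cvg; rewrite /normed_series_of /=.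
apply: nondecreasing_is_cvgn.
  apply/nondecreasing_seqP => n; rewrite /series /= !big_mkord big_ord_recr /=.
  by rewrite lerDl.
by exists M => _ [n _ <-]; rewrite /series /= big_mkord.
Qed.

Lemma pser_cvg c z : ecoef c -> ccvg (psum c z) (pser c z).
Proof.
move=> /(_ (cmod z) (cmod_ge0 z))[M HM]; split => /=.
  suff : cvgn (fun n => Re (psum c z n)) by [].
  under eq_fun do rewrite /psum Re_sum.
  apply: (@real_series_cvg (fun p => Re (rc (c p) * z ^+ p)) M) => n.
  apply: le_trans _ (HM n); apply: ler_sum => p _.
  by apply: le_trans (Re_le_cmod _) _; rewrite cmodM cmod_rc cmodX.
suff : cvgn (fun n => Im (psum c z n)) by [].
under eq_fun do rewrite /psum Im_sum.
apply: (@real_series_cvg (fun p => Im (rc (c p) * z ^+ p)) M) => n.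
apply: le_trans _ (HM n); apply: ler_sum => p _.
by apply: le_trans (Im_le_cmod _) _; rewrite cmodM cmod_rc cmodX.
Qed.

Definition dcoef (c : nat -> R) p := p.+1%:R * c p.+1.

Lemma natr_le_exp2 (p : nat) : (p%:R : R) <= 2 ^+ p.
Proof. by rewrite -natrX ler_nat ltnW // ltn_expl. Qed.

(** Since [p <= 2 ^ p], doubling the radius absorbs the factor [p.+1]. *)
Lemma ecoef_dcoef c : ecoef c -> ecoef (dcoef c).
Proof.
move=> ec r r0; pose s := 2 * (1 + r).
have s0 : 0 <= s by rewrite mulr_ge0 // addr_ge0.
have [M HM] := ec s s0; exists M => n.
apply: le_trans _ (HM n.+1); rewrite big_ord_recl /=.
apply: le_trans (_ : _ <= \sum_(i < n) `|c i.+1| * s ^+ i.+1) _; last first.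
  by rewrite lerDr; nneg.
apply: ler_sum => p _; rewrite /dcoef normrM normr_nat.
rewrite (_ : _ * _ = `|c p.+1| * (p.+1%:R * r ^+ p)); last by ring.
rewrite ler_wpM2l // /s exprMn; apply: ler_pM; [nneg|nneg|exact: natr_le_exp2|].
apply: (@le_trans _ _ ((1 + r) ^+ p)).
  by apply: lerXn2r; rewrite ?nnegrE ?addr_ge0 // lerDr.
by rewrite exprS ler_peMl ?exprn_ge0 ?addr_ge0 // lerDl.
Qed.

Lemma power_taylor (z h : C) (rho : R) p : 1 <= rho -> cmod z <= rho -> cmod (z + h) <= rho ->
  cmod ((z + h) ^+ p - z ^+ p - h * (p%:R * z ^+ p.-1)) <= (p ^ 2)%:R * rho ^+ p * cmod h ^+ 2.
Proof.
move=> r1 hz hzh; have r0 : 0 <= rho by rewrite (le_trans ler01).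
elim: p => [|p ih]; first by rewrite !expr0 subrr mul0r mulr0 subr0 cmod0 !mul0r.
have -> : (z + h) ^+ p.+1 - z ^+ p.+1 - h * (p.+1%:R * z ^+ p.+1.-1) =
    (z + h) * ((z + h) ^+ p - z ^+ p - h * (p%:R * z ^+ p.-1)) + p%:R * z ^+ p.-1 * h ^+ 2.
  case: p {ih} => [|p] /=; first by rewrite !expr1 !expr0; ring.
  by rewrite -[p.+2%:R]natr1 !exprS; ring.
apply: le_trans (cmodD _ _) _.
have e1 : cmod ((z + h) * ((z + h) ^+ p - z ^+ p - h * (p%:R * z ^+ p.-1))) <=
    (p ^ 2)%:R * rho ^+ p.+1 * cmod h ^+ 2.
  rewrite cmodM exprS; apply: le_trans (ler_pM (cmod_ge0 _) (cmod_ge0 _) hzh ih) _.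
  by rewrite le_eqVlt; apply/orP; left; apply/eqP; ring.
have e2 : cmod (p%:R * z ^+ p.-1 * h ^+ 2) <= p%:R * rho ^+ p.+1 * cmod h ^+ 2.
  rewrite cmodM (cmodX h) ler_wpM2r ?sqr_ge0 // cmodM cmod_nat ler_wpM2l // cmodX.
  apply: (@le_trans _ _ (rho ^+ p.-1)); first by apply: lerXn2r; rewrite ?nnegrE ?cmod_ge0.
  by apply: ler_weXn2l => //; case: p {ih e1} => //= p; rewrite ltnW.
apply: le_trans (lerD e1 e2) _; rewrite -!mulrDl -natrD.
rewrite ler_wpM2r ?sqr_ge0 // ler_wpM2r ?exprn_ge0 // ler_nat.
by rewrite -!mulnn mulSn mulnS; lia.
Qed.

(** The coefficients are summable at the radius [4 * rho], and [p ^ 2 <= 4 ^ p], so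
that the second order remainders of the monomials add up to [O (cmod h ^+ 2)]. *)
Lemma is_derive_pser c (z : C) : ecoef c -> is_derive z 1 (pser c) (pser (dcoef c) z).
Proof.
move=> ec; pose rho := cmod z + 1.
have rho1 : 1 <= rho by rewrite lerDr cmod_ge0.
have [M HM] : exists M : R, forall n, \sum_(p < n) `|c p| * (4 * rho) ^+ p <= M.
  by apply: ec; rewrite mulr_ge0 // (le_trans ler01).
have M0 : 0 <= M by apply: le_trans (HM 0%N); rewrite big_ord0.
have B0 : 0 < 2 * M + 1 by rewrite ltr_wpDl // mulr_ge0.
apply/is_deriveCP => e e0.
exists (Num.min 1 (e / (2 * M + 1))); first by rewrite lt_min ltr01 divr_gt0.
move=> h; rewrite lt_min => /andP[/ltW h1]; rewrite ltr_pdivlMr // => /ltW h2.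
have hz : cmod z <= rho by rewrite lerDl.
have hzh : cmod (z + h) <= rho by apply: le_trans (cmodD _ _) _; rewrite lerD2l.
have cv := ccvgB (ccvgB (ccvg_shift 1 (pser_cvg (z + h) ec)) (ccvg_shift 1 (pser_cvg z ec)))
  (ccvgM (ccvg_cst h) (pser_cvg z (ecoef_dcoef ec))).
apply: (@le_trans _ _ (2 * (M * cmod h ^+ 2))); last first.
  rewrite expr2 !mulrA ler_wpM2r ?cmod_ge0 //; apply: le_trans h2.
  by rewrite mulrC ler_wpM2l ?cmod_ge0 // lerDl.
apply: ccvg_le cv _ => n; rewrite addn1 /psum.
have -> : h * (\sum_(p < n) rc (dcoef c p) * z ^+ p) =
    \sum_(p < n.+1) rc (c p) * (h * (p%:R * z ^+ p.-1)).
  rewrite big_ord_recl mul0r !mulr0 add0r mulr_sumr; apply: eq_bigr => p _.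
  by rewrite lift0 /= /dcoef rcM rcMn; ring.
rewrite -!sumrB; apply: le_trans (cmod_sum _ _ _) _.
apply: le_trans (_ : \sum_(p < n.+1) `|c p| * (4 * rho) ^+ p * cmod h ^+ 2 <= _); last first.
  by rewrite -mulr_suml ler_wpM2r ?sqr_ge0.
apply: ler_sum => p _; rewrite -!mulrBr cmodM cmod_rc -mulrA ler_wpM2l //.
apply: le_trans (power_taylor p rho1 hz hzh) _.
rewrite ler_wpM2r ?sqr_ge0 // exprMn ler_wpM2r ?exprn_ge0 ?(le_trans ler01) //.
rewrite natrX (_ : 4 = 2 ^+ 2 :> R); last by rewrite -natrX.
by rewrite exprAC lerXn2r ?nnegrE ?exprn_ge0 // natr_le_exp2.
Qed.

Lemma derive1_pser c : ecoef c -> derive1 (pser c) = pser (dcoef c).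
Proof.
move=> ec; apply/funext => z; rewrite derive1E.
by have [_ ->] := is_derive_pser z ec.
Qed.

Lemma ecoef_iter c i : ecoef c -> ecoef (iter i dcoef c).
Proof. by move=> ec; elim: i => //= i; exact: ecoef_dcoef. Qed.

Lemma derive1n_pser c i : ecoef c -> derive1n i (pser c) = pser (iter i dcoef c).
Proof.
move=> ec; elim: i => [|i ih]; first by rewrite derive1n0.
by rewrite derive1nS ih derive1_pser //; exact: ecoef_iter.
Qed.

Lemma pser0 c : ecoef c -> pser c 0 = rc (c 0%N).
Proof.
move=> ec; have h1 := ccvg_shift 1 (pser_cvg 0 ec).
apply: ccvg_uniq h1 _; rewrite (_ : (fun n => _) = fun=> rc (c 0%N)); first exact: ccvg_cst.
apply/funext => n; rewrite addn1 /psum big_ord_recl expr0 mulr1 big1 ?addr0 // => i _.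
by rewrite expr0n mulr0.
Qed.

Lemma pser_shift c c' k z : ecoef c -> ecoef c' ->
  (forall s, (s < k)%N -> c s = 0) -> (forall s, c (s + k)%N = c' s) ->
  pser c z = z ^+ k * pser c' z.
Proof.
move=> ec ec' h0 hk; have h1 := ccvg_shift k (pser_cvg z ec).
apply: ccvg_uniq h1 _; have := ccvgM (ccvg_cst (z ^+ k)) (pser_cvg z ec').
congr ccvg; apply/funext => n; rewrite /psum addnC big_split_ord /=.
rewrite [X in _ = X + _]big1 ?add0r => [|i _]; last by rewrite h0 // rc0 mul0r.
by rewrite mulr_sumr; apply: eq_bigr => i _; rewrite addnC hk exprD; ring.
Qed.

End EntireSeries.

(** * Existence of the fundamental solutions *)

Section ExistenceOfSolutions.
Variable R : realType.
Local Notation C := (Cplx R).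

(** Taylor derivatives at 0 of the solution with data [delta_ij]: the equation
forces [e_(s+n+1) = s (s-1) ... (s-k+1) e_(s-k+m)]. The fuel replaces an argument
of well-foundedness, as the index decreases by [n + 1 + k - m]. *)
Fixpoint taylor_fuel (n m k j fuel p : nat) : nat :=
  if fuel is fuel'.+1 then
    if (p <= n)%N then (p == j : nat)
    else ((p - n.+1) ^_ k * taylor_fuel n m k j fuel' (p - n.+1 - k + m))%N
  else 0%N.

Definition taylor_data n m k j p := taylor_fuel n m k j p.+1 p.

Lemma taylor_fuel_indep n m k j f1 f2 p : (m <= n)%N -> (p < f1)%N -> (p < f2)%N ->
  taylor_fuel n m k j f1 p = taylor_fuel n m k j f2 p.
Proof.
move=> mn; elim: f1 f2 p => [//|f1 ih] [//|f2] p h1 h2 /=.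
by case: leqP => // pn; rewrite (ih f2) //; lia.
Qed.

Lemma taylor_data_init n m k j p : (p <= n)%N -> taylor_data n m k j p = (p == j).
Proof. by move=> h; rewrite /taylor_data /= h. Qed.

Lemma taylor_data_rec n m k j s : (m <= n)%N ->
  taylor_data n m k j (s + n.+1) = (s ^_ k * taylor_data n m k j (s - k + m))%N.
Proof.
move=> mn; rewrite /taylor_data [LHS]/= ifF; last by apply/negbTE; lia.
rewrite addnK; congr (_ * _)%N; apply: taylor_fuel_indep => //; lia.
Qed.

Lemma fact_ratio (t s m : nat) : (t <= s)%N -> ((t + m)`! * s`! <= t`! * (s + m)`!)%N.
Proof.
move=> ts; elim: m => [|m ih]; first by rewrite !addn0.
rewrite !addnS !factS -mulnA [leqRHS]mulnCA; apply: leq_mul => //; lia.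
Qed.

(** The terms from the index [p0 + N] on add up to at most half of the whole sum,
which is therefore at most twice the sum of the first [p0 + N] terms. *)
Lemma ecoef_geometric (T : nat -> R) (N p0 : nat) : (forall p, 0 <= T p) ->
  (forall p, (p0 <= p)%N -> T (p + N)%N <= T p / 2) ->
  exists M, forall n, \sum_(p < n) T p <= M.
Proof.
move=> T0 H; pose A := \sum_(p < p0 + N) T p.
exists (2 * A) => n.
have mono a b : (a <= b)%N -> \sum_(p < a) T p <= \sum_(p < b) T p.
  move=> ab; rewrite -(subnKC ab) big_split_ord /= lerDl; apply: sumr_ge0 => i _; exact: T0.
have : \sum_(p < (p0 + N) + n) T p <= A + (\sum_(p < (p0 + N) + n) T p) / 2.
  rewrite {1}big_split_ord /= lerD2l.
  apply: (@le_trans _ _ (\sum_(p < n) T (p0 + p)%N / 2)).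
    by apply: ler_sum => i _; rewrite addnAC H // leq_addr.
  rewrite -mulr_suml ler_wpM2r ?invr_ge0 //.
  apply: le_trans (_ : \sum_(p < p0 + n) T p <= _).
    by rewrite big_split_ord /= lerDr; apply: sumr_ge0 => i _; exact: T0.
  by apply: mono; lia.
have := mono n ((p0 + N) + n)%N (leq_addl _ _); lra.
Qed.

(** When the index grows by [N = n + 1 + k - m], the coefficient is divided by at
least the new index, which exceeds any fixed power of the radius. *)
Lemma taylor_ecoef n m k j : (m <= n)%N ->
  ecoef (fun p => (taylor_data n m k j p)%:R / p`!%:R : R).
Proof.
move=> mn; pose c p : R := (taylor_data n m k j p)%:R / p`!%:R.
change (ecoef c); move=> r r0.
have c0 p : 0 <= c p by rewrite divr_ge0.
pose N := (n.+1 + k - m)%N.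
have crec p : (m <= p)%N -> c (p + N)%N <= c p / (p + N)%:R.
  move=> mp; have -> : (p + N)%N = (p - m + k + n.+1)%N by rewrite /N; lia.
  set s := (p - m + k)%N.
  have sk : (s ^_ k * (p - m)`! = s`!)%N.
    by have := ffact_fact (leq_addl (p - m) k); rewrite addnK.
  rewrite /c taylor_data_rec // {2}/s addnK subnK // natrM (mulrC (s ^_ k)%:R) -!mulrA.
  rewrite ler_wpM2l // -invfM -natrM.
  rewrite ler_pdivrMr; last by rewrite ltr0n fact_gt0.
  rewrite mulrC ler_pdivlMr; last by rewrite ltr0n muln_gt0 fact_gt0 addnS.
  rewrite -natrM ler_nat -(leq_pmul2r (fact_gt0 (p - m))).
  have h1 := @fact_ratio (p - m) s m (leq_addr _ _); rewrite subnK // in h1.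
  have h2 : ((s + m)`! <= (s + n)`!)%N by apply: leq_fact; rewrite leq_add2l.
  have h3 : (p`! * s`! <= (p - m)`! * (s + n)`!)%N.
    by apply: leq_trans h1 _; rewrite leq_mul2l h2 orbT.
  rewrite addnS factS.
  have -> : (s ^_ k * (p`! * (s + n).+1) * (p - m)`! = (s + n).+1 * (p`! * s`!))%N.
    by rewrite -sk; ring.
  have -> : ((s + n).+1 * (s + n)`! * (p - m)`! = (s + n).+1 * ((p - m)`! * (s + n)`!))%N.
    by ring.
  by rewrite leq_mul2l h3 orbT.
pose T p := `|c p| * r ^+ p.
have T0 p : 0 <= T p by rewrite /T; nneg.
pose p1 := Num.truncn (2 * r ^+ N).
apply: (@ecoef_geometric T N (m + p1.+1)) => // p hp.
rewrite /T !ger0_norm // exprD.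
have pm : (m <= p)%N by lia.
apply: le_trans (_ : c p / (p + N)%:R * (r ^+ p * r ^+ N) <= _).
  by rewrite ler_wpM2r ?mulr_ge0 ?exprn_ge0 // crec.
rewrite (_ : c p / (p + N)%:R * (r ^+ p * r ^+ N) = c p * r ^+ p * (r ^+ N / (p + N)%:R)); last by ring.
apply: ler_wpM2l; first by rewrite mulr_ge0 ?exprn_ge0.
have hpN : 2 * r ^+ N <= (p + N)%:R.
  apply: ltW; apply: lt_le_trans (truncnS_gt _) _.
  by rewrite -/p1 ler_nat; lia.
rewrite ler_pdivrMr; first lra.
by rewrite ltr0n; lia.
Qed.

Lemma existence_fundamental (n m k : nat) : (m <= n)%N ->
  exists f : 'I_n.+1 -> C -> C, fundamental_solutions m k f.
Proof.
move=> mn.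
pose c (j p : nat) : R := (taylor_data n m k j p)%:R / p`!%:R.
have ec j : ecoef (c j) by exact: taylor_ecoef.
have iterE j i s : iter i (@dcoef R) (c j) s = (taylor_data n m k j (s + i))%:R / s`!%:R.
  elim: i s => [|i ih] s; first by rewrite addn0.
  rewrite iterS /dcoef ih addSnnS factS natrM; field.
  by rewrite nat1r !pnatr_eq0 -!lt0n fact_gt0.
exists (fun j => pser (c j)); split.
- by move=> j z; have [] := is_derive_pser z (ec j).
- move=> j z; rewrite !derive1n_pser //; apply: pser_shift; try exact: ecoef_iter.
    by move=> s sk; rewrite iterE taylor_data_rec // ffact_small // mul0n mul0r.
  move=> s; rewrite !iterE taylor_data_rec // addnK.
  have -> : ((s + k) ^_ k * taylor_data n m k j (s + m))%:R =
    (s + k)`!%:R / s`!%:R * (taylor_data n m k j (s + m))%:R :> R.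
    rewrite natrM -(ffact_fact (leq_addl s k)) addnK natrM mulfK //.
  by field; rewrite !pnatr_eq0 -!lt0n !fact_gt0.
- move=> i j; rewrite derive1n_pser // pser0 ?iterE; last exact: ecoef_iter.
  rewrite add0n taylor_data_init; last by rewrite -ltnS.
  by rewrite fact0 divr1 rcMn.
Qed.

End ExistenceOfSolutions.

(** * Higher derivatives of entire functions *)

Section Derivatives.
Variable R : realType.
Local Notation C := (Cplx R).

Lemma entire_derive1n (f : C -> C) i : entire f -> entire (derive1n i f).
Proof.
move=> ef; elim: i => [|i ih]; first by rewrite derive1n0.
by rewrite derive1nS; exact: entire_derive1.
Qed.

Lemma is_derive_derive1n (f : C -> C) i (z : C) : entire f ->
  is_derive z 1 (derive1n i f) (derive1n i.+1 f z).
Proof.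
move=> ef; rewrite derive1nS derive1E; apply: DeriveDef => //.
exact: entire_derive1n.
Qed.

Lemma rder_derive1n (f : C -> C) i (d : C) s : entire f ->
  rder (fun t => derive1n i f (rc t * d)) s (d * derive1n i.+1 f (rc s * d)).
Proof.
move=> ef; have := @rder_comp _ (derive1n i f) 0 d (derive1n i.+1 f (rc s * d)) s.
rewrite add0r; have -> : (fun x => derive1n i f (0 + rc x * d)) =
  (fun x => derive1n i f (rc x * d)) by apply/funext => x; rewrite add0r.
by apply; exact: is_derive_derive1n.
Qed.

Lemma is_derive_lincomb (I : Type) (r : seq I) (a : I -> C) (f : I -> C -> C) (df : I -> C) (z : C) :
  (forall j, is_derive z 1 (f j) (df j)) ->
  is_derive z 1 (fun z => \sum_(j <- r) a j * f j z) (\sum_(j <- r) a j * df j).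
Proof.
move=> H; elim: r => [|j r ih].
  by rewrite big_nil; under eq_fun do rewrite big_nil; exact: is_derive_cst.
rewrite big_cons; under eq_fun do rewrite big_cons.
exact: (is_deriveD (is_deriveZ (a j) (H j)) ih).
Qed.

Lemma derive1n_lincomb (I : Type) (r : seq I) (a : I -> C) (f : I -> C -> C) i :
  (forall j, entire (f j)) ->
  derive1n i (fun z => \sum_(j <- r) a j * f j z) =
  (fun z => \sum_(j <- r) a j * derive1n i (f j) z).
Proof.
move=> ef; elim: i => [|i ih]; first by [].
rewrite derive1nS ih; apply/funext => z; rewrite derive1E.
by have [_ ->] := is_derive_lincomb r a (fun j => is_derive_derive1n i z (ef j)).
Qed.

Lemma entire_lincomb (I : Type) (r : seq I) (a : I -> C) (f : I -> C -> C) :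
  (forall j, entire (f j)) -> entire (fun z => \sum_(j <- r) a j * f j z).
Proof.
by move=> ef z; have [] := is_derive_lincomb r a (fun j => is_derive_derive1n 0 z (ef j)).
Qed.

Lemma is_derive_dilation (f : C -> C) (a z l : C) : is_derive (a * z) 1 f l ->
  is_derive z 1 (fun x => f (a * x)) (a * l).
Proof.
move=> /is_deriveCP H; apply/is_deriveCP => t t0.
pose M := cmod a + 1.
have M0 : 0 < M by rewrite ltr_wpDl // cmod_ge0.
have [d d0 Hd] := H (t / M) (divr_gt0 t0 M0).
exists (d / M); first by rewrite divr_gt0.
move=> h; rewrite ltr_pdivlMr // => hd.
have lM : cmod (a * h) <= cmod h * M by rewrite cmodM mulrC ler_wpM2l ?cmod_ge0 // lerDl.
have := Hd _ (le_lt_trans lM hd); rewrite mulrDr => /le_trans; rewrite mulrCA mulrA; apply.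
apply: le_trans (ler_wpM2l _ lM) _; first by rewrite ltW ?divr_gt0.
by rewrite mulrCA divfK ?gt_eqF // mulrC.
Qed.

Lemma derive1n_dilation (f : C -> C) (a : C) i : entire f ->
  derive1n i (fun z => f (a * z)) = (fun z => a ^+ i * derive1n i f (a * z)).
Proof.
move=> ef; elim: i => [|i ih].
  by rewrite derive1n0; apply/funext => z; rewrite expr0 mul1r.
rewrite derive1nS ih; apply/funext => z; rewrite derive1E.
have [_ ->] := is_deriveZ (a ^+ i) (is_derive_dilation (is_derive_derive1n i (a * z) ef)).
by rewrite exprSr -mulrA.
Qed.

Lemma entire_dilation (f : C -> C) (a : C) : entire f -> entire (fun z => f (a * z)).
Proof.
by move=> ef z; have [] := is_derive_dilation (is_derive_derive1n 0 (a * z) ef).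
Qed.

(** The left-hand side bounds the derivative of the sum of squares in a system where
each entry is driven by the next one and the last entry by [c] times the entry
[m]; so this is the hypothesis of a Gronwall estimate. *)
Lemma cyclic_sum_le (w : nat -> R) (n m : nat) (c : R) : 0 <= c -> (m <= n)%N ->
  \sum_(i < n) 2 * (w i * w i.+1) + 2 * (c * (w n * w m)) <=
  2 * (1 + c) * \sum_(i < n.+1) w i ^+ 2.
Proof.
move=> c0 mn; set E := \sum_(i < n.+1) _.
have Ew i : (i <= n)%N -> w i ^+ 2 <= E.
  move=> iN; rewrite /E (bigD1 (Ordinal (iN : (i < n.+1)%N))) //= lerDl.
  by apply: sumr_ge0 => j _; exact: sqr_ge0.
have h1 : \sum_(i < n) 2 * (w i * w i.+1) <= 2 * E.
  apply: le_trans (_ : \sum_(i < n) (w i ^+ 2 + w i.+1 ^+ 2) <= _).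
    by apply: ler_sum => i _; have := sqr_ge0 (w i - w i.+1); lra.
  rewrite big_split /= mulr_natl mulr2n; apply: lerD; rewrite /E.
    by rewrite big_ord_recr /= lerDl sqr_ge0.
  by rewrite big_ord_recl /= lerDr sqr_ge0.
have h2 : 2 * (w n * w m) <= 2 * E.
  have := Ew n (leqnn n); have := Ew m mn; have := sqr_ge0 (w n - w m); lra.
have := ler_wpM2l c0 h2; move: h1; lra.
Qed.

End Derivatives.

(** * Uniqueness of solutions *)

Section Solutions.
Variable R : realType.
Local Notation C := (Cplx R).
Variables (n m k : nat).
Hypothesis mn : (m <= n)%N.

Definition solution (u : C -> C) := entire u /\
  forall z, derive1n n.+1 u z = z ^+ k * derive1n m u z.

Lemma solution_lincomb (I : Type) (r : seq I) (a : I -> C) (f : I -> C -> C) :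
  (forall j, solution (f j)) -> solution (fun z => \sum_(j <- r) a j * f j z).
Proof.
move=> H; have ef j : entire (f j) by have [] := H j.
split; first exact: entire_lincomb.
move=> z; rewrite !derive1n_lincomb // mulr_sumr; apply: eq_bigr => j _.
by have [_ ->] := H j; ring.
Qed.

Lemma solution_dilation (u : C -> C) (a : C) : a ^+ (n.+1 + k) = a ^+ m ->
  solution u -> solution (fun z => u (a * z)).
Proof.
move=> am [eu Hu]; split; first exact: entire_dilation.
move=> z; rewrite !derive1n_dilation // Hu exprMn.
by rewrite mulrA mulrA -exprD am; ring.
Qed.

Definition energy (u : C -> C) (d : C) (s : R) : R :=
  \sum_(i < n.+1) cmod (derive1n i u (rc s * d)) ^+ 2.

(** Along a ray the energy satisfies a linear differential inequality whose rate
does not depend on the direction. A zero jet at 0 therefore stays zero, and the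
jets on a circle have a common bound. *)
Lemma energy_growth u (d : C) (s : R) : solution u -> cmod d <= 1 -> 0 <= s ->
  energy u d s <= energy u d 0 * expR (2 * (1 + s ^+ k) * s).
Proof.
move=> [eu Hu] d1 s0.
pose y (i : nat) (t : R) : C := derive1n i u (rc t * d).
have dE (t : R) : is_derive t 1 (energy u d)
   (\sum_(i < n.+1) 2 * (Re (y i t) * Re (d * y i.+1 t) + Im (y i t) * Im (d * y i.+1 t))).
  apply: is_derive_sumR => i _; apply: is_derive_cmod2; exact: rder_derive1n.
pose K := 2 * (1 + s ^+ k).
have := @le_exp_gronwall R (energy u d) _ (fun t => K * t) (fun=> K) 0 s s0
  (fun t _ => dE t) (fun t _ => is_derive_linR K t).
rewrite mulr0 subr0; apply => t /andP[t0 ts].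
have step i : 2 * (Re (y i t) * Re (d * y i.+1 t) + Im (y i t) * Im (d * y i.+1 t)) <=
    2 * (cmod (y i t) * cmod (y i.+1 t)).
  rewrite ler_wpM2l //; apply: le_trans (ler_norm _) _.
  apply: le_trans (cdot_le _ _) _; rewrite ler_wpM2l ?cmod_ge0 //.
  by rewrite cmodM ler_piMl ?cmod_ge0.
have yn : cmod (y n.+1 t) <= s ^+ k * cmod (y m t).
  rewrite /y Hu cmodM ler_wpM2r ?cmod_ge0 // cmodX.
  apply: lerXn2r; rewrite ?nnegrE ?cmod_ge0 // cmodM cmod_rc ger0_norm //.
  by apply: le_trans ts; rewrite ler_piMr.
apply: le_trans (cyclic_sum_le (fun i => cmod (y i t)) (exprn_ge0 k s0) mn).
rewrite big_ord_recr /=; apply: lerD; first by apply: ler_sum => i _; exact: step.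
apply: le_trans (step n) _; rewrite ler_wpM2l //.
apply: le_trans (ler_wpM2l (cmod_ge0 _) yn) _.
by rewrite mulrCA.
Qed.

Lemma energy_ge0 u d s : 0 <= energy u d s.
Proof. by apply: sumr_ge0 => j _; exact: sqr_ge0. Qed.

Lemma le_energy u d s i : (i <= n)%N -> cmod (derive1n i u (rc s * d)) ^+ 2 <= energy u d s.
Proof.
move=> iN; rewrite /energy (bigD1 (Ordinal (iN : (i < n.+1)%N))) //= lerDl.
by apply: sumr_ge0 => j _; exact: sqr_ge0.
Qed.

Lemma polar_decomp (z : C) : exists2 d : C, cmod d <= 1 & z = rc (cmod z) * d.
Proof.
have [->|z0] := eqVneq z 0; first by exists 0; rewrite ?cmod0 // mulr0.
have r0 : rc (cmod z) != 0.
  by apply/eqP => -[/eqP]; rewrite cmod_eq0 (negbTE z0).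
exists ((rc (cmod z))^-1 * z); last by rewrite mulVKf.
by rewrite cmodM cmodV cmod_rc ger0_norm ?cmod_ge0 // mulVf // cmod_eq0.
Qed.

Lemma solution_zero u : solution u -> (forall i, (i <= n)%N -> derive1n i u 0 = 0) ->
  forall z, u z = 0.
Proof.
move=> su H z; have [d d1 ->] := polar_decomp z.
have := energy_growth su d1 (cmod_ge0 z).
have -> : energy u d 0 = 0.
  by rewrite /energy big1 // => i _; rewrite rc0 mul0r H ?cmod0 ?expr0n // -ltnS.
rewrite mul0r => h; have := le_trans (le_energy u d (cmod z) (leq0n n)) h.
rewrite derive1n0 => h0; apply/eqP; rewrite -cmod_eq0 -(sqrf_eq0 (cmod _)).
by rewrite eq_le h0 sqr_ge0.
Qed.

Lemma solution_unique u v : solution u -> solution v ->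
  (forall i, (i <= n)%N -> derive1n i u 0 = derive1n i v 0) -> forall z, u z = v z.
Proof.
move=> su sv H z.
pose f (b : bool) := if b then u else v.
pose a (b : bool) : C := if b then 1 else -1.
have sf b : solution (f b) by case: b.
have E (g : bool -> C) : \sum_(b <- [:: true; false]) g b = g true + g false.
  by rewrite !big_cons big_nil addr0.
have := @solution_zero _ (solution_lincomb [:: true; false] a sf) _ z.
rewrite E /= mul1r mulN1r => h; apply/eqP; rewrite -subr_eq0; apply/eqP/h => i iN.
rewrite derive1n_lincomb; last by move=> b; have [] := sf b.
by rewrite E /= mul1r mulN1r H // subrr.
Qed.

End Solutions.

(** * The Wronskian *)

Section Wronskian.
Variable R : realType.
Local Notation C := (Cplx R).

Lemma rder_prod (I : eqType) (r : seq I) (u : I -> R -> C) (v : I -> C) s : uniq r ->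
  (forall i, rder (u i) s (v i)) ->
  rder (fun x => \prod_(i <- r) u i x) s
    (\sum_(i <- r) \prod_(j <- r) (if j == i then v j else u j s)).
Proof.
move=> + H; elim: r => [_|i r ih /= /andP[ir ur]].
  by rewrite big_nil; under eq_fun do rewrite big_nil; exact: rder_cst.
rewrite big_cons; under eq_fun do rewrite big_cons.
have := rderM (H i) (ih ur).
rewrite big_cons eqxx (_ : \prod_(j <- r) (if j == i then v j else u j s) = \prod_(j <- r) u j s).
  rewrite (_ : \sum_(j <- r) \prod_(i0 <- i :: r) _ =
    u i s * \sum_(j <- r) \prod_(i0 <- r) (if i0 == j then v i0 else u i0 s)) //.
  rewrite mulr_sumr; apply: eq_big_seq => j jr; rewrite big_cons ifF //.
  by apply/negbTE; apply: contraNneq ir => ->.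
by apply: eq_big_seq => j jr; rewrite ifF //; apply/negbTE; apply: contraNneq ir => <-.
Qed.

Lemma rder_det n (A : R -> 'M[C]_n) (B : 'M[C]_n) s :
  (forall i j, rder (fun x => A x i j) s (B i j)) ->
  rder (fun x => \det (A x)) s
    (\sum_i \det (\matrix_(r, j) (if r == i then B r j else A s r j))).
Proof.
move=> H; rewrite /determinant exchange_big /=.
apply: rder_sum => p _.
rewrite (_ : \sum_i _ = (-1) ^+ p * \sum_i \prod_r (if r == i then B r (p r) else A s r (p r))).
  by apply: rderZ; apply: (@rder_prod _ (index_enum _) (fun i x => A x i (p i))
    (fun i => B i (p i)) s (index_enum_uniq _)) => i; exact: H.
rewrite mulr_sumr; apply: eq_bigr => i _; congr (_ * _).
by apply: eq_bigr => r _; rewrite mxE.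
Qed.

Variables (n m k : nat).
Hypothesis mn : (m < n)%N.

Lemma det_row_proportional (M : 'M[C]_n.+1) (i i' : 'I_n.+1) (a : C) : i != i' ->
  (forall j, M i j = a * M i' j) -> \det M = 0.
Proof.
move=> ii H.
have := @determinant_multilinear _ _ M (\matrix_(r, j) (M (if r == i then i' else r) j))
  (\matrix_(r, j) (M (if r == i then i' else r) j)) i a 0 _ _ _.
rewrite mul0r addr0 => ->.
- rewrite (@determinant_alternate _ _ _ i i') ?mulr0 // => j.
  by rewrite !mxE eqxx eq_sym (negbTE ii).
- by apply/rowP => j; rewrite !mxE eqxx H mul0r addr0.
- apply/matrixP => r j; rewrite !mxE ifF //; apply/negbTE; rewrite eq_sym neq_lift //.
- apply/matrixP => r j; rewrite !mxE ifF //; apply/negbTE; rewrite eq_sym neq_lift //.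
Qed.

(** Differentiating the row [i] gives a multiple of the row [i + 1], or of the row
[m] if [i = n]; since [m < n], the determinant then has two proportional rows. *)
Lemma wronskian_const (f : 'I_n.+1 -> C -> C) : (forall j, solution n m k (f j)) ->
  forall z, wronskian f z = wronskian f 0.
Proof.
move=> sf z.
have ef j : entire (f j) by have [] := sf j.
pose A (t : R) : 'M[C]_n.+1 := \matrix_(i, j) derive1n i (f j) (rc t * z).
pose B (t : R) : 'M[C]_n.+1 := \matrix_(i, j) (z * derive1n i.+1 (f j) (rc t * z)).
have dA t i j : rder (fun x => A x i j) t (B t i j).
  under [X in rder X]eq_fun do rewrite mxE.
  by rewrite mxE; exact: rder_derive1n.
have dW t : rder (fun x => wronskian f (rc x * z)) t 0.
  have := rder_det (dA t); rewrite big1 // => i _.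
  have [iN|iN] := ltnP i n.
    have iN' : (i.+1 < n.+1)%N by [].
    apply: (@det_row_proportional _ i (Ordinal iN') z); first by rewrite -val_eqE /= neq_ltn leqnn.
    by move=> j; rewrite !mxE eqxx -val_eqE /= gtn_eqF.
  have iE : nat_of_ord i = n by apply/eqP; rewrite eqn_leq -ltnS ltn_ord.
  have mN : (m < n.+1)%N by rewrite ltnW.
  apply: (@det_row_proportional _ i (Ordinal mN) (z * (rc t * z) ^+ k)).
    by rewrite -val_eqE /= iE gtn_eqF.
  move=> j; rewrite !mxE eqxx -val_eqE /= iE ltn_eqF // -mulrA.
  by rewrite -derive1nS; have [_ ->] := sf j.
have := @rder0_const R (fun x => wronskian f (rc x * z)) 0 1 ler01 (fun t _ => dW t).
by rewrite rc0 rc1 mul0r mul1r.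
Qed.

End Wronskian.

(** * Points of the unit circle *)

Section UnitCircle.
Variable R : realType.
Local Notation C := (Cplx R).

Definition cis (x : R) : C := Complex (cos x) (sin x).

Lemma cisD x y : cis (x + y) = cis x * cis y.
Proof. by apply: C_ext => /=; rewrite ?cosD ?sinD //; ring. Qed.
Lemma cis0 : cis 0 = 1.
Proof. by apply: C_ext => /=; rewrite ?cos0 ?sin0. Qed.
Lemma cmod_cis x : cmod (cis x) = 1.
Proof. by rewrite /cmod /= cos2Dsin2 sqrtr1. Qed.
Lemma cis2pi_nat a : cis (a%:R * (2 * pi)) = 1.
Proof.
elim: a => [|a ih]; first by rewrite mul0r cis0.
rewrite -natr1 mulrDl cisD ih mul1r mul1r; apply: C_ext => /=.
  by rewrite mulr_natl cos2pi.
by rewrite mulr_natl sin2pi.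
Qed.
Lemma cisX x a : cis x ^+ a = cis (a%:R * x).
Proof.
elim: a => [|a ih]; first by rewrite mul0r cis0 expr0.
by rewrite exprS ih -cisD -nat1r mulrDl mul1r.
Qed.
Lemma cisN_mul x : cis (- x) * cis x = 1.
Proof. by rewrite -cisD addNr cis0. Qed.

Lemma cis_neq1 (x : R) : 0 < `|x| < 2 * pi -> cis x != 1.
Proof.
move=> /andP[x0 x2]; apply/eqP => /(congr1 (@complex.Re R)) /=.
rewrite -cos_norm; set y := `|x|.
have -> : y = (y / 2) *+ 2 by rewrite -mulr_natr divfK ?pnatr_eq0.
have : 0 < sin (y / 2) by apply: sin_gt0_pi; rewrite -/y in x0 x2; lra.
rewrite cos_mulr2n => h; have := cos2Dsin2 (y / 2); nra.
Qed.

Lemma polarE (r t : R) : polar r t = rc r * cis t.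
Proof. by apply: C_ext; rewrite ?ReMrc ?ImMrc. Qed.

Lemma sum_cis (q : nat) (t : R) : cis t != 1 -> cis (q%:R * t) = 1 ->
  \sum_(i < q) cis (i%:R * t) = 0.
Proof.
move=> t1 tq; apply: (mulfI (_ : cis t - 1 != 0)); first by rewrite subr_eq0.
rewrite mulr0; under eq_bigr do rewrite -cisX.
by rewrite -subrX1 cisX tq subrr.
Qed.

End UnitCircle.

(** * Diagonalisation of the cyclic shift *)

Section DiscreteFourier.
Variable R : realType.
Local Notation C := (Cplx R).
Variables (q m : nat).
Hypothesis q0 : (0 < q)%N.

Let qR : (q%:R : R) != 0. Proof. by rewrite pnatr_eq0 -lt0n. Qed.
Let qC : (q%:R : C) != 0. Proof. by rewrite pnatr_eq0 -lt0n. Qed.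
Let qp : (0 : R) < q%:R. Proof. by rewrite ltr0n. Qed.

(** The [i]-th power of the [j]-th of the [q]-th roots of unity, and the inverse of
that power. *)
Definition zeta (j i : nat) : C := cis (j%:R * i%:R * (2 * pi / q%:R)).
Definition zetaV (j i : nat) : C := cis (- (j%:R * i%:R * (2 * pi / q%:R))).

(** Discrete Fourier coefficients of the entries [m], ..., [m + q - 1]: the
coordinates in an eigenbasis of the cyclic shift of these entries. *)
Definition zcoef (y : nat -> C) (j : nat) : C :=
  rc q%:R^-1 * \sum_(i < q) zetaV j (m + i) * y (m + i)%N.

(** Components along the eigenvalue 0: what is left of [y i] for [i < m] after
subtraction of the eigenvectors for the roots of unity. *)
Definition xcoef (y : nat -> C) (i : nat) : C :=
  y i - \sum_(j < q) zeta j i * zcoef y j.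

Lemma zetaD j a b : zeta j (a + b) = zeta j a * zeta j b.
Proof. by rewrite /zeta /zetaV -cisD natrD; congr cis; ring. Qed.
Lemma zetaVD j a b : zetaV j (a + b) = zetaV j a * zetaV j b.
Proof. by rewrite /zeta /zetaV -cisD natrD; congr cis; ring. Qed.
Lemma zetaV_mul j a : zetaV j a * zeta j a = 1.
Proof. exact: cisN_mul. Qed.
Lemma zeta_q j : zeta j q = 1.
Proof. by rewrite /zeta -mulrA (mulrC q%:R) divfK // cis2pi_nat. Qed.
Lemma zetaV_q j : zetaV j q = 1.
Proof. by have := zetaV_mul j q; rewrite zeta_q mulr1. Qed.
Lemma cmod_zeta j i : cmod (zeta j i) = 1. Proof. exact: cmod_cis. Qed.
Lemma cmod_zetaV j i : cmod (zetaV j i) = 1. Proof. exact: cmod_cis. Qed.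

Lemma cis_root (a b : nat) : a != b -> (a < q)%N -> (b < q)%N ->
  cis ((a%:R - b%:R) * (2 * pi / q%:R) : R) != 1 /\
  cis (q%:R * ((a%:R - b%:R) * (2 * pi / q%:R) : R)) = 1.
Proof.
move=> ab aq bq.
have pp : 0 < 2 * pi / q%:R :> R by rewrite divr_gt0 // mulr_gt0 // pi_gt0.
split.
  apply: cis_neq1; rewrite normrM (gtr0_norm pp) mulr_gt0 //=; last first.
    by rewrite normr_gt0 subr_eq0 eqr_nat.
  rewrite -ltr_pdivlMr // invf_div mulrC divfK ?gt_eqF ?mulr_gt0 ?pi_gt0 //.
  have : (0 : R) <= a%:R by []. have : (0 : R) <= b%:R by [].
  have : (a%:R : R) < q%:R by rewrite ltr_nat. have : (b%:R : R) < q%:R by rewrite ltr_nat.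
  by rewrite ltr_norml; lra.
have -> : q%:R * ((a%:R - b%:R) * (2 * pi / q%:R)) =
    a%:R * (2 * pi) + - (b%:R * (2 * pi)) :> R by field.
rewrite cisD cis2pi_nat mul1r.
by have := @cisN_mul R (b%:R * (2 * pi)); rewrite cis2pi_nat mulr1.
Qed.

Lemma zeta_orth (a b : nat) : (a < q)%N -> (b < q)%N ->
  \sum_(j < q) zeta j (m + a) * zetaV j (m + b) = (q%:R *+ (a == b) : C).
Proof.
move=> aq bq.
have E (j : nat) : zeta j (m + a) * zetaV j (m + b) =
    cis (j%:R * ((a%:R - b%:R) * (2 * pi / q%:R))).
  by rewrite /zeta /zetaV -cisD !natrD; congr cis; ring.
under eq_bigr do rewrite E.
have [->|ab] := eqVneq a b.
  rewrite subrr mul0r; under eq_bigr do rewrite mulr0 cis0.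
  by rewrite sumr_const card_ord mulr1n.
by have [h1 h2] := cis_root ab aq bq; rewrite sum_cis.
Qed.

Lemma xcoef0 y i : (m <= i < m + q)%N -> xcoef y i = 0.
Proof.
move=> /andP[mi iq]; have aq : (i - m < q)%N by rewrite ltn_subLR.
rewrite /xcoef; apply/eqP; rewrite subr_eq0; apply/eqP.
transitivity (rc q%:R^-1 * \sum_(b < q) (\sum_(j < q) zeta j i * zetaV j (m + b)) * y (m + b)%N).
  rewrite -{2}(subnKC mi).
  under eq_bigr do rewrite zeta_orth //.
  rewrite (bigD1 (Ordinal aq)) //= eqxx mulr1n big1 ?addr0 => [|b bi].
    by rewrite subnKC // mulrA rcV rcMn mulVf // mul1r.
  rewrite (negbTE (_ : i - m != b)%N) ?mulr0n ?mul0r //.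
  by apply: contra_neq bi => bi; apply: val_inj.
rewrite mulr_sumr; under eq_bigr do rewrite mulr_suml mulr_sumr.
rewrite exchange_big /=; apply: eq_bigr => j _.
by rewrite /zcoef mulrCA mulr_sumr mulr_sumr; apply: eq_bigr => b _; ring.
Qed.

Lemma zcoef_one j : (j < q)%N -> zcoef (fun=> 1) j = (j == 0%N)%:R.
Proof.
move=> jq; rewrite /zcoef; under eq_bigr do rewrite mulr1 zetaVD.
rewrite -mulr_sumr.
have [->|j0] := eqVneq j 0%N.
  have E i : zetaV 0 i = 1 by rewrite /zetaV !mul0r oppr0 cis0.
  under eq_bigr do rewrite E; rewrite sumr_const card_ord E mul1r rcV rcMn.
  by rewrite mulVf.
have j0' : 0%N != j by rewrite eq_sym.
have [h1 h2] := cis_root j0' q0 jq.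
have E (i : nat) : zetaV j i = cis (i%:R * ((0%:R - j%:R) * (2 * pi / q%:R))).
  by rewrite /zetaV; congr cis; ring.
by under eq_bigr do rewrite E; rewrite sum_cis // !mulr0.
Qed.

Lemma zcoef_shift y j : y (m + q)%N = y m ->
  zcoef (fun i => y i.+1) j = zeta j 1 * zcoef y j.
Proof.
move=> yq; rewrite /zcoef mulrCA; congr (_ * _).
pose g i := zetaV j (m + i) * y (m + i)%N.
have E (i : nat) : zetaV j (m + i) * y (m + i).+1 = zeta j 1 * g i.+1.
  rewrite /g addnS -[in zetaV j (m + i).+1]addn1 (zetaVD j (m + i) 1).
  by rewrite -[LHS]mul1r -(zetaV_mul j 1); ring.
under eq_bigr do rewrite E.
rewrite -mulr_sumr; congr (_ * _); apply: (addrI (g 0%N)).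
have -> : g 0%N + \sum_(i < q) g i.+1 = \sum_(i < q.+1) g i by rewrite big_ord_recl.
rewrite big_ord_recr /= addrC; congr (_ + _).
by rewrite /g zetaVD zetaV_q mulr1 yq addn0.
Qed.

Lemma xcoef_shift y i : y (m + q)%N = y m ->
  xcoef (fun i => y i.+1) i = xcoef y i.+1.
Proof.
move=> yq; rewrite /xcoef; congr (_ - _); apply: eq_bigr => j _.
by rewrite zcoef_shift // mulrA -zetaD addn1.
Qed.

Lemma zcoef_lin a b y1 y2 j :
  zcoef (fun i => a * y1 i - b * y2 i) j = a * zcoef y1 j - b * zcoef y2 j.
Proof.
rewrite /zcoef 2![_ * (rc _ * _)]mulrCA -mulrBr; congr (_ * _).
by rewrite !mulr_sumr -sumrB; apply: eq_bigr => i _; ring.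
Qed.

Lemma xcoef_lin a b y1 y2 i :
  xcoef (fun i => a * y1 i - b * y2 i) i = a * xcoef y1 i - b * xcoef y2 i.
Proof.
rewrite /xcoef; under eq_bigr do rewrite zcoef_lin.
rewrite !mulrBr !mulr_sumr.
rewrite (eq_bigr (fun j : 'I_q => a * (zeta j i * zcoef y1 j) - b * (zeta j i * zcoef y2 j))).
  by rewrite sumrB; ring.
by move=> j _; ring.
Qed.

Lemma rder_zcoef (Y : nat -> R -> C) (dY : nat -> C) s j :
  (forall i, rder (Y i) s (dY i)) ->
  rder (fun t => zcoef (fun i => Y i t) j) s (zcoef dY j).
Proof. by move=> H; apply: rderZ; apply: rder_sum => i _; apply: rderZ. Qed.

Lemma rder_xcoef (Y : nat -> R -> C) (dY : nat -> C) s i :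
  (forall i, rder (Y i) s (dY i)) ->
  rder (fun t => xcoef (fun i => Y i t) i) s (xcoef dY i).
Proof.
by move=> H; apply: rderB => //; apply: rder_sum => j _; apply: rderZ; exact: rder_zcoef.
Qed.

Lemma zcoef_le y j B : (forall i, (i < m + q)%N -> cmod (y i) <= B) ->
  cmod (zcoef y j) <= B.
Proof.
move=> H; rewrite cmodM cmod_rc ger0_norm ?invr_ge0 // mulrC ler_pdivrMr //.
apply: le_trans (cmod_sum _ _ _) _.
apply: le_trans (_ : \sum_(i < q) B <= _); last by rewrite sumr_const card_ord mulr_natr.
by apply: ler_sum => i _; rewrite cmodM cmod_zetaV mul1r H // ltn_add2l.
Qed.

Lemma xcoef_le y i B : (forall i, (i < m + q)%N -> cmod (y i) <= B) -> (i < m + q)%N ->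
  cmod (xcoef y i) <= (1 + q%:R) * B.
Proof.
move=> H iq; apply: le_trans (cmodB _ _) _; rewrite mulrDl mul1r lerD ?H //.
apply: le_trans (cmod_sum _ _ _) _.
apply: le_trans (_ : \sum_(i < q) B <= _); last by rewrite sumr_const card_ord mulr_natl.
by apply: ler_sum => j _; rewrite cmodM cmod_zeta mul1r zcoef_le.
Qed.

End DiscreteFourier.

(** * Differential inequalities for the spectral components *)

Section SystemEstimates.
Variable R : realType.
Local Notation C := (Cplx R).

Variables (q m : nat).
Hypothesis q0 : (0 < q)%N.
Variables (eps : R).
Hypotheses (eps0 : 0 < eps) (eps1 : eps <= 1).

(** The component along the root of unity 1, which has the largest growth rate in
the sector around the positive axis. *)
Definition dominant (y : nat -> C) : R := cmod (zcoef q m y 0) ^+ 2.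

Definition hatx (y : nat -> C) (i : nat) : C := rc (eps ^+ (m - i)) * xcoef q m y i.

(** Squared size of the other components; the weights [eps ^ (m - i)] make the
nilpotent part of the system small. *)
Definition recessive (y : nat -> C) : R :=
  \sum_(j < q | (0 < j)%N) cmod (zcoef q m y j) ^+ 2 + \sum_(i < m) cmod (hatx y i) ^+ 2.

Lemma dominant_ge0 y : 0 <= dominant y. Proof. exact: sqr_ge0. Qed.

Lemma recessive_ge0 y : 0 <= recessive y.
Proof. by rewrite addr_ge0 // sumr_ge0 // => i _; exact: sqr_ge0. Qed.

Lemma zcoef_recessive y j : (0 < j < q)%N -> cmod (zcoef q m y j) ^+ 2 <= recessive y.
Proof.
move=> /andP[j0 jq]; rewrite /recessive (bigD1 (Ordinal jq)) //= -addrA lerDl addr_ge0 //.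
  by apply: sumr_ge0 => i _; exact: sqr_ge0.
by apply: sumr_ge0 => i _; exact: sqr_ge0.
Qed.

Lemma hatx_recessive y i : (i < m)%N -> cmod (hatx y i) ^+ 2 <= recessive y.
Proof.
move=> im; rewrite /recessive [X in _ + X](bigD1 (Ordinal im)) //= addrCA lerDl addr_ge0 //.
  by apply: sumr_ge0 => j _; exact: sqr_ge0.
by apply: sumr_ge0 => j _; exact: sqr_ge0.
Qed.

Lemma le_sqrt (x y : R) : 0 <= x -> x ^+ 2 <= y -> x <= Num.sqrt y.
Proof.
by move=> x0 h; rewrite -(ger0_norm x0) -sqrtr_sqr ler_wsqrtr.
Qed.

Definition comp_const : R := eps^-1 ^+ m + q%:R.

Lemma comp_const_ge0 : 0 <= comp_const.
Proof. by rewrite addr_ge0 // exprn_ge0 // invr_ge0 ltW. Qed.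

Lemma epsV_ge (i : nat) (x : R) : 0 <= x -> x <= eps^-1 ^+ m * (eps ^+ (m - i) * x).
Proof.
move=> x0; rewrite mulrA ler_peMl // exprVn.
have e0 := exprn_gt0 m eps0.
rewrite mulrC ler_pdivlMr // mul1r; apply: ler_wiXn2l; rewrite ?(ltW eps0) //.
exact: leq_subr.
Qed.

Lemma xcoef_recessive y i : (i < m + q)%N ->
  cmod (xcoef q m y i) <= eps^-1 ^+ m * Num.sqrt (recessive y).
Proof.
move=> iq; have [mi|im] := leqP m i.
  by rewrite xcoef0 ?mi // cmod0 mulr_ge0 ?sqrtr_ge0 // exprn_ge0 // invr_ge0 ltW.
apply: le_trans (epsV_ge i (cmod_ge0 _)) _.
rewrite ler_wpM2l ?exprn_ge0 ?invr_ge0 ?(ltW eps0) //.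
apply: le_sqrt; first by rewrite mulr_ge0 ?cmod_ge0 // exprn_ge0 // ltW.
have := hatx_recessive y im; rewrite /hatx cmodM cmod_rc ger0_norm //.
by rewrite exprn_ge0 // ltW.
Qed.

Lemma le_comp y i : (i < m + q)%N ->
  cmod (y i) <= comp_const * Num.sqrt (dominant y + recessive y).
Proof.
move=> iq; have -> : y i = xcoef q m y i + \sum_(j < q) zeta R q j i * zcoef q m y j.
  by rewrite /xcoef subrK.
apply: le_trans (cmodD _ _) _; rewrite mulrDl; apply: lerD.
  apply: le_trans (xcoef_recessive y iq) _.
  rewrite ler_wpM2l ?exprn_ge0 ?invr_ge0 ?(ltW eps0) //.
  by rewrite ler_wsqrtr // lerDr dominant_ge0.
apply: le_trans (cmod_sum _ _ _) _.
apply: le_trans (_ : \sum_(j < q) Num.sqrt (dominant y + recessive y) <= _); last first.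
  by rewrite sumr_const card_ord mulr_natl.
apply: ler_sum => j _; rewrite cmodM cmod_zeta mul1r; apply: le_sqrt (cmod_ge0 _) _.
have [->|j0] := eqVneq (j : nat) 0%N; first by rewrite lerDl recessive_ge0.
apply: le_trans (zcoef_recessive y _) _; first by rewrite lt0n j0 ltn_ord.
by rewrite lerDr dominant_ge0.
Qed.

(** The dominant component enters every entry with the coefficient 1, so a lower
bound for it is one for the entry once the recessive components are small. *)
Lemma dominant_comp y i : (i < m + q)%N ->
  Num.sqrt (dominant y) - comp_const * Num.sqrt (recessive y) <= cmod (y i).
Proof.
move=> iq; have q0' : (0 < q)%N := q0.
have z0 : zeta R q 0 i = 1 by rewrite /zeta !mul0r cis0.
have E : y i = zcoef q m y 0 + (xcoef q m y i + \sum_(j < q | (0 < j)%N) zeta R q j i * zcoef q m y j).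
  rewrite /xcoef (bigD1 (Ordinal q0')) //= z0 mul1r.
  rewrite (eq_bigl (fun j : 'I_q => (0 < j)%N)); last by move=> j; rewrite -lt0n.
  by ring.
have -> : Num.sqrt (dominant y) = cmod (zcoef q m y 0) by rewrite sqrtr_sqr ger0_norm ?cmod_ge0.
rewrite lerBlDr addrC -lerBlDr.
have := cmod_subr (zcoef q m y 0) (y i); rewrite cmodBC {2}E addrAC subrr add0r => h.
apply: le_trans h _; apply: le_trans (cmodD _ _) _; rewrite mulrDl; apply: lerD.
  exact: xcoef_recessive.
apply: le_trans (cmod_sum _ _ _) _.
apply: le_trans (_ : \sum_(j < q | (0 < j)%N) Num.sqrt (recessive y) <= _); last first.
  apply: le_trans (_ : \sum_(j < q) Num.sqrt (recessive y) <= _).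
    by rewrite [leRHS](bigID (fun j : 'I_q => (0 < j)%N)) /= lerDl sumr_ge0 // => j _; exact: sqrtr_ge0.
  by rewrite sumr_const card_ord mulr_natl.
apply: ler_sum => j j0; rewrite cmodM cmod_zeta mul1r; apply: le_sqrt (cmod_ge0 _) _.
by rewrite zcoef_recessive // j0 ltn_ord.
Qed.

Lemma components_le y B : 0 <= B -> (forall i, (i < m + q)%N -> cmod (y i) <= B) ->
  dominant y + recessive y <= (q%:R + m%:R * (1 + q%:R) ^+ 2) * B ^+ 2.
Proof.
move=> B0 H; rewrite mulrDl /recessive addrA; apply: lerD.
  have -> : dominant y + \sum_(j < q | (0 < j)%N) cmod (zcoef q m y j) ^+ 2 =
     \sum_(j < q) cmod (zcoef q m y j) ^+ 2.
    have q0' : (0 < q)%N := q0.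
    rewrite [RHS](bigD1 (Ordinal q0')) //=; congr (_ + _).
    by apply: eq_bigl => j; rewrite lt0n -val_eqE.
  apply: le_trans (_ : \sum_(j < q) B ^+ 2 <= _); last by rewrite sumr_const card_ord mulr_natl.
  by apply: ler_sum => j _; apply: lerXn2r; rewrite ?nnegrE ?cmod_ge0 // zcoef_le.
apply: le_trans (_ : \sum_(i < m) (1 + q%:R) ^+ 2 * B ^+ 2 <= _); last first.
  by rewrite sumr_const card_ord -mulrA mulr_natl.
apply: ler_sum => i _; rewrite -exprMn; apply: lerXn2r; rewrite ?nnegrE ?cmod_ge0 //.
  by rewrite mulr_ge0 // addr_ge0.
have iq : (i < m + q)%N by rewrite (leq_trans (ltn_ord i)) // leq_addr.
rewrite cmodM cmod_rc ger0_norm ?exprn_ge0 ?(ltW eps0) //.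
apply: le_trans (xcoef_le q0 H iq).
by rewrite ler_piMl ?cmod_ge0 // exprn_ile1 // ltW.
Qed.

Variables (Y : nat -> R -> C) (mu : C) (b beta s : R).
Hypotheses (b0 : 0 <= b) (beta0 : 0 <= beta) (s0 : 0 < s) (mu1 : cmod mu <= 1).
Hypothesis cyclic : Y (m + q)%N s = Y m s.
Hypothesis dY : forall i,
  rder (Y i) s (mu * rc b * Y i.+1 s - rc (beta / s) * (i%:R * Y i s)).

Let y i := Y i s.
Let V := Num.sqrt (dominant y + recessive y).
Let N := dominant y + recessive y.

(** Size of the lower order term [beta / s * i * Y i] in spectral coordinates. *)
Definition drift_const : R := beta * ((1 + q%:R) * ((m + q)%:R * comp_const)).

Lemma drift_const_ge0 : 0 <= drift_const.
Proof.
apply: mulr_ge0 => //; apply: mulr_ge0; first by rewrite addr_ge0.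
by apply: mulr_ge0 => //; exact: comp_const_ge0.
Qed.

Let V2 : V * V = N.
Proof. by rewrite -expr2 sqr_sqrtr // addr_ge0 // ?dominant_ge0 ?recessive_ge0. Qed.

Let V0 : 0 <= V. Proof. exact: sqrtr_ge0. Qed.

Let err i : C := i%:R * y i.

Let err_le i : (i < m + q)%N -> cmod (err i) <= (m + q)%:R * comp_const * V.
Proof.
move=> iq; rewrite cmodM cmod_nat -mulrA ler_pM ?cmod_ge0 // ?le_comp //.
by rewrite ler_nat ltnW.
Qed.

Let zerr_le j : cmod (rc (beta / s) * zcoef q m err j) <= drift_const / s * V.
Proof.
rewrite cmodM cmod_rc ger0_norm ?divr_ge0 ?(ltW s0) // /drift_const.
have h := zcoef_le q0 j err_le.
rewrite (_ : _ * V = beta / s * ((1 + q%:R) * ((m + q)%:R * comp_const * V))); last by ring.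
rewrite ler_wpM2l ?divr_ge0 ?(ltW s0) //; apply: le_trans h _.
rewrite ler_peMl ?mulr_ge0 // ?comp_const_ge0 //.
by rewrite lerDl.
Qed.

Let xerr_le i : (i < m)%N -> cmod (rc (beta / s) * xcoef q m err i) <= drift_const / s * V.
Proof.
move=> im; have iq : (i < m + q)%N by rewrite (leq_trans im) // leq_addr.
rewrite cmodM cmod_rc ger0_norm ?divr_ge0 ?(ltW s0) // /drift_const.
have h := xcoef_le q0 err_le iq.
rewrite (_ : _ * V = beta / s * ((1 + q%:R) * ((m + q)%:R * comp_const * V))); last by ring.
by rewrite ler_wpM2l ?divr_ge0 ?(ltW s0).
Qed.

Let dz j : rder (fun t => zcoef q m (fun i => Y i t) j) s
  (mu * rc b * (zeta R q j 1 * zcoef q m y j) - rc (beta / s) * zcoef q m err j).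
Proof.
rewrite -(@zcoef_shift R q m q0 y j cyclic) -zcoef_lin.
exact: (rder_zcoef q m j dY).
Qed.

Let dx i : rder (fun t => xcoef q m (fun i => Y i t) i) s
  (mu * rc b * xcoef q m y i.+1 - rc (beta / s) * xcoef q m err i).
Proof.
rewrite -(@xcoef_shift R q m q0 y i cyclic) -xcoef_lin.
exact: (rder_xcoef q m i dY).
Qed.

Let cdot_err z e D : cmod z <= V -> cmod e <= D * V -> 2 * `|cdot z e| <= 2 * (D * N).
Proof.
move=> hz he; rewrite ler_wpM2l //; apply: le_trans (cdot_le _ _) _.
by rewrite -V2 mulrA mulrC; apply: ler_pM; rewrite ?cmod_ge0.
Qed.

(** Only the lower order term couples the dominant component to the others. *)
Lemma is_derive_dominant : exists2 dP : R,
  is_derive s 1 (fun t => dominant (fun i => Y i t)) dP &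
  `|dP - 2 * b * Re mu * dominant y| <= 2 * drift_const / s * N.
Proof.
exists (2 * cdot (zcoef q m y 0) (mu * rc b * (zeta R q 0 1 * zcoef q m y 0) -
    rc (beta / s) * zcoef q m err 0)).
  exact: is_derive_cmod2 (dz 0).
rewrite cdotB (_ : mu * rc b * _ = (rc b * mu) * zcoef q m y 0); last first.
  by rewrite /zeta !mul0r cis0 mul1r; ring.
rewrite cdotM ReMrc /dominant.
rewrite (_ : _ - _ = - (2 * cdot (zcoef q m y 0) (rc (beta / s) * zcoef q m err 0))); last by ring.
rewrite normrN normrM ger0_norm // (_ : 2 * drift_const / s * N = 2 * (drift_const / s * N)); last by ring.
apply: cdot_err (zerr_le 0).
by apply: le_sqrt (cmod_ge0 _) _; rewrite lerDl recessive_ge0.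
Qed.

(** The weights turn the nilpotent coupling of the entries below [m] into one of
size [eps], so that to leading order no recessive component grows at a rate
above [g]. *)
Lemma is_derive_recessive (g : R) :
  (forall j, (0 < j < q)%N -> Re (mu * zeta R q j 1) <= g) -> eps <= g ->
  exists2 dR : R,
    is_derive s 1 (fun t => recessive (fun i => Y i t)) dR &
    dR <= 2 * b * g * recessive y + 2 * (q + m)%:R * drift_const / s * N.
Proof.
move=> Hg eg.
pose dzj j := mu * rc b * (zeta R q j 1 * zcoef q m y j) - rc (beta / s) * zcoef q m err j.
pose dxi i := rc (eps ^+ (m - i)) * (mu * rc b * xcoef q m y i.+1 - rc (beta / s) * xcoef q m err i).
exists (\sum_(j < q | (0 < j)%N) 2 * cdot (zcoef q m y j) (dzj j) +
        \sum_(i < m) 2 * cdot (hatx y i) (dxi i)).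
  have d1 : is_derive s 1 (fun t => \sum_(j < q | (0 < j)%N) cmod (zcoef q m (fun i => Y i t) j) ^+ 2)
      (\sum_(j < q | (0 < j)%N) 2 * cdot (zcoef q m y j) (dzj j)).
    by apply: is_derive_sumR => j _; exact: is_derive_cmod2 (dz j).
  have d2 : is_derive s 1 (fun t => \sum_(i < m) cmod (hatx (fun i => Y i t) i) ^+ 2)
      (\sum_(i < m) 2 * cdot (hatx y i) (dxi i)).
    by apply: is_derive_sumR => i _; exact: is_derive_cmod2 (rderZ _ (dx i)).
  exact: is_deriveD d1 d2.
have N0 : 0 <= N by rewrite addr_ge0 // ?dominant_ge0 ?recessive_ge0.
have K0 : 0 <= 2 * drift_const / s * N.
  by rewrite mulr_ge0 // divr_ge0 ?(ltW s0) // mulr_ge0 // drift_const_ge0.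
have zV j : (0 < j < q)%N -> cmod (zcoef q m y j) <= V.
  move=> hj; apply: le_sqrt (cmod_ge0 _) _; apply: le_trans (zcoef_recessive y hj) _.
  by rewrite lerDr dominant_ge0.
have xV i : (i < m)%N -> cmod (hatx y i) <= V.
  move=> im; apply: le_sqrt (cmod_ge0 _) _; apply: le_trans (hatx_recessive y im) _.
  by rewrite lerDr dominant_ge0.
have Z j : (0 < j < q)%N -> 2 * cdot (zcoef q m y j) (dzj j) <=
    2 * b * g * cmod (zcoef q m y j) ^+ 2 + 2 * drift_const / s * N.
  move=> hj; rewrite /dzj cdotB.
  rewrite (_ : mu * rc b * _ = (rc b * (mu * zeta R q j 1)) * zcoef q m y j); last by ring.
  rewrite cdotM ReMrc mulrBr; apply: lerD.
    rewrite mulrA ler_wpM2r ?sqr_ge0 // mulrA ler_wpM2l ?Hg //.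
    by rewrite mulr_ge0.
  rewrite -mulrN (_ : 2 * drift_const / s * N = 2 * (drift_const / s * N)); last by ring.
  apply: le_trans (cdot_err (zV j hj) (zerr_le j)).
  by rewrite ler_wpM2l // -normrN ler_norm.
have hatS i : (i < m)%N -> rc (eps ^+ (m - i)) * xcoef q m y i.+1 = rc eps * hatx y i.+1.
  by move=> im; rewrite /hatx mulrA -rcM -exprS -subSn.
have X i : (i < m)%N -> 2 * cdot (hatx y i) (dxi i) <=
    b * eps * (cmod (hatx y i) ^+ 2 + cmod (hatx y i.+1) ^+ 2) + 2 * drift_const / s * N.
  move=> im; rewrite /dxi mulrBr cdotB mulrBr; apply: lerD.
    rewrite (_ : _ * (mu * rc b * _) = mu * rc (b * eps) * hatx y i.+1); last first.
      by rewrite mulrCA hatS // rcM; ring.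
    apply: le_trans (ler_wpM2l _ (le_trans (ler_norm _) (cdot_le _ _))) _ => //.
    rewrite (cmodM _ (hatx y i.+1)) (cmodM mu) cmod_rc ger0_norm; last by rewrite mulr_ge0 // ltW.
    have be0 : 0 <= b * eps by rewrite mulr_ge0 // ltW.
    have xy0 : 0 <= cmod (hatx y i) * cmod (hatx y i.+1) by rewrite mulr_ge0 ?cmod_ge0.
    apply: le_trans (_ : b * eps * (2 * (cmod (hatx y i) * cmod (hatx y i.+1))) <= _).
      rewrite [leLHS](_ : _ = cmod mu * (b * eps * (2 * (cmod (hatx y i) * cmod (hatx y i.+1))))); last by ring.
      by rewrite ler_piMl // mulr_ge0 // mulr_ge0.
    rewrite ler_wpM2l //.
    by have := sqr_ge0 (cmod (hatx y i) - cmod (hatx y i.+1)); lra.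
  rewrite -mulrN (_ : 2 * drift_const / s * N = 2 * (drift_const / s * N)); last by ring.
  have he : cmod (rc (eps ^+ (m - i)) * (rc (beta / s) * xcoef q m err i)) <= drift_const / s * V.
    rewrite cmodM cmod_rc ger0_norm ?exprn_ge0 ?(ltW eps0) //.
    apply: le_trans (xerr_le im).
    by rewrite ler_piMl ?cmod_ge0 // exprn_ile1 // ltW.
  apply: le_trans (cdot_err (xV i im) he).
  by rewrite ler_wpM2l // -normrN ler_norm.
have hm : hatx y m = 0 by rewrite /hatx xcoef0 ?mulr0 // leqnn -[X in (X < _)%N]addn0 ltn_add2l.
have SX : \sum_(i < m) (cmod (hatx y i) ^+ 2 + cmod (hatx y i.+1) ^+ 2) <=
    2 * \sum_(i < m) cmod (hatx y i) ^+ 2.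
  rewrite big_split /= mulr_natl mulr2n lerD2l.
  case: (m) hm => [|m'] hm'; first by rewrite !big_ord0.
  rewrite big_ord_recr /= hm' cmod0 expr0n addr0.
  by rewrite [leRHS]big_ord_recl /= lerDr sqr_ge0.
have be0 : 0 <= b * eps by rewrite mulr_ge0 // ltW.
pose SZ := \sum_(j < q | (0 < j)%N) cmod (zcoef q m y j) ^+ 2.
pose SH := \sum_(i < m) cmod (hatx y i) ^+ 2.
have SH0 : 0 <= SH by apply: sumr_ge0 => i _; exact: sqr_ge0.
have T1 : \sum_(j < q | (0 < j)%N) 2 * cdot (zcoef q m y j) (dzj j) <=
    2 * b * g * SZ + q%:R * (2 * drift_const / s * N).
  apply: le_trans (_ : \sum_(j < q | (0 < j)%N) (2 * b * g * cmod (zcoef q m y j) ^+ 2 +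
      2 * drift_const / s * N) <= _).
    by apply: ler_sum => j j0; apply: Z; rewrite j0 ltn_ord.
  rewrite big_split /= -mulr_sumr lerD2l.
  apply: le_trans (_ : \sum_(j < q) (2 * drift_const / s * N) <= _).
    by rewrite [leRHS](bigID (fun j : 'I_q => (0 < j)%N)) /= lerDl sumr_ge0.
  by rewrite sumr_const card_ord [leRHS]mulr_natl.
have T2 : \sum_(i < m) 2 * cdot (hatx y i) (dxi i) <=
    2 * b * g * SH + m%:R * (2 * drift_const / s * N).
  apply: le_trans (_ : \sum_(i < m) (b * eps * (cmod (hatx y i) ^+ 2 + cmod (hatx y i.+1) ^+ 2) +
      2 * drift_const / s * N) <= _).
    by apply: ler_sum => i _; exact: X.
  rewrite big_split /= -mulr_sumr sumr_const card_ord (mulr_natl (2 * drift_const / s * N) m) lerD2r.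
  apply: le_trans (ler_wpM2l be0 SX) _.
  rewrite (_ : b * eps * (2 * SH) = 2 * SH * b * eps); last by ring.
  rewrite (_ : 2 * b * g * SH = 2 * SH * b * g); last by ring.
  by rewrite ler_wpM2l // !mulr_ge0.
apply: le_trans (lerD T1 T2) _.
rewrite /recessive -/SZ -/SH natrD le_eqVlt; apply/orP; left; apply/eqP; ring.
Qed.

End SystemEstimates.

(** * Integrals over intervals *)

Section IntegralsOverIntervals.
Variable R : realType.
Local Notation mu := (@lebesgue_measure R).

Lemma continuous_integrable_segment (f : R -> R) (a b : R) :
  (forall x : R, {for x, continuous f}) -> mu.-integrable `[a, b] (EFin \o f).
Proof.
move=> cf; apply: continuous_compact_integrable; first exact: segment_compact.
by apply: continuous_subspaceT => y; exact: cf.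
Qed.

Lemma continuous_integrable_open (f : R -> R) (a b : R) :
  (forall x : R, {for x, continuous f}) -> mu.-integrable `]a, b[ (EFin \o f).
Proof.
move=> cf; apply: integrableS (continuous_integrable_segment a b cf) => //.
exact: subset_itv_oo_cc.
Qed.

Lemma Rintegral_open_segment (f : R -> R) (a b : R) :
  (forall x : R, {for x, continuous f}) ->
  \int[mu]_(x in `]a, b[) f x = \int[mu]_(x in `[a, b]) f x.
Proof.
move=> cf; rewrite Rintegral_itv_bndo_bndc; last exact: continuous_integrable_open.
rewrite Rintegral_itv_obnd_cbnd //.
apply: integrableS (continuous_integrable_segment a b cf) => //.
exact: subset_itv_oc_cc.
Qed.

(** The end points are negligible, so pointwise convergence is asked for on the
open interval only. *)
Lemma bounded_convergence_segment (F : nat -> R -> R) (G : R -> R) (a b M : R) :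
  (forall n (x : R), {for x, continuous (F n)}) -> (forall x : R, {for x, continuous G}) ->
  (forall n x, `|F n x| <= M) ->
  (forall x, a < x < b -> F n x @[n --> \oo] --> G x) ->
  \int[mu]_(x in `[a, b]) F n x @[n --> \oo] --> \int[mu]_(x in `[a, b]) G x.
Proof.
move=> cF cG HM H.
have mD : measurable (`]a, b[%classic : set R) by [].
have iF n := continuous_integrable_open a b (cF n).
have iG := continuous_integrable_open a b cG.
have iM : mu.-integrable `]a, b[ (EFin \o (fun=> M)).
  by apply: continuous_integrable_open => x; exact: cst_continuous.
have Hcv : {ae mu, forall x, `]a, b[%classic x -> (EFin \o F n) x @[n --> \oo] --> (EFin \o G) x}.
  apply: aeW => x /= hx; apply/fine_cvgP; split; first by apply: nearW.
  by apply: H; move: hx; rewrite in_itv.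
have Hdom : {ae mu, forall x n, `]a, b[%classic x -> (`|(EFin \o F n) x| <= (EFin \o (fun=> M)) x)%E}.
  by apply: aeW => x n' _ /=; rewrite lee_fin.
have [_ _] := @dominated_convergence _ _ R mu _ mD (fun n => EFin \o F n) _ _
  (fun n => measurable_int mu (iF n)) (measurable_int mu iG) Hcv iM Hdom.
have E (f : R -> R) : (forall x : R, {for x, continuous f}) ->
    (\int[mu]_(x in `]a, b[) (EFin \o f) x)%E = (\int[mu]_(x in `[a, b]) f x)%:E.
  move=> cf; rewrite -(Rintegral_open_segment a b cf) /Rintegral fineK //.
  exact: integrable_fin_num (continuous_integrable_open a b cf).
rewrite (E G cG); under eq_fun do rewrite (E _ (cF _)).
by move=> /fine_cvgP[_].
Qed.

(** For a primitive [F] the difference [F (x + T) - F x] does not depend on [x]. *)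
Lemma Rintegral_periodic (f : R -> R) (T a b : R) (N : nat) : 0 < T ->
  (forall x : R, {for x, continuous f}) -> (forall x, f (x + T) = f x) -> a <= b -> (0 < N)%N ->
  \int[mu]_(x in `[a, a + N%:R * T]) f x = N%:R * \int[mu]_(x in `[b, b + T]) f x.
Proof.
move=> T0 cf per ab N0.
have [F dF] := continuous_primitive a cf.
have NT : 0 < N%:R * T by rewrite mulr_gt0 // ltr0n.
have FI x y : a <= x -> x < y -> \int[mu]_(t in `[x, y]) f t = F y - F x.
  move=> ax xy; apply: Rintegral_primitive => // t /andP[xt _].
  by apply: dF; exact: le_trans xt.
have shift x : a <= x -> F (x + T) - F x = F (a + T) - F a.
  move=> ax; apply: (@zero_der_const R (fun y => F (y + T) - F y) a x ax) => y /andP[ay _].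
  rewrite -(subrr (f y)); apply: is_deriveB (dF y ay).
  have h : is_derive (T + 1 * y) 1 F (f y).
    rewrite mul1r addrC -per; apply: dF; apply: le_trans ay _; rewrite lerDl ltW //.
  have := @is_derive_compR R F (fun t => T + 1 * t) y (f y) 1 h (is_derive_affineR T 1 y).
  rewrite mulr1 (_ : (fun x0 => F (T + 1 * x0)) = (fun x0 => F (x0 + T))) //.
  by apply/funext => x0; rewrite mul1r addrC.
rewrite FI // ?ltrDl // FI // ?ltrDl // shift //.
elim: (N) => [|M ih]; first by rewrite !mul0r addr0 subrr.
rewrite -natr1 !mulrDl !mul1r -ih addrA.
have := shift (a + M%:R * T) _; rewrite lerDl mulr_ge0 ?(ltW T0) // => /(_ isT) <-.
by ring.
Qed.

End IntegralsOverIntervals.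


(** * The norm on circles *)

Section NormOnCircles.
Variable R : realType.
Local Notation C := (Cplx R).

Lemma eucl_normE n (f : 'I_n.+1 -> C -> C) z :
  eucl_norm f z = Num.sqrt (\sum_j cmod (f j z) ^+ 2).
Proof. by rewrite /eucl_norm; congr Num.sqrt; apply: eq_bigr => j _; rewrite cmod_sqr. Qed.

Lemma eucl_norm_ge0 n (f : 'I_n.+1 -> C -> C) z : 0 <= eucl_norm f z.
Proof. exact: sqrtr_ge0. Qed.

Lemma le_eucl_norm n (f : 'I_n.+1 -> C -> C) j z : cmod (f j z) <= eucl_norm f z.
Proof.
rewrite eucl_normE; apply: le_sqrt (cmod_ge0 _) _.
rewrite (bigD1 j) //= lerDl; apply: sumr_ge0 => i _; exact: sqr_ge0.
Qed.

Lemma eucl_norm_le n (f : 'I_n.+1 -> C -> C) z : eucl_norm f z <= \sum_j cmod (f j z).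
Proof.
rewrite eucl_normE -(ler_pXn2r (_ : 0 < 2)%N) ?nnegrE ?sqrtr_ge0 //; last first.
  by apply: sumr_ge0 => i _; exact: cmod_ge0.
rewrite sqr_sqrtr; last by apply: sumr_ge0 => i _; exact: sqr_ge0.
rewrite [leRHS]expr2 mulr_suml; apply: ler_sum => j _.
rewrite expr2 ler_wpM2l ?cmod_ge0 // (bigD1 j) //= lerDl.
by apply: sumr_ge0 => i _; exact: cmod_ge0.
Qed.

Lemma rder_polar (r t : R) : rder (polar r) t (ci R * polar r t).
Proof.
split; rewrite /polar /=.
  apply: is_derive_eq (is_deriveRM (is_derive_cst r t 1) (is_derive_cos t)) _.
  by rewrite /cst; ring.
apply: is_derive_eq (is_deriveRM (is_derive_cst r t 1) (is_derive_sin t)) _.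
by rewrite /cst; ring.
Qed.

Lemma continuous_ln_norm n (f : 'I_n.+1 -> C -> C) (r : R) : (forall j, entire (f j)) ->
  (forall t, 0 < eucl_norm f (polar r t)) ->
  forall t : R, {for t, continuous (fun t => ln (eucl_norm f (polar r t)))}.
Proof.
move=> ef pos t.
have dG : is_derive t 1 (fun t => \sum_j cmod (f j (polar r t)) ^+ 2)
   (\sum_j 2 * (Re (f j (polar r t)) * Re (ci R * polar r t * derive1 (f j) (polar r t)) +
     Im (f j (polar r t)) * Im (ci R * polar r t * derive1 (f j) (polar r t)))).
  apply: is_derive_sumR => j _; apply: is_derive_cmod2; apply: rder_chain (rder_polar r t).
  by rewrite derive1E; apply: DeriveDef => //; exact: ef.
have cG : {for t, continuous (fun t => \sum_j cmod (f j (polar r t)) ^+ 2)}.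
  by case: dG => /derivable1_diffP/differentiable_continuous.
have -> : (fun t => ln (eucl_norm f (polar r t))) =
    (fun t => ln (Num.sqrt (\sum_j cmod (f j (polar r t)) ^+ 2))).
  by apply/funext => x; rewrite eucl_normE.
have p : 0 < Num.sqrt (\sum_j cmod (f j (polar r t)) ^+ 2) by rewrite -eucl_normE.
apply: (@continuous_comp _ _ _ (fun t => Num.sqrt (\sum_j cmod (f j (polar r t)) ^+ 2)) (@ln R)).
  apply: (@continuous_comp _ _ _ (fun t => \sum_j cmod (f j (polar r t)) ^+ 2) Num.sqrt) => //.
  exact: sqrt_continuous.
exact: continuous_ln.
Qed.

End NormOnCircles.

(** * Growth of solutions along rays *)

Section Growth.
Variable R : realType.
Local Notation C := (Cplx R).

Lemma gronwall_ex (f A dA : R -> R) (a b : R) : a <= b ->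
  (forall x, a <= x <= b -> is_derive x 1 A (dA x)) ->
  (forall x, a <= x <= b -> exists2 d, is_derive x 1 f d & d <= dA x * f x) ->
  f b <= f a * expR (A b - A a).
Proof.
move=> ab HA H; apply: (@le_exp_gronwall R f (fun x => 'D_1 f x) A dA) => // x hx.
  by have [d dd _] := H x hx; apply: DeriveDef => //; case: dd.
by have [d [_ ->]] := H x hx.
Qed.

Variables (n q k : nat).
Hypothesis hq : (2 <= q <= n.+1)%N.

Let m := (n.+1 - q)%N.
Let beta : R := k%:R / q%:R.
Let rho : R := 1 + beta.

Let q0 : (0 < q)%N. Proof. by case/andP: hq => h _; rewrite (leq_trans _ h). Qed.
Let mq : (m + q)%N = n.+1. Proof. by rewrite subnK //; case/andP: hq. Qed.
Let mn : (m < n)%N. Proof. by rewrite /m; case/andP: hq; lia. Qed.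
Let beta0 : 0 <= beta. Proof. by rewrite divr_ge0. Qed.
Let rho1 : 1 <= rho. Proof. by rewrite lerDl. Qed.
Let rho0 : 0 < rho. Proof. exact: lt_le_trans rho1. Qed.
Let qR : (q%:R : R) != 0. Proof. by rewrite pnatr_eq0 -lt0n. Qed.

Definition ray_weight (i : nat) (th s : R) : C :=
  rc (s `^ (- (i%:R * beta))) * cis (- (i%:R * beta * th)).

(** Jet of a solution along the ray of argument [th], rescaled so that the
leading part of the system it satisfies has constant coefficients in the
variable [s `^ rho / rho]. *)
Definition ray_jet (u : C -> C) (th : R) (i : nat) (s : R) : C :=
  ray_weight i th s * derive1n i u (rc s * cis th).

Let mu th : C := cis (rho * th).

Lemma cmod_ray_weight i th s : 0 < s -> cmod (ray_weight i th s) = s `^ (- (i%:R * beta)).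
Proof. by move=> s0; rewrite cmodM cmod_cis mulr1 cmod_rc ger0_norm ?powR_ge0. Qed.

Lemma rder_ray_jet u th i s : entire u -> 0 < s ->
  rder (ray_jet u th i) s (mu th * rc (s `^ beta) * ray_jet u th i.+1 s -
    rc (beta / s) * (i%:R * ray_jet u th i s)).
Proof.
move=> eu s0; have sn0 : s != 0 by rewrite gt_eqF.
pose a : R := - (i%:R * beta).
have d1 := rderM (rder_rc (is_derive1_powR a s0)) (rder_cst (cis (- (i%:R * beta * th))) s).
have := rderM d1 (rder_derive1n i (cis th) s eu).
rewrite (_ : _ + _ = mu th * rc (s `^ beta) * ray_jet u th i.+1 s -
    rc (beta / s) * (i%:R * ray_jet u th i s)) //.
have E1 : s `^ (a - 1) = s `^ a / s by rewrite powRB ?powRr1 ?(ltW s0) // sn0 implybT.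
have E2 : s `^ a = s `^ beta * s `^ (- (i.+1%:R * beta)).
  by rewrite -powRD ?sn0 ?implybT //; congr (_ `^ _); rewrite /a -natr1; ring.
have E3 : cis (- (i%:R * beta * th)) * cis th = mu th * cis (- (i.+1%:R * beta * th)).
  by rewrite /mu -!cisD; congr cis; rewrite /rho -natr1; ring.
rewrite mulr0 addr0 E1 /ray_jet /ray_weight -/a {1}/a.
rewrite [X in _ + X](_ : _ = mu th * rc (s `^ beta) *
  (rc (s `^ (- (i.+1%:R * beta))) * cis (- (i.+1%:R * beta * th)) *
   derive1n i.+1 u (rc s * cis th))); last first.
  rewrite [LHS](_ : _ = rc (s `^ a) * (cis (- (i%:R * beta * th)) * cis th) *
    derive1n i.+1 u (rc s * cis th)); last by ring.
  by rewrite E2 E3 rcM; ring.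
rewrite addrC; congr (_ + _).
have -> : rc (- (i%:R * beta) * (s `^ a / s)) = - (i%:R * (rc (beta / s) * rc (s `^ a))) :> C.
  by rewrite -rcMn -!rcM -rcN; congr rc; ring.
by ring.
Qed.

(** This is the differential equation: the weights absorb the factor [z ^+ k]
because [k = q * beta]. *)
Lemma ray_jet_cyclic u th s : solution n m k u -> 0 < s ->
  ray_jet u th (m + q) s = ray_jet u th m s.
Proof.
move=> [_ Hu] s0; have sn0 : s != 0 by rewrite gt_eqF.
rewrite /ray_jet /ray_weight mq Hu exprMn cisX -rcX -powR_mulrn ?(ltW s0) //.
have kq : k%:R = q%:R * beta :> R by rewrite mulrC divfK.
have E1 : s `^ (- (n.+1%:R * beta)) * s `^ k%:R = s `^ (- (m%:R * beta)).
  rewrite -powRD ?sn0 ?implybT //; congr (_ `^ _).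
  by rewrite kq -mq natrD; ring.
have E2 : cis (- (n.+1%:R * beta * th)) * cis (k%:R * th) = cis (- (m%:R * beta * th)).
  by rewrite -cisD kq -mq natrD; congr cis; ring.
by rewrite -E1 -E2 rcM; ring.
Qed.

Lemma derive_ray_jet u th i s : 0 < s ->
  cmod (derive1n i u (rc s * cis th)) = s `^ (i%:R * beta) * cmod (ray_jet u th i s).
Proof.
move=> s0; have sn0 : s != 0 by rewrite gt_eqF.
rewrite cmodM cmod_ray_weight // mulrA -powRD ?sn0 ?implybT //.
by rewrite subrr powRr0 mul1r.
Qed.

Lemma ray_jet0 u th s : 0 < s -> cmod (u (rc s * cis th)) = cmod (ray_jet u th 0 s).
Proof. by move=> s0; have := derive_ray_jet u th 0 s0; rewrite mul0r powRr0 mul1r. Qed.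

Lemma is_derive_phase (g s : R) : 0 < s ->
  is_derive s 1 (fun s => 2 * g / rho * s `^ rho) (2 * s `^ beta * g).
Proof.
move=> s0; have := is_derive_compR (is_derive_linR (2 * g / rho) _) (is_derive1_powR rho s0).
rewrite (_ : rho - 1 = beta); last by rewrite /rho; ring.
rewrite (_ : 2 * g / rho * _ = 2 * s `^ beta * g) //.
by field; rewrite gt_eqF.
Qed.

Lemma powR_ge1 (s a : R) : 1 <= s -> 0 <= a -> 1 <= s `^ a.
Proof. by move=> s1 a0; rewrite -(powRr0 s) ler_powR. Qed.

Section Rays.
Variables (eps : R).
Hypotheses (eps0 : 0 < eps) (eps1 : eps <= 1).

Let D : R := drift_const q m eps beta.
Let D0 : 0 <= D. Proof. exact: drift_const_ge0. Qed.

Definition total_drift : R := 2 * D + 2 * (q + m)%:R * D.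

Let K0 : 0 <= total_drift.
Proof. by apply: addr_ge0; apply: mulr_ge0 => //; apply: mulr_ge0. Qed.

Definition ray_total (u : C -> C) (th s : R) : R :=
  dominant q m (fun i => ray_jet u th i s) + recessive q m eps (fun i => ray_jet u th i s).

Lemma ray_total_ge0 u th s : 0 <= ray_total u th s.
Proof. by rewrite addr_ge0 ?dominant_ge0 ?recessive_ge0. Qed.

Let mu1 th : cmod (mu th) <= 1. Proof. by rewrite cmod_cis. Qed.

(** From [s1] on the drift, of order [1 / s], is at most the gap between the rates
[g0] and [g]. *)
Lemma ray_total_growth u (th g0 g s1 s : R) : solution n m k u ->
  (forall j, (0 < j < q)%N -> Re (mu th * zeta R q j 1) <= g0) -> Re (mu th) <= g0 ->
  eps <= g0 -> 1 <= s1 -> total_drift / s1 <= 2 * (g - g0) -> g0 <= g -> s1 <= s ->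
  ray_total u th s <=
    ray_total u th s1 * expR (2 * g / rho * s `^ rho - 2 * g / rho * s1 `^ rho).
Proof.
move=> su Hj Hm eg s11 hd g0g s1s.
apply: (@gronwall_ex (ray_total u th) (fun s => 2 * g / rho * s `^ rho)
  (fun s => 2 * s `^ beta * g) s1 s s1s) => x /andP[x1 xs].
  by apply: is_derive_phase; apply: lt_le_trans x1; apply: lt_le_trans s11.
have x1' : 1 <= x := le_trans s11 x1.
have x0 : 0 < x by apply: lt_le_trans x1'.
have b0 : 0 <= x `^ beta := powR_ge0 _ _.
have cyc := ray_jet_cyclic th su x0.
have dY i := rder_ray_jet th i (proj1 su) x0.
have [dP d1 h1] := is_derive_dominant q0 eps0 eps1 beta0 x0 cyc dY.
have [dR d2 h2] := is_derive_recessive q0 eps0 eps1 b0 beta0 x0 (mu1 th) cyc dY Hj eg.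
exists (dP + dR); first exact: is_deriveD d1 d2.
move: h1 h2; rewrite -/(ray_total u th x) -/D.
set P := dominant _ _ _; set Rr := recessive _ _ _ _; set b := x `^ beta => h1 h2.
have P0 : 0 <= P by exact: dominant_ge0.
have R0 : 0 <= Rr by exact: recessive_ge0.
have PR0 : 0 <= P + Rr := addr_ge0 P0 R0.
have NE : ray_total u th x = P + Rr by [].
rewrite NE in h1 h2 *.
have b1 : 1 <= b by exact: powR_ge1.
have hP : dP <= 2 * b * g0 * P + 2 * D / x * (P + Rr).
  move: h1; rewrite ler_norml => /andP[_ h1].
  have : 2 * b * Re (mu th) * P <= 2 * b * g0 * P.
    by rewrite ler_wpM2r // ler_wpM2l // mulr_ge0.
  lra.
have hK : total_drift / x * (P + Rr) <= 2 * b * (g - g0) * (P + Rr).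
  rewrite ler_wpM2r //.
  apply: (@le_trans _ _ (2 * (g - g0))).
    apply: le_trans hd; rewrite ler_wpM2l // lef_pV2 ?posrE //.
    exact: lt_le_trans s11.
  rewrite -mulrA ler_wpM2l //; rewrite ler_peMl ?subr_ge0 //.
apply: le_trans (lerD hP h2) _.
have -> : 2 * b * g0 * P + 2 * D / x * (P + Rr) + (2 * b * g0 * Rr +
    2 * (q + m)%:R * D / x * (P + Rr)) = 2 * b * g0 * (P + Rr) + total_drift / x * (P + Rr).
  by rewrite /total_drift; ring.
apply: le_trans (lerD (lexx _) hK) _.
by rewrite le_eqVlt; apply/orP; left; apply/eqP; ring.
Qed.

(** Positive when the recessive components are dominated. *)
Definition ray_cone (eta : R) (u : C -> C) (th s : R) : R :=
  eta * dominant q m (fun i => ray_jet u th i s) - recessive q m eps (fun i => ray_jet u th i s).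

(** The rate of the dominant component exceeds [g], those of the recessive
components stay below [g], and the drift fits into both gaps. In particular
the positivity of [ray_cone] is preserved. *)
Lemma ray_cone_growth u (th g0 g eta s1 s : R) : solution n m k u ->
  (forall j, (0 < j < q)%N -> Re (mu th * zeta R q j 1) <= g0) ->
  eps <= g0 -> 0 < eta <= 1 -> 1 <= s1 ->
  total_drift / s1 <= 2 * (g - g0) -> total_drift / s1 <= 2 * (Re (mu th) - g) * eta ->
  g0 <= g <= Re (mu th) -> s1 <= s ->
  ray_cone eta u th s1 * expR (2 * g / rho * s `^ rho - 2 * g / rho * s1 `^ rho) <=
    ray_cone eta u th s.
Proof.
move=> su Hj eg /andP[eta0 eta1] s11 hd1 hd2 /andP[g0g gc] s1s; set cone := ray_cone eta u th.
rewrite -lerN2 -mulNr.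
apply: (@gronwall_ex (fun s => - cone s) (fun s => 2 * g / rho * s `^ rho)
  (fun s => 2 * s `^ beta * g) s1 s s1s) => x /andP[x1 xs].
  by apply: is_derive_phase; apply: lt_le_trans x1; apply: lt_le_trans s11.
have x1' : 1 <= x := le_trans s11 x1.
have x0 : 0 < x by apply: lt_le_trans x1'.
have b0 : 0 <= x `^ beta := powR_ge0 _ _.
have cyc := ray_jet_cyclic th su x0.
have dY i := rder_ray_jet th i (proj1 su) x0.
have [dP d1 h1] := is_derive_dominant q0 eps0 eps1 beta0 x0 cyc dY.
have [dR d2 h2] := is_derive_recessive q0 eps0 eps1 b0 beta0 x0 (mu1 th) cyc dY Hj eg.
exists (- (eta * dP - dR)).
  by apply: is_deriveN; apply: is_deriveB d2; exact: is_deriveZ d1.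
move: h1 h2; rewrite -/D /cone /ray_cone.
set P := dominant _ _ _; set Rr := recessive _ _ _ _; set b := x `^ beta => h1 h2.
have P0 : 0 <= P by exact: dominant_ge0.
have R0 : 0 <= Rr by exact: recessive_ge0.
have PR0 : 0 <= P + Rr := addr_ge0 P0 R0.
have b1 : 1 <= b by exact: powR_ge1.
have xV : x^-1 <= s1^-1 by rewrite lef_pV2 ?posrE //; exact: lt_le_trans s11.
have k1 : total_drift / x <= 2 * b * (g - g0).
  apply: (@le_trans _ _ (2 * (g - g0))); first by apply: le_trans hd1; rewrite ler_wpM2l.
  by rewrite -mulrA ler_wpM2l // ler_peMl ?subr_ge0.
have k2 : total_drift / x <= 2 * b * (Re (mu th) - g) * eta.
  apply: (@le_trans _ _ (2 * (Re (mu th) - g) * eta)).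
    by apply: le_trans hd2; rewrite ler_wpM2l.
  rewrite ler_wpM2r ?(ltW eta0) // -mulrA ler_wpM2l // ler_peMl ?subr_ge0 //.
have hP : eta * (2 * b * Re (mu th) * P) - 2 * D / x * (P + Rr) <= eta * dP.
  move: h1; rewrite ler_norml => /andP[h1 _].
  have t0 : 0 <= 2 * D / x * (P + Rr).
    by apply: mulr_ge0; [apply: mulr_ge0; [apply: mulr_ge0|rewrite invr_ge0 ltW]|].
  have h1' : 2 * b * Re (mu th) * P - 2 * D / x * (P + Rr) <= dP by lra.
  apply: le_trans (ler_wpM2l (ltW eta0) h1').
  rewrite mulrBr lerD2l lerN2 ler_piMl //.
have m1 : total_drift / x * P <= 2 * b * (Re (mu th) - g) * eta * P by rewrite ler_wpM2r.
have m2 : total_drift / x * Rr <= 2 * b * (g - g0) * Rr by rewrite ler_wpM2r.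
have E : total_drift / x * (P + Rr) = 2 * D / x * (P + Rr) + 2 * (q + m)%:R * D / x * (P + Rr).
  by rewrite /total_drift; ring.
have E2 : total_drift / x * (P + Rr) = total_drift / x * P + total_drift / x * Rr by ring.
have F : 2 * b * (Re (mu th) - g) * eta * P = eta * (2 * b * Re (mu th) * P) - 2 * b * g * (eta * P) by ring.
have G : 2 * b * (g - g0) * Rr = 2 * b * g * Rr - 2 * b * g0 * Rr by ring.
have T : 2 * b * g * - (eta * P - Rr) = - (2 * b * g * (eta * P)) + 2 * b * g * Rr by ring.
rewrite T; lra.
Qed.

End Rays.

Lemma growth_start (K d : R) : 0 <= K -> 0 < d -> exists2 s1 : R, 1 <= s1 & K / s1 <= d.
Proof.
move=> K0 d0; exists (1 + K / d); first by rewrite lerDl divr_ge0 // ltW.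
have p : 0 < 1 + K / d by rewrite ltr_pwDl // divr_ge0 // ltW.
by rewrite ler_pdivrMr // mulrDr mulr1 mulrCA divff ?mulr1 ?gt_eqF // lerDr ltW.
Qed.

Lemma sqrt_expR2 (x : R) : Num.sqrt (expR (2 * x)) = expR x.
Proof. by rewrite mulr_natl mulr2n expRD -expr2 sqrtr_sqr ger0_norm ?expR_ge0. Qed.

Lemma le_powR_rho (s : R) : 1 <= s -> s <= s `^ rho.
Proof.
by move=> s1; rewrite -[X in X <= _](powRr1 (le_trans ler01 s1)) ler_powR.
Qed.

Lemma powR_le_expR (s a : R) : 1 <= s -> 0 <= a -> s `^ a <= expR (a * s `^ rho).
Proof.
move=> s1 a0; have s0 : 0 < s by exact: lt_le_trans s1.
rewrite -[X in X <= _]lnK ?posrE ?powR_gt0 // ln_powR ler_expR ler_wpM2l //.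
apply: le_trans (le_powR_rho s1); exact: ltW (ln_sublinear s0).
Qed.

Lemma total_drift_ge0 eps : 0 < eps -> 0 <= total_drift eps.
Proof.
move=> eps0; have D0 := @drift_const_ge0 R q m eps eps0 beta beta0.
by apply: addr_ge0; apply: mulr_ge0 => //; apply: mulr_ge0.
Qed.

Lemma Re_mu_zeta_le1 th j : Re (mu th * zeta R q j 1) <= 1.
Proof.
apply: le_trans (ler_norm _) _; apply: le_trans (Re_le_cmod _) _.
by rewrite cmodM cmod_zeta cmod_cis mulr1.
Qed.

(** With [eps] and [g0] equal to 1 the hypotheses on the rates hold in every
direction, whence constants independent of [th]. *)
Lemma jet_bound u : solution n m k u -> exists s1, exists2 M, 1 <= s1 /\ 0 <= M &
  forall th s i, s1 <= s -> (i <= n)%N ->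
    cmod (derive1n i u (rc s * cis th)) <= expR (M * s `^ rho).
Proof.
move=> su; have e0 : (0 : R) < 1 by [].
have [s1 s11 hs1] := growth_start (total_drift_ge0 e0) (ltr0n _ 2).
have s10 : 0 < s1 by exact: lt_le_trans s11.
pose E1 := energy n u 0 0 * expR (2 * (1 + s1 ^+ k) * s1).
have E10 : 0 <= E1 by rewrite mulr_ge0 ?expR_ge0 // energy_ge0.
have hE th : energy n u (cis th) s1 <= E1.
  have := energy_growth (ltnW mn) su (_ : cmod (cis th) <= 1) (ltW s10).
  rewrite cmod_cis lexx => /(_ isT) h; apply: le_trans h _.
  by rewrite /E1 /energy; under eq_bigr do rewrite rc0 mul0r; under [in leRHS]eq_bigr do rewrite mulr0.
pose T1 := (q%:R + m%:R * (1 + q%:R) ^+ 2) * Num.sqrt E1 ^+ 2.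
have T10 : 0 <= T1 by rewrite /T1; apply: mulr_ge0; [nneg|exact: sqr_ge0].
have hT th : ray_total 1 u th s1 <= T1.
  apply: components_le; rewrite ?sqrtr_ge0 // => i; rewrite mq ltnS => iN.
  rewrite cmodM cmod_ray_weight //.
  apply: le_trans (_ : 1 * cmod (derive1n i u (rc s1 * cis th)) <= _).
    rewrite ler_wpM2r ?cmod_ge0 // -[leRHS](powRr0 s1) ler_powR // oppr_le0 mulr_ge0 //.
  rewrite mul1r; apply: le_sqrt (cmod_ge0 _) _.
  exact: le_trans (le_energy u (cis th) s1 iN) (hE th).
pose cc := comp_const q m (1 : R).
have cc0 : 0 <= cc by exact: comp_const_ge0.
exists s1; exists (n%:R * beta + cc * (1 + T1) + 2 * 2 / rho).
  split=> //; apply: addr_ge0; last by rewrite divr_ge0 // ltW.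
  by apply: addr_ge0; apply: mulr_ge0 => //; rewrite addr_ge0.
move=> th s i s1s iN; have s1' : 1 <= s := le_trans s11 s1s.
have s0 : 0 < s by exact: lt_le_trans s1'.
have r1 : 1 <= s `^ rho by apply: powR_ge1 => //; exact: ltW.
rewrite derive_ray_jet // 2!(mulrDl _ _ (s `^ rho)) !expRD -mulrA; apply: ler_pM; rewrite ?powR_ge0 ?cmod_ge0 //.
  apply: le_trans (powR_le_expR s1' (mulr_ge0 (ler0n _ i) beta0)) _.
  by rewrite ler_expR ler_wpM2r ?powR_ge0 // ler_wpM2r // ler_nat.
have tot := ray_total_growth ltr01 (lexx 1) su (fun j _ => Re_mu_zeta_le1 th j) _ (lexx 1) s11 _ _ s1s.
have {}tot : ray_total 1 u th s <= T1 * expR (2 * 2 / rho * s `^ rho).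
  apply: le_trans (tot 2 _ _ _) _.
  - by have := Re_mu_zeta_le1 th 0; rewrite /zeta !mul0r cis0 mulr1.
  - by apply: le_trans hs1 _; lra.
  - by lra.
  apply: ler_pM; rewrite ?expR_ge0 ?hT //; first exact: ray_total_ge0.
  by rewrite ler_expR gerBl mulr_ge0 ?powR_ge0 // divr_ge0 // ltW.
have iN' : (i < m + q)%N by rewrite mq.
apply: le_trans (@le_comp R q m q0 1 ltr01 (lexx 1) (fun i => ray_jet u th i s) i iN') _.
rewrite -/(ray_total 1 u th s) -/cc.
have sq (x : R) : 0 <= x -> Num.sqrt x <= 1 + x.
  move=> x0; rewrite -(ler_pXn2r (_ : 0 < 2)%N) ?nnegrE ?sqrtr_ge0 ?addr_ge0 //.
  rewrite sqr_sqrtr //; nra.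
have X1 : 1 <= expR (2 * 2 / rho * s `^ rho).
  by rewrite -expR0 ler_expR mulr_ge0 ?powR_ge0 // divr_ge0 // ltW.
apply: (@le_trans _ _ (cc * ((1 + T1) * expR (2 * 2 / rho * s `^ rho)))).
  rewrite ler_wpM2l //; apply: le_trans (sq _ (ray_total_ge0 _ _ _ _)) _.
  by rewrite mulrDl mul1r lerD.
rewrite mulrA ler_wpM2r ?expR_ge0 //.
apply: le_trans (_ : expR (cc * (1 + T1)) <= _).
  by apply: le_trans (expR_ge1Dx _); rewrite lerDr.
by rewrite ler_expR ler_peMr // mulr_ge0 // addr_ge0.
Qed.

(** All components grow at most at the rate [c], and the margin [g - c] absorbs the
drift. *)
Lemma ray_upper u th (c g : R) : solution n m k u ->
  (forall j, (0 < j < q)%N -> Re (mu th * zeta R q j 1) <= c) -> Re (mu th) <= c ->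
  0 < c < g ->
  exists s1, exists2 M, 1 <= s1 /\ 0 <= M &
    forall s, s1 <= s -> cmod (u (rc s * cis th)) <= M * expR (g / rho * s `^ rho).
Proof.
move=> su Hj Hm /andP[c0 cg].
pose eps := Num.min 1 c.
have e0 : 0 < eps by rewrite lt_min ltr01.
have e1 : eps <= 1 by rewrite ge_min lexx.
have ec : eps <= c by rewrite ge_min lexx orbT.
have d0 : 0 < 2 * (g - c) by rewrite mulr_gt0 // subr_gt0.
have [s1 s11 hs1] := growth_start (total_drift_ge0 e0) d0.
exists s1; exists (comp_const q m eps * Num.sqrt (ray_total eps u th s1)).
  by split=> //; rewrite mulr_ge0 ?sqrtr_ge0 // comp_const_ge0.
move=> s s1s; have s0 : 0 < s by apply: lt_le_trans s1s; apply: lt_le_trans s11.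
have tot := ray_total_growth e0 e1 su Hj Hm ec s11 hs1 (ltW cg) s1s.
rewrite ray_jet0 //; have N0 : (0 < m + q)%N by rewrite mq.
apply: le_trans (@le_comp R q m q0 eps e0 e1 (fun i => ray_jet u th i s) 0 N0) _.
rewrite -(mulrA (comp_const q m eps)); apply: ler_wpM2l; first exact: comp_const_ge0.
rewrite -/(ray_total eps u th s).
apply: le_trans (ler_wsqrtr tot) _.
rewrite sqrtrM ?ray_total_ge0 // ler_wpM2l ?sqrtr_ge0 // -[expR (g / rho * _)]sqrt_expR2 ler_wsqrtr // ler_expR.
apply: (@le_trans _ _ (2 * g / rho * s `^ rho)).
  by rewrite gerBl mulr_ge0 ?powR_ge0 // divr_ge0 ?(ltW rho0) // mulr_ge0 // ltW // (lt_trans c0).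
by rewrite le_eqVlt; apply/orP; left; apply/eqP; ring.
Qed.

Variable f : 'I_n.+1 -> C -> C.
Hypothesis Hf : fundamental_solutions m k f.

Lemma fundamental_solution j : solution n m k (f j).
Proof. by case: Hf => ef Hf1 _; split; [exact: ef|exact: Hf1]. Qed.

Lemma fundamental_wronskian z : wronskian f z = 1.
Proof.
rewrite (wronskian_const mn fundamental_solution) /wronskian.
case: Hf => _ _ Hf2; rewrite (_ : \matrix_(i, j) _ = 1%:M) ?det1 //.
by apply/matrixP => i j; rewrite !mxE Hf2.
Qed.

(** Since the Wronskian never vanishes, a solution may have any prescribed jet
at any point. *)
Lemma prescribed_jet (z : C) (t : nat -> C) :
  exists a : 'I_n.+1 -> C, forall i : 'I_n.+1, \sum_j a j * derive1n i (f j) z = t i.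
Proof.
pose M : 'M[C]_n.+1 := \matrix_(i, j) derive1n i (f j) z.
have MU : M \in unitmx by rewrite unitmxE -[\det M]/(wronskian f z) fundamental_wronskian unitr1.
pose v : 'cV[C]_n.+1 := invmx M *m \col_i t i.
exists (fun j => v j 0) => i.
have : (M *m v) i 0 = t i by rewrite mulmxA mulmxV // mul1mx mxE.
by rewrite mxE => <-; apply: eq_bigr => j _; rewrite [M i j]mxE mulrC.
Qed.

(** The solution whose jet at [s1] is purely dominant stays in the cone, hence
grows at the rate [g]; being a combination of the [f j], it is bounded by a
multiple of their norm. *)
Lemma ray_lower th (g0 g : R) :
  (forall j, (0 < j < q)%N -> Re (mu th * zeta R q j 1) <= g0) -> 0 < g0 ->
  g0 < g < Re (mu th) ->
  exists s1, exists2 c0, 1 <= s1 /\ 0 < c0 &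
    forall s, s1 <= s -> c0 * expR (g / rho * s `^ rho) <= eucl_norm f (rc s * cis th).
Proof.
move=> Hj g00 /andP[g0g gc].
pose eps := Num.min 1 g0.
have e0 : 0 < eps by rewrite lt_min ltr01.
have e1 : eps <= 1 by rewrite ge_min lexx.
have eg : eps <= g0 by rewrite ge_min lexx orbT.
pose cc := comp_const q m eps.
have cc1 : 1 <= cc.
  rewrite /cc /comp_const; apply: (@le_trans _ _ (0 + q%:R)); first by rewrite add0r ler1n.
  by rewrite lerD2r exprn_ge0 // invr_ge0 ltW.
have cc0 : 0 < cc by exact: lt_le_trans cc1.
(* with this aperture, the recessive part of the value at a point of the cone is
   at most half of the dominant part *)
pose eta : R := ((2 * cc) ^-1) ^+ 2.
have eta0 : 0 < eta by rewrite exprn_gt0 // invr_gt0 mulr_gt0.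
have eta1 : eta <= 1.
  apply: exprn_ile1; first by rewrite invr_ge0 mulr_ge0 // ltW.
  by rewrite invf_le1 ?mulr_gt0 //; apply: le_trans cc1 _; rewrite ler_peMl ?ler1n // ltW.
pose d := Num.min (2 * (g - g0)) (2 * (Re (mu th) - g) * eta).
have d0 : 0 < d.
  rewrite lt_min; apply/andP; split; first by rewrite mulr_gt0 // subr_gt0.
  by rewrite mulr_gt0 // mulr_gt0 // subr_gt0.
have [s1 s11 hs1] := growth_start (total_drift_ge0 e0) d0.
have s10 : 0 < s1 by exact: lt_le_trans s11.
have hd1 : total_drift eps / s1 <= 2 * (g - g0) by apply: le_trans hs1 _; rewrite ge_min lexx.
have hd2 : total_drift eps / s1 <= 2 * (Re (mu th) - g) * eta.
  by apply: le_trans hs1 _; rewrite ge_min lexx orbT.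
have [a Ha] := prescribed_jet (rc s1 * cis th) (fun i => (ray_weight i th s1)^-1).
pose u z := \sum_j a j * f j z.
have su : solution n m k u by apply: solution_lincomb => j; exact: fundamental_solution.
have jet1 i : (i < m + q)%N -> ray_jet u th i s1 = 1.
  rewrite mq => iN; rewrite /ray_jet /u derive1n_lincomb; last first.
    by move=> j; have [] := fundamental_solution j.
  rewrite (Ha (Ordinal iN)) /= divff //.
  by rewrite -cmod_gt0 cmod_ray_weight // powR_gt0.
have zc j : zcoef q m (fun i => ray_jet u th i s1) j = zcoef q m (fun=> 1) j.
  rewrite /zcoef; congr (_ * _); apply: eq_bigr => i _.
  by rewrite jet1 // ltn_add2l.
have dom1 : dominant q m (fun i => ray_jet u th i s1) = 1.
  by rewrite /dominant zc zcoef_one // cmod1 expr1n.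
have rec0 : recessive q m eps (fun i => ray_jet u th i s1) = 0.
  rewrite /recessive !big1 ?addr0 //.
    move=> i _; rewrite /hatx /xcoef jet1; last by rewrite (leq_trans (ltn_ord i)) // leq_addr.
    rewrite (bigD1 (Ordinal q0)) //= zc zcoef_one //= mulr1 big1 => [|j j0].
      by rewrite addr0 /zeta !mul0r cis0 subrr mulr0 cmod0 expr0n.
    rewrite zc zcoef_one // (negbTE (_ : j != 0%N :> nat)) ?mulr0 //.
  move=> j j0; rewrite zc zcoef_one // (negbTE (_ : j != 0%N :> nat)) ?cmod0 ?expr0n //.
  by rewrite -lt0n.
pose A := \sum_j cmod (a j) + 1.
have A0 : 0 < A by rewrite ltr_wpDl // sumr_ge0 // => j _; exact: cmod_ge0.
exists s1; exists (2^-1 * expR (- (g / rho * s1 `^ rho)) / A).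
  by split=> //; rewrite divr_gt0 // mulr_gt0 ?expR_gt0 // invr_gt0.
move=> s s1s; have s0 : 0 < s by exact: lt_le_trans s1s.
have hyp : g0 <= g <= Re (mu th) by rewrite !ltW.
have hyp2 : 0 < eta <= 1 by rewrite eta0.
have := ray_cone_growth e0 e1 su Hj eg hyp2 s11 hd1 hd2 hyp s1s.
rewrite {1}/ray_cone dom1 rec0 mulr1 subr0 /ray_cone.
set P := dominant _ _ _; set Rr := recessive _ _ _ _ => h.
have P0 : 0 <= P by exact: dominant_ge0.
have R0 : 0 <= Rr by exact: recessive_ge0.
set X := g / rho * s `^ rho; set X1 := g / rho * s1 `^ rho.
have EX : 2 * g / rho * s `^ rho - 2 * g / rho * s1 `^ rho = 2 * (X - X1) by rewrite /X /X1; ring.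
rewrite EX in h.
have hR : Rr <= eta * P.
  by rewrite -subr_ge0; apply: le_trans h; rewrite mulr_ge0 ?expR_ge0 // ltW.
have hP : expR (2 * (X - X1)) <= P.
  by rewrite -(ler_pM2l eta0); apply: le_trans h _; rewrite gerBl.
have sP : expR (X - X1) <= Num.sqrt P by rewrite -sqrt_expR2 ler_wsqrtr.
have sR : cc * Num.sqrt Rr <= 2^-1 * Num.sqrt P.
  apply: le_trans (ler_wpM2l (ltW cc0) (ler_wsqrtr hR)) _.
  rewrite sqrtrM ?(ltW eta0) // /eta sqrtr_sqr ger0_norm; last by rewrite invr_ge0 mulr_ge0 // ltW.
  by rewrite mulrA invfM (mulrC 2^-1) mulrA divff ?mul1r ?gt_eqF.
have N0 : (0 < m + q)%N by rewrite mq.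
have low := @dominant_comp R q m q0 eps e0 e1 (fun i => ray_jet u th i s) 0 N0.
rewrite -/P -/Rr -/cc in low.
have hu : 2^-1 * expR (X - X1) <= cmod (u (rc s * cis th)).
  by rewrite ray_jet0 //; apply: le_trans low; lra.
have uA : cmod (u (rc s * cis th)) <= A * eucl_norm f (rc s * cis th).
  apply: le_trans (cmod_sum _ _ _) _.
  rewrite /A mulrDl mul1r mulr_suml; apply: le_trans (_ : \sum_i cmod (a i) * eucl_norm f (rc s * cis th) <= _).
    by apply: ler_sum => j _; rewrite cmodM ler_wpM2l ?cmod_ge0 // le_eucl_norm.
  by rewrite lerDl eucl_norm_ge0.
rewrite mulrAC ler_pdivrMr // mulrC [leRHS]mulrC.
apply: le_trans uA; apply: le_trans hu.
by rewrite expRD -/X mulrCA mulrC -!mulrA (mulrC (expR X)) lexx.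
Qed.

Lemma cmod_det_le p (A : 'M[C]_p) (B : R) : 0 <= B -> (forall i j, cmod (A i j) <= B) ->
  cmod (\det A) <= p`!%:R * B ^+ p.
Proof.
move=> B0 H; apply: le_trans (cmod_sum _ _ _) _.
apply: le_trans (_ : \sum_(s : 'S_p) B ^+ p <= _).
  apply: ler_sum => s _; rewrite cmodM cmodX cmodN cmod1 expr1n mul1r.
  rewrite (big_morph (@cmod R) (@cmodM R) (@cmod1 R)).
  apply: le_trans (_ : \prod_(i < p) B <= _); last by rewrite prodr_const card_ord.
  by apply: ler_prod => i _; rewrite cmod_ge0 H.
by rewrite sumr_const card_Sn mulr_natl.
Qed.

(** The upper half is [jet_bound]. For the lower half, the Wronskian 1 is expanded
along its first row, whose cofactors are at most exponentially large: so the norm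
cannot be too small, in any direction. *)
Lemma ln_norm_bound : exists s1, exists2 M, 1 <= s1 /\ 0 <= M &
  forall th s, s1 <= s -> 0 < eucl_norm f (rc s * cis th) /\
    `|ln (eucl_norm f (rc s * cis th))| <= M * s `^ rho.
Proof.
have [S [B [SB1 SB2]]] : exists S : R, exists B : R, (1 <= S /\ 0 <= B) /\
   forall th s i j, S <= s -> (i <= n)%N ->
     cmod (derive1n i (f j) (rc s * cis th)) <= expR (B * s `^ rho).
  have H (j : 'I_n.+1) : exists SB : R * R, (1 <= SB.1 /\ 0 <= SB.2) /\
     forall th s i, SB.1 <= s -> (i <= n)%N ->
     cmod (derive1n i (f j) (rc s * cis th)) <= expR (SB.2 * s `^ rho).
    have [s1 [M h1 h2]] := jet_bound (fundamental_solution j).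
    by exists (s1, M).
  have [SB HSB] := choice H.
  exists (\sum_j (SB j).1), (\sum_j (SB j).2).
  have S0 j : 0 <= (SB j).1 by have [[h _] _] := HSB j; exact: le_trans h.
  have B0 j : 0 <= (SB j).2 by have [[_ h] _] := HSB j.
  have leS j : (SB j).1 <= \sum_j (SB j).1 by rewrite [leRHS](bigD1 j) //= lerDl sumr_ge0.
  have leB j : (SB j).2 <= \sum_j (SB j).2 by rewrite [leRHS](bigD1 j) //= lerDl sumr_ge0.
  split; [split; last by apply: sumr_ge0 => j _; exact: B0|].
    by apply: le_trans (leS ord0); have [[h _] _] := HSB ord0.
  move=> th s i j hs iN; have [_ h] := HSB j.
  apply: le_trans (h th s i (le_trans (leS j) hs) iN) _.
  by rewrite ler_expR ler_wpM2r ?powR_ge0.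
case: SB1 => S1 B0.
pose L := ln (n.+1`!%:R : R) + n.+1%:R.
have F0 : 0 < (n.+1`!%:R : R) by rewrite ltr0n fact_gt0.
have F1 : 1 <= (n.+1`!%:R : R) by rewrite ler1n fact_gt0.
have L0 : 0 <= L by rewrite addr_ge0 // ln_ge0.
exists S; exists (L + n.+1%:R * B); first by split=> //; rewrite addr_ge0 // mulr_ge0.
move=> th s Ss; set z := rc s * cis th.
have s1 : 1 <= s := le_trans S1 Ss.
have r1 : 1 <= s `^ rho by apply: powR_ge1 => //; exact: ltW.
have r0 : 0 <= s `^ rho by exact: powR_ge0.
pose E := expR (B * s `^ rho).
have E0 : 0 <= E by exact: expR_ge0.
have hE (i : nat) j : (i <= n)%N -> cmod (derive1n i (f j) z) <= E by exact: SB2.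
pose M : 'M[C]_n.+1 := \matrix_(i, j) derive1n i (f j) z.
have detM : \det M = 1 by exact: fundamental_wronskian.
have low : 1 <= n.+1`!%:R * E ^+ n * eucl_norm f z.
  rewrite -[leLHS](@cmod1 R) -detM (expand_det_row M 0).
  apply: le_trans (cmod_sum _ _ _) _.
  apply: le_trans (_ : \sum_(j < n.+1) eucl_norm f z * (n`!%:R * E ^+ n) <= _); last first.
    rewrite sumr_const card_ord -[leLHS]mulr_natl factS natrM le_eqVlt; apply/orP; left; apply/eqP; ring.
  apply: ler_sum => j _; rewrite cmodM; apply: ler_pM; rewrite ?cmod_ge0 //.
    by rewrite mxE derive1n0 le_eucl_norm.
  rewrite /cofactor cmodM cmodX cmodN cmod1 expr1n mul1r; apply: cmod_det_le => // i j'.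
  by rewrite !mxE hE // -ltnS.
have up : eucl_norm f z <= n.+1%:R * E.
  apply: le_trans (eucl_norm_le f z) _.
  apply: le_trans (_ : \sum_(j < n.+1) E <= _); last by rewrite sumr_const card_ord mulr_natl.
  by apply: ler_sum => j _; have := hE 0%N j (leq0n n); rewrite derive1n0.
have Ep : 0 < E by exact: expR_gt0.
have pos : 0 < eucl_norm f z.
  rewrite lt_def eucl_norm_ge0 andbT; apply/eqP => h.
  by move: low; rewrite h mulr0 ler10.
split=> //.
have lnE : ln E = B * s `^ rho by rewrite /E expRK.
have l1 : ln (eucl_norm f z) <= ln n.+1%:R + B * s `^ rho.
  rewrite -lnE -lnM ?posrE ?ltr0n // ler_ln ?posrE ?mulr_gt0 ?ltr0n //.
have l2 : 0 <= ln n.+1`!%:R + n%:R * (B * s `^ rho) + ln (eucl_norm f z).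
  rewrite -lnE.
  have -> : n%:R * ln E = ln (E ^+ n) by rewrite lnXn // mulr_natl.
  rewrite -lnM ?posrE ?exprn_gt0 // -lnM ?posrE ?mulr_gt0 ?exprn_gt0 //.
  exact: ln_ge0.
have l3 : ln (n.+1%:R : R) <= n.+1%:R by apply: ltW; apply: ln_sublinear; rewrite ltr0n.
have lf : ln (n.+1`!%:R : R) <= ln n.+1`!%:R * s `^ rho by rewrite ler_peMr // ln_ge0.
have ln1 : (n.+1%:R : R) <= n.+1%:R * s `^ rho by rewrite ler_peMr.
have lf0 : 0 <= ln (n.+1`!%:R : R) by exact: ln_ge0.
have Br0 : 0 <= B * s `^ rho by rewrite mulr_ge0.
have nB : 0 <= n%:R * (B * s `^ rho) by rewrite mulr_ge0.
have nR : (n.+1%:R : R) = n%:R + 1 by rewrite natr1.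
have n0 : (0 : R) <= n%:R by [].
have Ln : 0 <= n.+1%:R * s `^ rho by rewrite mulr_ge0.
rewrite ler_norml /L; apply/andP; split.
  rewrite nR in ln1 l1 l3 Ln *; lra.
rewrite nR in ln1 l1 l3 Ln *; lra.
Qed.

(** * The characteristic *)

Let N := (q + k)%N.

Let q2 : (2 <= q)%N. Proof. by case/andP: hq. Qed.
Let qp : (0 : R) < q%:R. Proof. by rewrite ltr0n. Qed.
Let N0 : (0 < N)%N. Proof. by rewrite /N addn_gt0 q0. Qed.
Let NR : (N%:R : R) != 0. Proof. by rewrite pnatr_eq0 -lt0n. Qed.
Let Np : (0 : R) < N%:R. Proof. by rewrite ltr0n. Qed.
Let rhoN : rho = N%:R / q%:R. Proof. by rewrite /rho /beta /N natrD; field. Qed.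

Let piq0 : 0 < pi / q%:R :> R. Proof. by rewrite divr_gt0 // pi_gt0. Qed.
Let piq2 : pi / q%:R <= pi / 2 :> R.
Proof. by rewrite ler_wpM2l ?pi_ge0 // lef_pV2 ?posrE // ler_nat. Qed.

Lemma cos_piq_ge0 : 0 <= cos (pi / q%:R) :> R.
Proof. by apply: cos_ge0_pihalf; rewrite piq2 andbT (le_trans _ (ltW piq0)) // oppr_le0 divr_ge0 // pi_ge0. Qed.

Lemma cos_piq_lt (phi : R) : `|phi| < pi / q%:R -> cos (pi / q%:R) < cos phi.
Proof.
move=> h; rewrite -[cos phi]cos_norm ltr_cos //; rewrite in_itv /= ?normr_ge0 /=.
  by apply: ltW; apply: lt_le_trans h _; apply: le_trans piq2 _; have := pi_ge0 R; lra.
by rewrite ltW //=; apply: le_trans piq2 _; have := pi_ge0 R; lra.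
Qed.

(** Why the root of unity 1 dominates: the angles of the other roots keep a
distance at least [pi / q] from the multiples of [2 * pi]. *)
Lemma cos_other_roots (phi : R) (j : nat) : `|phi| < pi / q%:R -> (0 < j < q)%N ->
  cos (phi + j%:R * (2 * pi / q%:R)) <= cos (pi / q%:R).
Proof.
rewrite ltr_norml => /andP[p1 p2] /andP[j0 jq].
set psi := phi + _.
have j1 : (1 : R) <= j%:R by rewrite ler1n.
have jq1 : (j%:R : R) + 1 <= q%:R by rewrite natr1 ler_nat.
have E : j%:R * (2 * pi / q%:R) = 2 * j%:R * (pi / q%:R) :> R by ring.
have Eq : pi = q%:R * (pi / q%:R) :> R by rewrite mulrC divfK.
have h1 : pi / q%:R <= psi.
  have := ler_wpM2r (ltW piq0) j1; rewrite /psi E; lra.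
have h2 : psi <= 2 * pi - pi / q%:R.
  have := ler_wpM2r (ltW piq0) jq1; rewrite /psi E {4}Eq; lra.
have piqpi : pi / q%:R <= pi :> R by apply: le_trans piq2 _; have := pi_ge0 R; lra.
have mono (x : R) : pi / q%:R <= x <= pi -> cos x <= cos (pi / q%:R).
  move=> /andP[x1 x2]; rewrite leNgt ltr_cos ?in_itv /= ?(ltW piq0) ?piqpi ?x2 ?andbT //.
    by rewrite -leNgt.
  exact: le_trans (ltW piq0) x1.
have [hp|hp] := leP psi pi; first by apply: mono; rewrite h1.
have -> : cos psi = cos (2 * pi - psi).
  rewrite mulr_natl cosB cos2pi sin2pi mul0r mul1r addr0 //.
by apply: mono; apply/andP; split; lra.
Qed.

(** Every coordinate grows at most at any rate above [cos (rho * th)], and the norm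
grows at least at any rate between [cos (pi / q)] and [cos (rho * th)]. *)
Lemma ray_limit (th : R) : `|rho * th| < pi / q%:R ->
  forall d, 0 < d -> exists2 S, 1 <= S & forall s, S <= s ->
    `|ln (eucl_norm f (rc s * cis th)) / s `^ rho - cos (rho * th) / rho| <= d.
Proof.
move=> hth d d0; pose c := cos (rho * th).
have cq : cos (pi / q%:R) < c := cos_piq_lt hth; have cq0 := cos_piq_ge0.
have c0 : 0 < c by exact: le_lt_trans cq.
have muE : Re (cis (rho * th)) = c by [].
have Hj j : (0 < j < q)%N -> Re (cis (rho * th) * zeta R q j 1) <= cos (pi / q%:R).
  move=> hj; rewrite /zeta mulr1 -cisD /=; exact: cos_other_roots.
have [s1 [M1 [[s11 M10] H1]]] := ln_norm_bound.
pose g := c + d * rho / 2.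
have dr0 : 0 < d * rho / 2 by rewrite divr_gt0 // mulr_gt0.
have cg : 0 < c < g by rewrite c0 ltrDl.
have U (j : 'I_n.+1) : exists SM : R * R, (1 <= SM.1 /\ 0 <= SM.2) /\
    forall s, SM.1 <= s -> cmod (f j (rc s * cis th)) <= SM.2 * expR (g / rho * s `^ rho).
  have [sj [Mj h1 h2]] := @ray_upper (f j) th c g (fundamental_solution j)
    (fun j hj => le_trans (Hj j hj) (ltW cq)) (lexx _) cg.
  by exists (sj, Mj).
have [SM HSM] := choice U.
pose Su := \sum_j (SM j).1; pose Mu := \sum_j (SM j).2 + 1.
have S0 j : 0 <= (SM j).1 by have [[h _] _] := HSM j; exact: le_trans h.
have M0 j : 0 <= (SM j).2 by have [[_ h] _] := HSM j.
have leS j : (SM j).1 <= Su by rewrite /Su [leRHS](bigD1 j) //= lerDl sumr_ge0.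
have Mu0 : 0 < Mu by rewrite ltr_wpDl // sumr_ge0.
have up s : s1 <= s -> Su <= s -> ln (eucl_norm f (rc s * cis th)) <= ln Mu + g / rho * s `^ rho.
  move=> h1 hs; have [p _] := H1 th s h1.
  rewrite -[X in _ <= _ + X]expRK -lnM ?posrE ?expR_gt0 // ler_ln ?posrE ?mulr_gt0 ?expR_gt0 //.
  apply: le_trans (eucl_norm_le f _) _; rewrite /Mu mulrDl mul1r mulr_suml.
  apply: le_trans (_ : \sum_j (SM j).2 * expR (g / rho * s `^ rho) <= _); last first.
    by rewrite lerDl expR_ge0.
  apply: ler_sum => j _; have [_ h] := HSM j; apply: h; exact: le_trans (leS j) hs.
(* a rate below [c], as close to [c] as [d] requires, and above the rates of the
   recessive components *)
pose g1 := Num.max ((cos (pi / q%:R) + c) / 2) (c - d * rho / 2).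
have g1c : g1 < c by rewrite gt_max; apply/andP; split; lra.
pose g0 := (cos (pi / q%:R) + g1) / 2.
have g1q : cos (pi / q%:R) < g1 by rewrite lt_max; apply/orP; left; lra.
have Hj0 j : (0 < j < q)%N -> Re (cis (rho * th) * zeta R q j 1) <= g0.
  by move=> hj; apply: le_trans (Hj j hj) _; rewrite /g0; lra.
have g00 : 0 < g0 by rewrite /g0; lra.
have g0g1 : g0 < g1 < Re (cis (rho * th)) by rewrite muE g1c andbT /g0; lra.
have [s2 [c2 [s21 c20] H2]] := ray_lower Hj0 g00 g0g1.
have low s : s1 <= s -> s2 <= s -> ln c2 + g1 / rho * s `^ rho <= ln (eucl_norm f (rc s * cis th)).
  move=> h1 hs; have [p _] := H1 th s h1.
  rewrite -[X in _ + X <= _]expRK -lnM ?posrE ?expR_gt0 // ler_ln ?posrE ?mulr_gt0 ?expR_gt0 //.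
  exact: H2.
pose L := `|ln Mu| + `|ln c2|.
have L0 : 0 <= L by rewrite addr_ge0.
have Su0 : 0 <= Su by apply: sumr_ge0.
exists (s1 + s2 + Su + 2 * L / d).
  have : 0 <= 2 * L / d by rewrite divr_ge0 ?mulr_ge0 // ltW.
  lra.
have Ld : 0 <= 2 * L / d by rewrite divr_ge0 ?mulr_ge0 // ltW.
move=> s hs.
have hs1 : s1 <= s by lra.
have hs2 : s2 <= s by lra.
have hs3 : Su <= s by lra.
have s1' : 1 <= s by lra.
have hL : L <= d / 2 * s.
  have : 2 * L / d <= s by lra.
  rewrite ler_pdivrMr // => h; lra.
have ss := @le_powR_rho s s1'.
have r0 : 0 < s `^ rho by apply: lt_le_trans ss; lra.
have hLr : L <= d / 2 * s `^ rho.
  by apply: le_trans hL _; rewrite ler_wpM2l // divr_ge0 // ltW.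
have u1 := up s hs1 hs3; have l1 := low s hs1 hs2.
have a1 : ln Mu <= L by apply: le_trans (ler_norm _) _; rewrite lerDl.
have a2 : - L <= ln c2.
  by rewrite lerNl; apply: le_trans (ler_norm _) _; rewrite normrN lerDr.
have gE : g / rho * s `^ rho = c / rho * s `^ rho + d / 2 * s `^ rho.
  by rewrite /g; field; rewrite gt_eqF.
have g1E : c / rho * s `^ rho - d / 2 * s `^ rho <= g1 / rho * s `^ rho.
  rewrite -mulrBl ler_wpM2r ?powR_ge0 // ler_pdivlMr // mulrBl divfK ?gt_eqF //.
  by rewrite le_max; apply/orP; right; lra.
set F := ln (eucl_norm f (rc s * cis th)) in u1 l1 *.
rewrite (_ : F / s `^ rho - cos (rho * th) / rho = (F - c / rho * s `^ rho) / s `^ rho); last first.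
  by rewrite mulrBl mulfK ?gt_eqF.
rewrite normrM [X in _ * X]gtr0_norm ?invr_gt0 // ler_pdivrMr // ler_norml.
apply/andP; split; lra.
Qed.

(** Rotation by an [N]-th root of unity preserves the equation, and its effect on
the initial values at 0 is diagonal. *)
Lemma fundamental_rotation j z : f j (cis (2 * pi / N%:R) * z) = cis (2 * pi / N%:R) ^+ j * f j z.
Proof.
set w := cis _; have sj := fundamental_solution j.
have wN : w ^+ N = 1 by have := cis2pi_nat R 1; rewrite mul1r cisX (mulrC N%:R) divfK.
have sd : solution n m k (fun z => f j (w * z)).
  apply: solution_dilation sj; by rewrite -/m -mq -addnA exprD -/N wN mulr1 ?addnK.
have sc : solution n m k (fun z => \sum_(i <- [:: tt]) w ^+ j * f j z).
  exact: (solution_lincomb [:: tt] (fun=> w ^+ j) (fun=> sj)).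
have -> : w ^+ j * f j z = \sum_(i <- [:: tt]) w ^+ j * f j z by rewrite big_seq1.
apply: (solution_unique (ltnW mn) sd sc) => i iN.
have ej : entire (f j) by case: sj.
rewrite derive1n_dilation // (derive1n_lincomb [:: tt] (fun=> w ^+ j) i (fun=> ej)) big_seq1 mulr0.
case: Hf => _ _ Hf2; have := Hf2 (Ordinal (iN : (i < n.+1)%N)) j; rewrite /= => ->.
by case: eqP => [<-//|_]; rewrite !mulr0.
Qed.

Lemma eucl_norm_rotation (r t : R) :
  eucl_norm f (polar r (t + 2 * pi / N%:R)) = eucl_norm f (polar r t).
Proof.
rewrite !eucl_normE; congr Num.sqrt; apply: eq_bigr => j _.
rewrite !polarE cisD (_ : rc r * _ = cis (2 * pi / N%:R) * (rc r * cis t)); last by ring.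
by rewrite fundamental_rotation cmodM cmodX cmod_cis expr1n mul1r.
Qed.

Lemma eucl_norm_origin : eucl_norm f 0 = 1.
Proof.
rewrite eucl_normE (bigD1 ord0) //= big1 => [|j j0].
  case: Hf => _ _ Hf2; have := Hf2 ord0 ord0; rewrite eqxx derive1n0 => ->.
  by rewrite cmod1 expr1n addr0 sqrtr1.
case: Hf => _ _ Hf2; have := Hf2 ord0 j; rewrite derive1n0 => ->.
by rewrite eq_sym (negbTE j0) cmod0 expr0n.
Qed.

(** The norm has the period [2 * pi / N] in the argument, so that the mean over the
circle is [N] times the integral over [|t| < pi / N] divided by [2 * pi]. There
the normalised logarithm converges boundedly to [cos (rho * t) / rho], whose
integral is [2 * sin (pi / q) / rho ^+ 2]; finally [N = q * rho]. *)
Lemma characteristic_asymptotics :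
  characteristic f r / (q%:R * sin (pi / q%:R) / (pi * rho) * r `^ rho)
    @[r --> +oo] --> (1 : R).
Proof.
have [s1 [M [[s11 M0] H1]]] := ln_norm_bound.
(* radii below [s1] are replaced by [s1], so that the bounds hold for all [r] *)
pose v r := Num.max r s1.
have v1 r : s1 <= v r by rewrite le_max lexx orbT.
have v11 r : 1 <= v r by exact: le_trans (v1 r).
have vp r : 0 < v r `^ rho by rewrite powR_gt0 // (lt_le_trans _ (v11 r)).
pose F (r t : R) := ln (eucl_norm f (polar (v r) t)) / v r `^ rho.
have ef j : entire (f j) by case: Hf => h _ _; exact: h.
have pos r t : 0 < eucl_norm f (polar (v r) t).
  by rewrite polarE; have [] := H1 t (v r) (v1 r).
have cF r : forall t : R, {for t, continuous (F r)}.
  move=> t; rewrite /F; apply: continuousM; last exact: cst_continuous.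
  exact: (continuous_ln_norm ef (pos r)).
have bF r t : `|F r t| <= M.
  rewrite normrM [X in _ * X]gtr0_norm ?invr_gt0 // ler_pdivrMr //.
  by rewrite polarE; have [] := H1 t (v r) (v1 r).
pose T : R := 2 * pi / N%:R.
have T0 : 0 < T by rewrite divr_gt0 // mulr_gt0 // pi_gt0.
have perF r t : F r (t + T) = F r t by rewrite /F eucl_norm_rotation.
pose a : R := - (pi / N%:R).
have aT : a + T = pi / N%:R by rewrite /a /T; field.
have piN : pi / N%:R <= pi :> R by rewrite ler_pdivrMr // ler_peMr ?pi_ge0 // ler1n.
have I1 r : \int[lebesgue_measure]_(t in `[- pi, pi]) F r t = N%:R * \int[lebesgue_measure]_(t in `[a, pi / N%:R]) F r t.
  have := @Rintegral_periodic R (F r) T (- pi) a N T0 (cF r) (perF r) _ N0.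
  rewrite aT lerN2 => /(_ piN).
  by rewrite (_ : - pi + N%:R * T = pi) // /T; field.
pose G (t : R) := cos (rho * t) / rho.
have dG (t : R) : is_derive t 1 (fun t => sin (rho * t) / rho ^+ 2) (G t).
  have h := is_derive_compR (is_derive_sin (rho * t)) (is_derive_linR rho t).
  apply: is_derive_eq (is_deriveRM h (is_derive_cst (rho ^- 2) t 1)) _.
  by rewrite /G mulr0 addr0 expr2 invfM mulrA mulfK // gt_eqF.
have cG : forall t : R, {for t, continuous G}.
  move=> t; rewrite /G; apply: continuousM; last exact: cst_continuous.
  apply: (@continuous_comp _ _ _ (fun t => rho * t) (@cos R)); last exact: continuous_cos.
  by apply: continuousM; [exact: cst_continuous|].
have IG : \int[lebesgue_measure]_(t in `[a, pi / N%:R]) G t = 2 * sin (pi / q%:R) / rho ^+ 2.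
  rewrite (@Rintegral_primitive R G (fun t => sin (rho * t) / rho ^+ 2)) //; last first.
    by rewrite /a gtrN // divr_gt0 // pi_gt0.
  have E : rho * (pi / N%:R) = pi / q%:R by rewrite rhoN; field; rewrite NR qR.
  by rewrite /a mulrN sinN E; ring.
have LF : \int[lebesgue_measure]_(t in `[a, pi / N%:R]) F r t @[r --> +oo] --> 2 * sin (pi / q%:R) / rho ^+ 2.
  rewrite -IG; apply/cvg_pinftyP => u hu.
  apply: (@bounded_convergence_segment R (fun n => F (u n)) G a (pi / N%:R) M) => //.
  move=> t ht; apply/cvgrPdist_le => d d0.
  have hth : `|rho * t| < pi / q%:R.
    rewrite normrM gtr0_norm // rhoN mulrAC ltr_pdivrMr // mulrC divfK //.
    by rewrite -ltr_pdivlMr // ltr_norml.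
  have [S S1 HS] := ray_limit hth d0.
  move/cvgryPge : hu => /(_ S); apply: filterS => i hi.
  rewrite distrC /F /G polarE; apply: HS.
  by rewrite le_max hi.
have A0 : 0 < q%:R * sin (pi / q%:R) / (pi * rho) :> R.
  rewrite divr_gt0 ?mulr_gt0 ?pi_gt0 //; apply: sin_gt0_pi; rewrite piq0 /=.
  by apply: le_lt_trans piq2 _; have := pi_gt0 R; lra.
have K : (2 * pi)^-1 * (N%:R * (2 * sin (pi / q%:R) / rho ^+ 2)) /
    (q%:R * sin (pi / q%:R) / (pi * rho)) = 1 :> R.
  have sn : sin (pi / q%:R) != 0 :> R.
    apply: contraTneq A0 => ->; by rewrite mulr0 mul0r ltxx.
  have pn : pi != 0 :> R by rewrite gt_eqF // pi_gt0.
  have E (x y u w : R) : x != 0 -> y != 0 -> u != 0 -> w != 0 ->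
      (2 * y)^-1 * (u * (2 * x / (u / w) ^+ 2)) / (w * x / (y * (u / w))) = 1.
    by move=> x0 y0 u0 w0; field; rewrite x0 y0 u0 w0.
  by rewrite rhoN; exact: E sn pn NR qR.
have L2 : (2 * pi)^-1 * (N%:R * \int[lebesgue_measure]_(t in `[a, pi / N%:R]) F r t) /
    (q%:R * sin (pi / q%:R) / (pi * rho)) @[r --> +oo] -->
    (2 * pi)^-1 * (N%:R * (2 * sin (pi / q%:R) / rho ^+ 2)) / (q%:R * sin (pi / q%:R) / (pi * rho)).
  apply: cvgM; last exact: cvg_cst.
  by apply: cvgM; [exact: cvg_cst|apply: cvgM; [exact: cvg_cst|]].
rewrite K in L2; apply: cvg_trans L2; apply: near_eq_cvg.
near=> r.
have rs : s1 <= r by near: r; apply: nbhs_pinfty_ge; exact: num_real.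
have vr : v r = r by rewrite /v max_l.
rewrite -I1 /characteristic eucl_norm_origin ln1 subr0.
have -> : \int[lebesgue_measure]_(t in `[- pi, pi]) ln (eucl_norm f (polar r t)) =
    r `^ rho * \int[lebesgue_measure]_(t in `[- pi, pi]) F r t.
  rewrite -RintegralZl //; last exact: continuous_integrable_segment.
  by apply: eq_Rintegral => t _; rewrite /F vr mulrCA divff ?mulr1 // -vr gt_eqF.
have rn : r `^ rho != 0 by rewrite -vr gt_eqF.
have E (x i u p : R) : u != 0 -> p != 0 -> x * i / u = x * (p * i) / (u * p).
  by move=> u0 p0; field; rewrite u0 p0.
by apply: E => //; rewrite gt_eqF.
Unshelve. all: by end_near.
Qed.

End Growth.

(** * Positivity on the positive axis *)

Section PositiveAxis.
Variable R : realType.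
Local Notation C := (Cplx R).

Lemma increasing_der (f df : R -> R) (a b : R) : a < b ->
  (forall x, a <= x <= b -> is_derive x 1 f (df x)) ->
  (forall x, a < x < b -> 0 < df x) -> f a < f b.
Proof.
move=> ab df1 pos.
have [||c] := @MVT R f df a b ab.
- by move=> x; rewrite in_itv /= => /andP[/ltW ax /ltW xb]; apply: df1; rewrite ax.
- apply: derivable_within_continuous => x; rewrite in_itv /= => h.
  by case: (df1 x h).
rewrite in_itv /= => h e; rewrite -subr_gt0 e mulr_gt0 ?subr_gt0 //; exact: pos.
Qed.

(** Used through its square, which is differentiable everywhere. *)
Definition negpart (t : R) : R := Num.min t 0.

Lemma is_derive_negpart2 (t : R) : is_derive t 1 (fun t => negpart t ^+ 2) (2 * negpart t).
Proof.
apply/is_deriveRP => e e0; exists e => // h he.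
apply: le_trans (_ : `|h| * `|h| <= _); last by rewrite ler_wpM2r // ltW.
rewrite -normrM ler_norml ger0_norm -?expr2 ?sqr_ge0 // /negpart.
by case: (leP t 0) => t0; case: (leP (t + h) 0) => th; apply/andP; split; nra.
Qed.

Lemma negpart_pairing (s t : R) : negpart s * t <= negpart s * negpart t.
Proof.
rewrite ler_wnM2l // ?ge_min ?lexx // orbT //.
Qed.

Variables (n m k : nat).
Hypothesis mn : (m <= n)%N.

Lemma is_derive_Re_jet (u : C -> C) i (x : R) : entire u ->
  is_derive x 1 (fun t => Re (derive1n i u (rc t))) (Re (derive1n i.+1 u (rc x))).
Proof.
move=> eu; have [h _] := rder_derive1n i 1 x eu.
by move: h; under eq_fun do rewrite mulr1; rewrite mul1r mulr1.
Qed.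

Lemma Re_jet_top (u : C -> C) (x : R) : solution n m k u ->
  Re (derive1n n.+1 u (rc x)) = x ^+ k * Re (derive1n m u (rc x)).
Proof. by case=> _ ->; rewrite -rcX ReMrc. Qed.

(** On the positive axis the system for the jet has nonnegative coefficients, so
the sum of the squared negative parts satisfies a Gronwall inequality and stays
zero. *)
Lemma nonneg_jet (u : C -> C) (a b : R) : solution n m k u -> 0 <= a <= b ->
  (forall i, (i <= n)%N -> 0 <= Re (derive1n i u (rc a))) ->
  forall i, (i <= n)%N -> 0 <= Re (derive1n i u (rc b)).
Proof.
move=> su /andP[a0 ab] Ha; have eu : entire u by case: su.
pose y i (x : R) := Re (derive1n i u (rc x)).
pose phi (x : R) := \sum_(i < n.+1) negpart (y i x) ^+ 2.
have dphi (x : R) : is_derive x 1 phi (\sum_(i < n.+1) 2 * negpart (y i x) * y i.+1 x).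
  apply: is_derive_sumR => i _.
  exact: (is_derive_compR (is_derive_negpart2 _) (is_derive_Re_jet i x eu)).
pose K := 2 * (1 + b ^+ k).
have b0 : 0 <= b by exact: le_trans ab.
have phi_b : phi b <= phi a * expR (K * b - K * a).
  apply: (@le_exp_gronwall R phi _ (fun t => K * t) (fun=> K) a b ab
    (fun t _ => dphi t) (fun t _ => is_derive_linR K t)) => x /andP[ax xb].
  apply: le_trans (cyclic_sum_le (fun i => negpart (y i x)) (exprn_ge0 k b0) mn).
  rewrite big_ord_recr /=; apply: lerD.
    by apply: ler_sum => i _; rewrite -mulrA ler_wpM2l // negpart_pairing.
  have top : y n.+1 x = x ^+ k * y m x by exact: Re_jet_top.
  rewrite -mulrA ler_wpM2l // top mulrCA.
  have x0 : 0 <= x by exact: le_trans ax.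
  apply: le_trans (ler_wpM2l (exprn_ge0 k x0) (negpart_pairing _ _)) _.
  rewrite ler_wpM2r //; first by rewrite mulr_le0 // ge_min lexx orbT.
  by apply: lerXn2r; rewrite ?nnegrE.
have phi0 : phi a = 0.
  by rewrite /phi big1 // => i _; rewrite /negpart min_r ?expr0n // Ha // -ltnS.
rewrite phi0 mul0r in phi_b => i iN.
have : negpart (y i b) ^+ 2 <= 0.
  apply: le_trans phi_b; rewrite /phi (bigD1 (Ordinal (iN : (i < n.+1)%N))) //= lerDl.
  by apply: sumr_ge0 => j _; exact: sqr_ge0.
move=> h; have : negpart (y i b) ^+ 2 == 0 by rewrite eq_le h sqr_ge0.
by rewrite sqrf_eq0 leNgt; apply: contraTN => lt; rewrite /negpart min_l ?ltW // lt_eqF.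
Qed.

Variable f : 'I_n.+1 -> C -> C.
Hypothesis Hf : fundamental_solutions m k f.

Let sf j : solution n m k (f j).
Proof. by case: Hf => ef Hf1 _; split; [exact: ef|exact: Hf1]. Qed.
Let ef j : entire (f j). Proof. by case: (sf j). Qed.
Let jet0 j i : (i <= n)%N -> derive1n i (f j) 0 = (i == j)%:R.
Proof. by move=> iN; case: Hf => _ _ /(_ (Ordinal (iN : (i < n.+1)%N)) j). Qed.

Lemma fundamental_nonneg j (x : R) i : 0 <= x -> (i <= n)%N ->
  0 <= Re (derive1n i (f j) (rc x)).
Proof.
move=> x0; apply: (@nonneg_jet _ 0) => // [|{}i iN]; first by rewrite lexx.
by rewrite rc0 jet0 //; case: (i == j).
Qed.

(** The solutions [ci * f j] and [- ci * f j] have jets with real part 0 at 0, hence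
nonnegative real parts afterwards. *)
Lemma fundamental_real j (x : R) : 0 <= x -> Im (f j (rc x)) = 0.
Proof.
move=> x0; have ge (c : C) : Re c = 0 -> 0 <= Re (c * f j (rc x)).
  move=> c0; have su := solution_lincomb [:: tt] (fun=> c) (fun=> sf j).
  have := @nonneg_jet _ 0 x su _ _ 0 (leq0n n); rewrite derive1n0 big_seq1; apply.
    by rewrite lexx.
  move=> i iN; rewrite (@derive1n_lincomb _ _ [:: tt] (fun=> c) (fun=> f j)) => [|_]; last exact: ef.
  rewrite big_seq1.
  by rewrite rc0 jet0 // ReM c0; case: (i == j); rewrite /= !mul0r mulr0 subrr.
have := ge (ci R) erefl; have := ge (- ci R) (oppr0 _).
by rewrite !ReM /= => *; lra.
Qed.

(** Positivity passes from each derivative to the preceding one by integration.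
The derivative of order [j] starts at 1; from there positivity descends to the
order [m], the equation carries it to the order [n + 1], and it descends to all
orders. *)
Lemma fundamental_pos (j : 'I_n.+1) (x : R) i : (m <= j)%N -> 0 < x -> (i <= n)%N ->
  0 < Re (derive1n i (f j) (rc x)).
Proof.
move=> mj; pose P l := forall x : R, 0 < x -> 0 < Re (derive1n l (f j) (rc x)).
have step l : (l <= n)%N -> P l.+1 -> P l.
  move=> lN Pl {}x x0; apply: le_lt_trans (fundamental_nonneg j (lexx 0) lN) _.
  have := @increasing_der (fun t => Re (derive1n l (f j) (rc t)))
    (fun t => Re (derive1n l.+1 (f j) (rc t))) 0 x x0 (fun t _ => is_derive_Re_jet l t (@ef j)).
  apply => t /andP[t0 _].
  exact: Pl.
have down a b : (b <= a)%N -> (a <= n.+1)%N -> P a -> P b.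
  elim: a => [|a ih]; first by rewrite leqn0 => /eqP ->.
  rewrite leq_eqVlt => /orP[/eqP -> //|ba] aN Pa.
  by apply: ih => //; [exact: ltnW|exact: step].
have Pj : P j.
  move=> {}x x0; apply: lt_le_trans ltr01 _.
  have -> : 1 = Re (derive1n j (f j) (rc 0)) by rewrite rc0 jet0 ?eqxx // -ltnS.
  have := @nondecreasing_der R (fun t => Re (derive1n j (f j) (rc t)))
    (fun t => Re (derive1n j.+1 (f j) (rc t))) 0 x (ltW x0) (fun t _ => is_derive_Re_jet j t (@ef j)).
  apply => t /andP[t0 _].
  have [jn|nj] := ltnP j n; first exact: fundamental_nonneg.
  have -> : (j : nat) = n by apply/eqP; rewrite eqn_leq nj -ltnS ltn_ord.
  by rewrite Re_jet_top // mulr_ge0 ?exprn_ge0 // fundamental_nonneg.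
have Ptop : P n.+1.
  move=> {}x x0; rewrite Re_jet_top // mulr_gt0 ?exprn_gt0 //.
  by apply: (down j m mj _ Pj) => //; exact: ltnW.
by move=> x0 iN; exact: (down n.+1 i (leqW iN) (leqnn _) Ptop).
Qed.

(** Comparison at abscissa 1, where the jet of [f j] is positive, propagates to
the whole half-line. *)
Lemma fundamental_comparable (i j : 'I_n.+1) : (m <= j)%N -> exists2 K : R, 0 <= K &
  forall x, 1 <= x -> cmod (f i (rc x)) <= K * cmod (f j (rc x)).
Proof.
move=> mj; pose y i l : R := Re (derive1n l (f i) (rc 1)).
pose K := \sum_(l < n.+1) y i l / y j l.
have q0 l : (l <= n)%N -> 0 <= y i l / y j l.
  move=> lN; rewrite divr_ge0 //; first exact: fundamental_nonneg.
  by apply/ltW/fundamental_pos.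
have K0 : 0 <= K by apply: sumr_ge0 => l _; rewrite q0 // -ltnS.
exists K => // x x1; have x0 : 0 <= x by exact: le_trans x1.
have cmodE l : cmod (f l (rc x)) = Re (f l (rc x)).
  have e : f l (rc x) = rc (Re (f l (rc x))) by apply: C_ext => //=; rewrite fundamental_real.
  by rewrite e cmod_rc /= ger0_norm //; exact: (@fundamental_nonneg l x 0%N).
rewrite !cmodE -subr_ge0.
pose g (b : bool) := if b then f j else f i.
pose a (b : bool) : C := if b then rc K else -1.
have sg b : solution n m k (g b) by case: b; exact: sf.
have E (h : bool -> C) : \sum_(b <- [:: true; false]) h b = h true + h false.
  by rewrite !big_cons big_nil addr0.
have := @nonneg_jet _ 1 x (solution_lincomb [:: true; false] a sg) _ _ 0 (leq0n n).
rewrite derive1n0 E /= mulN1r ReB ReMrc; apply; first by rewrite ler01.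
move=> l lN; rewrite derive1n_lincomb; last by move=> b; case: (sg b).
rewrite E /= mulN1r ReB ReMrc subr_ge0 -ler_pdivrMr; last exact: fundamental_pos.
rewrite /K (bigD1 (Ordinal (lN : (l < n.+1)%N))) //= lerDl.
by apply: sumr_ge0 => l' _; rewrite q0 // -ltnS.
Qed.

End PositiveAxis.

(** * The projective curve *)

Section ProjectiveCurve.
Variable R : realType.
Local Notation C := (Cplx R).

Lemma ccvg_continuous (g : C -> C) (l : C) (u : nat -> C) : is_derive (0 : C) 1 g l ->
  (forall e : R, 0 < e -> \forall s \near \oo, cmod (u s) < e) -> ccvg (fun s => g (u s)) (g 0).
Proof.
move=> dg hu; apply/ccvgP => e e0; have [d d0 Hd] := is_derive_epsdelta dg e0.
by apply: filterS (hu _ d0) => s /Hd; rewrite add0r.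
Qed.

Lemma line_scale (n : nat) (v w : 'rV[C]_n.+1) : <[v]>%VS = <[w]>%VS ->
  exists a : C, v = a *: w.
Proof. by move=> e; apply/vlineP; rewrite -e memv_line. Qed.

Lemma proj_point_scale (n : nat) (v w : 'rV[C]_n.+1) (v0 : v != 0) (w0 : w != 0) (a : C) :
  v = a *: w -> proj_point v0 = proj_point w0.
Proof.
move=> e; apply: eq_exist => /=; apply/eqP; rewrite eqEdim !dim_vline v0 w0 andbT.
by rewrite -memvE; apply/vlineP; exists a.
Qed.

Lemma infinity_chartE (w : C) : w != 0 -> infinity_chart w = affine_chart w^-1.
Proof.
move=> w0; apply: (@proj_point_scale _ _ _ _ _ w); apply/rowP => j; rewrite !mxE.
by case: ifP => _; rewrite ?mulr1 // divff.
Qed.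

(** Two lifts of the same point are proportional, which is stated without the
factor as the vanishing of the 2 by 2 minors. *)
Lemma lift_minors (n : nat) (u v : 'I_n.+1 -> C) : <[\row_j u j]>%VS = <[\row_j v j]>%VS ->
  forall i j, u j * v i = u i * v j.
Proof.
move=> /line_scale[a /rowP e] i j; have := e i; have := e j; rewrite !mxE => -> ->; ring.
Qed.

(** The chart at infinity, in which [w] is [z^-1], provides a lift that does not
vanish at [w = 0]. *)
Lemma rational_lift_infinity (n : nat) (F : C -> projspace R n) : rational_curve F ->
  exists g : 'I_n.+1 -> C -> C, exists2 d : R, 0 < d &
    [/\ forall j, derivable (g j) 0 1, exists j, g j 0 != 0 &
     forall w, w != 0 -> cmod w < d -> val (F w^-1) = <[\row_j g j w]>%VS].
Proof.
move=> [G [_ hG] GF]; have [g /nbhs_ballP[e /= e0 He]] := hG 0.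
have [d d0 ed] := pos_rc e0; exists g; exists d => //.
have near w : cmod w < d -> (forall j, derivable (g j) w 1) /\
    val (G (infinity_chart w)) = <[\row_j g j w]>%VS.
  by move=> wd; apply: He; rewrite -ball_normE /ball_ /= sub0r normrN normE ed rc_lt.
split.
- by move=> j; have [|h _] := near 0; [rewrite cmod0|exact: h].
- have [|_ h] := near 0; first by rewrite cmod0.
  apply: contrapT => H; have g0 : \row_j g j 0 = 0 :> 'rV[C]_n.+1.
    apply/rowP => j; rewrite !mxE; apply/eqP; apply: contrapT => /negP h0.
    by apply: H; exists j.
  have := svalP (G (infinity_chart 0)); rewrite [sval _]h g0 dim_vline eqxx //.
- move=> w w0 wd; have [_ <-] := near w wd.
  by rewrite infinity_chartE // GF.
Qed.

Variables (n m k N : nat).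
Hypothesis mn : (m < n)%N.
Hypothesis N2 : (2 <= N)%N.

Variable f : 'I_n.+1 -> C -> C.
Hypothesis Hf : fundamental_solutions m k f.
Let w := cis (2 * pi / N%:R : R).
Hypothesis rot : forall j z, f j (w * z) = w ^+ j * f j z.

Lemma root_of_unity_neq1 : w != 1.
Proof.
have p0 := pi_gt0 R; have N0 : (0 : R) < N%:R by rewrite ltr0n; exact: leq_trans N2.
have N2' : (2 : R) <= N%:R by rewrite ler_nat.
have h : 2 * pi / N%:R <= pi :> R by rewrite ler_pdivrMr //; nra.
have h0 : 0 < 2 * pi / N%:R :> R by rewrite divr_gt0 // mulr_gt0.
have c1 : cos (2 * pi / N%:R) < 1 :> R.
  have := @ltr_cos R 0 (2 * pi / N%:R); rewrite !in_itv /= lexx (ltW p0) (ltW h0) h cos0.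
  by move=> -> //.
by apply/eqP => /(congr1 (@complex.Re R)) /= e; rewrite e ltxx in c1.
Qed.

(** A lift at infinity gives the ratios of the coordinates limits that do not
depend on the direction. The coordinates [m] and [m + 1] are positive and dominate
all others on the positive axis, so their ratio has a finite nonzero limit; but
rotation by [w] multiplies this ratio by [w]. *)
Lemma fundamental_not_rational (F : C -> projspace R n) :
  reduced_representation f F -> transcendental_curve F.
Proof.
move=> [_ _ fF] /rational_lift_infinity[g [d d0 [dg [i0 gi0] gF]]].
have minors (z : C) i j : z != 0 -> cmod z < d -> f j z^-1 * g i z = f i z^-1 * g j z.
  move=> z0 zd; apply: (@lift_minors n (fun j => f j z^-1) (fun j => g j z)).
  by rewrite -gF // -fF.
pose x (s : nat) : R := s.+1%:R.
have x0 s : 0 < x s by rewrite ltr0n.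
have x1 s : 1 <= x s by rewrite ler1n.
have rx0 s : rc (x s) != 0 by rewrite -cmod_gt0 cmod_rc gtr0_norm.
have small (c : C) : cmod c = 1 -> forall e, 0 < e ->
    \forall s \near \oo, cmod (c * (rc (x s))^-1) < e.
  move=> c1 e e0; near=> s.
  rewrite cmodM c1 mul1r cmodV cmod_rc gtr0_norm // invf_plt ?posrE //.
  apply: le_lt_trans (ler_norm _) _.
  have : `|e^-1| < s%:R by near: s; exact: nbhs_infty_gtr.
  by move/lt_trans; apply; rewrite ltr_nat.
have c0 c : cmod c = 1 -> c != 0 :> C by move=> c1; rewrite -cmod_gt0 c1.
have lim (c : C) j : cmod c = 1 -> ccvg (fun s => g j (c * (rc (x s))^-1)) (g j 0).
  move=> c1; apply: ccvg_continuous (small c c1).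
  by apply: DeriveDef; [exact: dg|].
have pos s (j : 'I_n.+1) : (m <= j)%N -> 0 < cmod (f j (rc (x s))).
  move=> mj; have h := @fundamental_pos R n m k (ltnW mn) f Hf j (x s) 0%N mj (x0 s) (leq0n n).
  by apply: lt_le_trans h _; apply: le_trans (ler_norm _) (Re_le_cmod _).
(* comparison on the positive axis keeps the limits of the coordinates of
   index at least m away from zero *)
have gne (j : 'I_n.+1) : (m <= j)%N -> g j 0 != 0.
  move=> mj; have [K K0 HK] := fundamental_comparable (ltnW mn) Hf i0 mj.
  apply/eqP => gj0; move/eqP: gi0; apply.
  apply: ccvg_uniq (lim 1 i0 (cmod1 R)) _; apply/ccvgP => e e0.
  have K1 : 0 < K + 1 by rewrite ltr_wpDl.
  have /ccvgP/(_ _ (divr_gt0 e0 K1)) := lim 1 j (cmod1 R); rewrite gj0 => gj.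
  apply: filterS2 gj (small 1 (cmod1 R) _ d0) => s; rewrite !subr0 mul1r ltr_pdivlMr // => q sd.
  have := congr1 (@cmod R) (minors _ i0 j (invr_neq0 (rx0 s)) sd).
  rewrite invrK !cmodM => E; rewrite -(ltr_pM2l (pos s j mj)) E.
  apply: le_lt_trans (ler_wpM2r (cmod_ge0 _) (HK _ (x1 s))) _.
  rewrite mulrAC mulrC ltr_pM2l ?pos //; apply: le_lt_trans q.
  by rewrite mulrC ler_wpM2l ?cmod_ge0 // lerDl.
pose a : 'I_n.+1 := Ordinal (ltnW mn : (m < n.+1)%N).
pose b : 'I_n.+1 := Ordinal (mn : (m.+1 < n.+1)%N).
have ga : g a 0 != 0 by apply: gne.
have gb : g b 0 != 0 by apply: gne; exact: leqnSn.
have w1 : cmod w = 1 by exact: cmod_cis.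
have wV1 : cmod w^-1 = 1 by rewrite cmodV w1 invr1.
(* rotating the argument multiplies the ratio of the coordinates m and m+1 by
   the root of unity, but not its limit *)
have cross s : cmod (1 * (rc (x s))^-1) < d ->
    w * (g a (w^-1 * (rc (x s))^-1) * g b (1 * (rc (x s))^-1)) =
    g b (w^-1 * (rc (x s))^-1) * g a (1 * (rc (x s))^-1).
  rewrite mul1r => sd; have rxV := invr_neq0 (rx0 s).
  have wx0 : w^-1 * (rc (x s))^-1 != 0 by rewrite mulf_neq0 // c0.
  have wxd : cmod (w^-1 * (rc (x s))^-1) < d by rewrite cmodM wV1 mul1r.
  have e1 := minors _ a b rxV sd; have := minors _ a b wx0 wxd.
  rewrite invfM !invrK in e1 *; rewrite !rot /= exprS => e2.
  have pa : f a (rc (x s)) != 0 by rewrite -cmod_gt0 pos.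
  have pb : f b (rc (x s)) != 0 by rewrite -cmod_gt0 pos //= leqnSn.
  have wm : w ^+ m != 0 by rewrite expf_neq0 // c0.
  apply: (mulfI (mulf_neq0 wm (mulf_neq0 pa pb))).
  transitivity ((w * w ^+ m * f b (rc (x s)) * g a (w^-1 / rc (x s))) *
    (f a (rc (x s)) * g b (rc (x s))^-1)); first by ring.
  by rewrite e2 -e1; ring.
have L1 := ccvgM (ccvg_cst w) (ccvgM (lim w^-1 a wV1) (lim 1 b (cmod1 R))).
have L2 := ccvgM (lim w^-1 b wV1) (lim 1 a (cmod1 R)).
have L : w * (g a 0 * g b 0) = g b 0 * g a 0.
  apply: ccvg_uniq L1 _; apply/ccvgP => e e0.
  move/ccvgP: L2 => /(_ e e0) L2; apply: filterS2 L2 (small 1 (cmod1 R) _ d0) => s h sd.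
  by rewrite cross.
have := root_of_unity_neq1; rewrite -subr_eq0 => /eqP; apply.
apply: (mulIf (mulf_neq0 ga gb)); rewrite mul0r mulrBl mul1r L; ring.
Unshelve. all: by end_near.
Qed.

(** The derivative of order [j] at 0 of the combination is [c j]. *)
Lemma fundamental_free : linearly_independent f.
Proof.
case: Hf => ef _ jet c H j.
have z : (fun z => \sum_i c i * f i z) = (fun=> 0) by apply/funext.
have d i : derive1n i (fun=> (0 : C)) = (fun=> 0) :> (C -> C).
  elim: i => [//|i ih]; rewrite derive1nS ih; apply/funext => u.
  by rewrite derive1E derive_val.
have := congr1 (fun h => derive1n j h 0) z; rewrite d derive1n_lincomb //.
rewrite (bigD1 j) //= jet eqxx mulr1 big1 ?addr0 // => i ij.
by rewrite jet eq_sym (negbTE ij) mulr0.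
Qed.

(** Two reduced representations are proportional at every point, so a linear
relation for one of them is a relation for the other. *)
Lemma representation_nondegenerate (F : C -> projspace R n) :
  reduced_representation f F -> linearly_nondegenerate F.
Proof.
move=> [_ _ fF] g [_ _ gF] c H; apply: fundamental_free => z.
have [a /rowP e] := line_scale (etrans (esym (fF z)) (gF z)).
transitivity (a * \sum_j c j * g j z); last by rewrite H mulr0.
by rewrite mulr_sumr; apply: eq_bigr => j _; have := e j; rewrite !mxE => ->; ring.
Qed.

End ProjectiveCurve.

Lemma fundamental_curve (R : realType) (n q k : nat) (f : 'I_n.+1 -> Cplx R -> Cplx R) :
  (2 <= q <= n.+1)%N -> fundamental_solutions (n.+1 - q)%N k f ->
  exists F : Cplx R -> projspace R n,
    [/\ holomorphic_curve F, reduced_representation f F, transcendental_curve F &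
        linearly_nondegenerate F].
Proof.
move=> hq Hf; have [ef _ _] := Hf.
have fne z : exists j, f j z != 0.
  have [a /(_ ord0)] := prescribed_jet hq Hf z (fun=> 1).
  rewrite (eq_bigr (fun j => a j * f j z)) // => e; apply: contrapT => H; have := oner_neq0 (Cplx R).
  rewrite -e big1 ?eqxx // => j _; have [->|h] := eqVneq (f j z) 0; first by rewrite mulr0.
  by case: H; exists j.
have rne z : \row_j f j z != 0 :> 'rV[Cplx R]_n.+1.
  have [j h] := fne z; apply: contraNneq h => /rowP/(_ j); rewrite !mxE => ->; exact: eqxx.
pose F z := proj_point (rne z); exists F.
have fF : reduced_representation f F by [].
have mn : ((n.+1 - q).+1 <= n)%N by move: hq => /andP[]; lia.
split => //.
- by move=> z0; exists f; near=> z; split => // j; exact: ef.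
- apply: (@fundamental_not_rational R n (n.+1 - q) k (q + k) mn _ f Hf) fF.
    by rewrite (leq_trans _ (leq_addr _ _)) //; case/andP: hq.
  exact: (fundamental_rotation hq Hf).
- exact: representation_nondegenerate Hf F fF.
Unshelve. all: by end_near.
Qed.

Theorem proposition8p2 (R : realType) (n q k m : nat) (beta rho : R)
    (hn : (1 <= n)%N) (hq : (2 <= q <= n.+1)%N)
    (hm : m = (n.+1 - q)%N)
    (hbeta : beta = k%:R / q%:R) (hrho : rho = 1 + beta) :
  (exists f : 'I_n.+1 -> Cplx R -> Cplx R, fundamental_solutions m k f) /\
  (forall f : 'I_n.+1 -> Cplx R -> Cplx R, fundamental_solutions m k f ->
     [/\ exists F : Cplx R -> projspace R n,
           [/\ holomorphic_curve F,
               reduced_representation f F,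
               transcendental_curve F &
               linearly_nondegenerate F],
         forall z : Cplx R, wronskian f z = 1 &
         characteristic f r /
           (q%:R * sin (pi / q%:R) / (pi * rho) * r `^ rho)
           @[r --> +oo] --> (1 : R)]).
Proof.
subst m beta rho; split.
  by apply: existence_fundamental; case/andP: hq => q2 _; lia.
move=> f Hf; split.
- exact: fundamental_curve hq Hf.
- exact: (fundamental_wronskian hq Hf).
- exact: (characteristic_asymptotics hq Hf).
Qed.
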